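(* Let $\mathcal{C}$ be a triangulated category with small products and $\mathcal{C}'$ a triangulated category with small coproducts. Let $\mathcal{C}_0$ be an essentially small triangulated category that is a common full triangulated subcategory of $\mathcal{C}$ and $\mathcal{C}'$ and whose objects are compact in $\mathcal{C}'$ and cocompact in $\mathcal{C}$. Let $P$ be a set of objects of $\mathcal{C}_0$, $M\in\mathrm{Obj}\,\mathcal{C}$, $N\in\mathrm{Obj}\,\mathcal{C}'$. For each $X\in\mathrm{Obj}\,\mathcal{C}$ denote by $H^X$ the coextension to $\mathcal{C}'$ of the restriction to $\mathcal{C}_0$ of the functor $\mathcal{C}(X,-)$; denote by $\Phi$ the pairing $\mathcal{C}^{op}\times\mathcal{C}'\to\mathrm{Ab}$, $\Phi(X,Y)=H^X(Y)$. Then the following statements are valid. 1. $\Phi$ is a nice duality of triangulated categories. 2. Denote by $\mathcal{E}$ the colocalizing triangulated subcategory of $\mathcal{C}$ cogenerated by $\mathrm{Obj}\,\mathcal{C}_0$. Then there exists a left adjoint $L$ to the embedding $\mathcal{E}\to\mathcal{C}$, and $\Phi(-,-)\cong\Phi^{\mathcal{E}}(L(-),-)$, where $\Phi^{\mathcal{E}}$ is the restriction of $\Phi$ to $\mathcal{E}^{op}\times\mathcal{C}'$. 3. Assume that $M$ is a $\mathcal{C}_0$-limit of some $(M_l)$. Then $\Phi(M,N)\cong\varinjlim\Phi(M_l,N)$. In particular, the functor $\Phi(-,N)$ converts $\mathcal{C}$-products into coproducts of abelian groups. 4. Assume that $N$ is a $\mathcal{C}_0$-colimit of some $(N_l)$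 in $\mathcal{C}'$. Then $\Phi(M,N)\cong\varinjlim\Phi(M,N_l)$. In particular, the functor $\Phi(M,-):\mathcal{C}'\to\mathrm{Ab}$ is a homological functor that respects coproducts. 5. $\Phi$ is determined (among dualities, up to a canonical isomorphism) by the following conditions: it converts $\mathcal{C}$-products and $\mathcal{C}'$-coproducts into direct sums of abelian groups, its restriction to $\mathcal{C}_0^{op}\times\mathcal{C}_0$ equals $\mathcal{C}_0(-,-)$, and it annihilates both ${}^{\perp_{\mathcal{C}}}\mathcal{C}_0\times\mathrm{Obj}\,\mathcal{C}'$ and $\mathrm{Obj}\,\mathcal{C}\times\mathcal{C}_0^{\perp_{\mathcal{C}'}}$. 6. There exists a smashing torsion pair $s'=(\mathcal{LO}',\mathcal{RO}')$ for $\mathcal{C}'$ such that $\mathcal{LO}'$ is the $\mathcal{C}'$-strong extension-closure of $P$ and $\mathcal{RO}'=P^{\perp_{\mathcal{C}'}}$. 7. There exists a cosmashing torsion pair $s=(\mathcal{LO},\mathcal{RO})$ for $\mathcal{C}$ such that $\mathcal{LO}={}^{\perp_{\mathcal{C}}}P$ and $\mathcal{RO}$ is the strong extension-closure of $P$ in $\mathcal{C}^{op}$. Moreover, $s$ restricts to a torsion pair $s_{\mathcal{E}}=(\mathcal{LO}_{\mathcal{E}},\mathcal{RO}_{\mathcal{E}})=(\mathcal{LO}\cap\mathrm{Obj}\,\mathcal{E},\mathcal{RO}\cap\mathrm{Obj}\,\mathcal{E})$ for $\mathcal{E}$. 8. The torsion pairs $s$ and $s_{\mathcal{E}}$ are (respectively)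 left $\Phi$-orthogonal and left $\Phi^{\mathcal{E}}$-orthogonal to $s'$. Moreover, $\mathcal{LO}={}^{\perp_{\Phi}}(\mathcal{LO}')$ and $\mathcal{LO}_{\mathcal{E}}={}^{\perp_{\Phi^{\mathcal{E}}}}(\mathcal{LO}')$. 9. Both $\mathcal{LO}'\cap\mathrm{Obj}\,\mathcal{C}_0$ and $\mathcal{RO}\cap\mathrm{Obj}\,\mathcal{C}_0$ are equal to the $\mathcal{C}_0$-envelope of $P$.
   Context: Orthogonals: in a triangulated category $\mathcal{D}$, $S^{\perp_{\mathcal{D}}}=\{Y:\mathcal{D}(X,Y)=0\ \forall X\in S\}$, ${}^{\perp_{\mathcal{D}}}S=\{Y:\mathcal{D}(Y,X)=0\ \forall X\in S\}$. For a pairing $\Phi$, ${}^{\perp_{\Phi}}(S)$ is the class of objects $X$ of the first category with $\Phi(X,Y)=0$ for all $Y\in S$. An object $C$ of $\mathcal{C}'$ is compact if $\mathcal{C}'(C,-)$ respects small coproducts; an object $C$ of $\mathcal{C}$ is cocompact if $\mathcal{C}(-,C)$ converts small products into coproducts. Coextension: let $H_0:\mathcal{C}_0\to\mathrm{Ab}$ be a homological functor. For $Y\in\mathrm{Obj}\,\mathcal{C}'$ choose an exact sequence $\coprod_i\mathcal{C}_0(-,C^i)\to\coprod_j\mathcal{C}_0(-,C^j)\to\mathcal{C}'(-,Y)|_{\mathcal{C}_0}\to 0$ of additive functors $\mathcal{C}_0^{op}\to\mathrm{Ab}$, with families $C^i,C^j$ of objects of $\mathcal{C}_0$, and put $H(Y)=\mathrm{Coker}(\coprod_iH_0(C^i)\to\coprod_jH_0(C^j))$;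 $H:\mathcal{C}'\to\mathrm{Ab}$ is a well-defined homological functor (the left Kan extension of $H_0$), called the coextension of $H_0$. Duality: a bifunctor $\Phi:\mathcal{C}^{op}\times\mathcal{C}'\to\mathrm{Ab}$ that is homological in both arguments (contravariant in the first, covariant in the second) and is equipped with a natural isomorphism $\Phi(A,Y)\cong\Phi(A[1],Y[1])$. It is nice if for all distinguished triangles $A\xrightarrow{l}B\xrightarrow{m}C\xrightarrow{n}A[1]$ in $\mathcal{C}$ and $X\xrightarrow{f}Y\xrightarrow{g}Z\xrightarrow{h}X[1]$ in $\mathcal{C}'$ the projection from $\mathrm{Ker}\big(\Phi(A,X)\oplus\Phi(B,Y)\oplus\Phi(C,Z)\to\Phi(A,Y)\oplus\Phi(B,Z)\oplus\Phi(C[-1],X)\big)$, where the map is $(a,b,c)\mapsto(f_*a-l^*b,\ g_*b-m^*c,\ h_*c-(n[-1])^*a)$ (using $\Phi(C,X[1])\cong\Phi(C[-1],X)$), to $\mathrm{Ker}\big(\Phi(A,X)\oplus\Phi(B,Y)\to\Phi(A,Y)\big)$, $(a,b)\mapsto f_*a-l^*b$, is epimorphic. The colocalizing subcategory of $\mathcal{C}$ cogenerated by a class $S$ is the smallest full strict triangulated subcategory containing $S$ and closed under $\mathcal{C}$-products. $\mathcal{C}_0$-colimits and limits: for a small diagram $(N_l)$ in $\mathcal{C}'$ and $N$ equipped with compatible morphisms $N_l\to N$, $N$ is a $\mathcal{C}_0$-colimit of $(N_l)$ if $\varinjlim\mathcal{C}'(Y,N_l)\to\mathcal{C}'(Y,N)$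 is an isomorphism for all $Y\in\mathrm{Obj}\,\mathcal{C}_0$. Dually, for a small diagram $(M_l)$ in $\mathcal{C}$ and $M$ with compatible morphisms $M\to M_l$, $M$ is a $\mathcal{C}_0$-limit of $(M_l)$ if $\varinjlim\mathcal{C}(M_l,Y)\to\mathcal{C}(M,Y)$ is an isomorphism for all $Y\in\mathrm{Obj}\,\mathcal{C}_0$. A torsion pair for $\mathcal{D}$ is a couple $(\mathcal{LO},\mathcal{RO})$ of classes of objects with $\mathcal{LO}^{\perp}=\mathcal{RO}$, $\mathcal{LO}={}^{\perp}\mathcal{RO}$, and such that every object $M$ fits in a distinguished triangle $L\to M\to R\to L[1]$ with $L\in\mathcal{LO}$, $R\in\mathcal{RO}$. It is smashing if $\mathcal{D}$ has coproducts and $\mathcal{RO}$ is closed under them; cosmashing if $\mathcal{D}$ has products and $\mathcal{LO}$ is closed under them. A torsion pair $s=(\mathcal{LO},\mathcal{RO})$ for $\mathcal{C}$ is left $\Phi$-orthogonal to a torsion pair $s'=(\mathcal{LO}',\mathcal{RO}')$ for $\mathcal{C}'$ if $\Phi(X,Y)=0$ whenever $X\in\mathcal{LO},Y\in\mathcal{LO}'$ or $X\in\mathcal{RO},Y\in\mathcal{RO}'$. Strong extension-closure in a triangulated category $\mathcal{D}$ with coproducts: for a sequence $Y_0\xrightarrow{\phi_0}Y_1\xrightarrow{\phi_1}\cdots$ the homotopy colimit $\varinjlim Y_i$ is a cone of $\coprod_iY_i\to\coprod_iY_i$ whose restriction to $Y_i$ is $\mathrm{id}_{Y_i}-\phi_i:Y_i\to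 Y_i\oplus Y_{i+1}$. A class $Q$ is strongly extension-closed if $0\in Q$ and $\varinjlim Y_i\in Q$ whenever $Y_0\in Q$ and $\mathrm{Cone}(\phi_i)\in Q$ for all $i\ge 0$. The strong extension-closure of $P$ is the smallest strongly extension-closed class that contains $P$ and is closed under retracts and small coproducts. The $\mathcal{C}_0$-envelope of $P$ is the smallest class of objects of $\mathcal{C}_0$ that contains $P$ and $0$ and is closed under extensions and under retracts in $\mathcal{C}_0$. *)

(* Defs.v *)
From HB Require Import structures.
From mathcomp Require Import all_boot all_algebra.
From mathcomp Require Import boolp classical_sets functions cardinality fsbigop.

Set Implicit Arguments.
Unset Strict Implicit.
Unset Printing Implicit Defensive.

Import GRing.Theory.
Local Open Scope ring_scope.

(* Size conventions: groups of morphisms are zmodTypes and "small" sets are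
   choiceTypes. The carriers of both live in the same universe, while the
   objects of a category live in an unrelated one; by classical choice every
   type of that universe is (the carrier of) a choiceType. *)

Record preadditive := Preadditive {
  Ob :> Type;
  Mor : Ob -> Ob -> zmodType;
  idm : forall X, Mor X X;
  comp : forall X Y Z, Mor Y Z -> Mor X Y -> Mor X Z;
  comp1m : forall X Y (f : Mor X Y), comp (idm Y) f = f;
  compm1 : forall X Y (f : Mor X Y), comp f (idm X) = f;
  compA : forall X Y Z T (h : Mor Z T) (g : Mor Y Z) (f : Mor X Y),
    comp h (comp g f) = comp (comp h g) f;
  compDl : forall X Y Z (g g' : Mor Y Z) (f : Mor X Y),
    comp (g + g') f = comp g f + comp g' f;
  compDr : forall X Y Z (g : Mor Y Z) (f f' : Mor X Y),
    comp g (f + f') = comp g f + comp g f' }.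

Declare Scope cat_scope.
Delimit Scope cat_scope with C.
Notation "g ∘ f" := (comp g f) (at level 40, left associativity) : cat_scope.
Local Open Scope cat_scope.

Record iso (C : preadditive) (X Y : C) := Iso {
  iso_to : Mor X Y;
  iso_from : Mor Y X;
  iso_toK : iso_from ∘ iso_to = idm X;
  iso_fromK : iso_to ∘ iso_from = idm Y }.

(* Functors between preadditive categories are additive. *)
Record functor (C D : preadditive) := Functor {
  fob :> C -> D;
  fmap : forall X Y : C, Mor X Y -> Mor (fob X) (fob Y);
  fmap1 : forall X, fmap (idm X) = idm (fob X);
  fmapM : forall X Y Z (g : Mor Y Z) (f : Mor X Y),
    fmap (g ∘ f) = fmap g ∘ fmap f;
  fmapD : forall X Y (f g : Mor X Y), fmap (f + g) = fmap f + fmap g }.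

Definition idf (C : preadditive) : functor C C :=
  @Functor C C id (fun X Y f => f)
    (fun _ => erefl) (fun _ _ _ _ _ => erefl) (fun _ _ _ _ => erefl).

Definition fully_faithful (C D : preadditive) (F : functor C D) :=
  forall X Y : C, bijective (@fmap C D F X Y).

Definition is_left_adjoint (C D : preadditive)
    (L : functor C D) (G : functor D C) :=
  exists eta : forall X : C, Mor X (G (L X)),
    (forall (X X' : C) (f : Mor X X'),
       eta X' ∘ f = fmap G (fmap L f) ∘ eta X) /\
    (forall (X : C) (Y : D) (f : Mor X (G Y)),
       exists! g : Mor (L X) Y, fmap G g ∘ eta X = f).

Definition op (C : preadditive) : preadditive :=
  @Preadditive C (fun X Y => @Mor C Y X) (@idm C)
    (fun X Y Z g f => comp f g)
    (fun X Y f => compm1 f) (fun X Y f => comp1m f)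
    (fun X Y Z T h g f => esym (compA f g h))
    (fun X Y Z g g' f => compDr f g g') (fun X Y Z g f f' => compDl f f' g).

Definition op_functor (C D : preadditive) (F : functor C D) :
    functor (op C) (op D) :=
  @Functor (op C) (op D) F (fun X Y f => fmap F f)
    (fmap1 F) (fun X Y Z g f => fmapM F f g) (fun X Y f g => fmapD F f g).

Definition op_iso (C : preadditive) (X Y : C) (i : iso X Y) :
    @iso (op C) X Y :=
  @Iso (op C) X Y (iso_from i) (iso_to i) (iso_toK i) (iso_fromK i).

Definition is_zero (C : preadditive) (Z : C) := idm Z = 0.

Definition is_coproduct (C : preadditive) (I : choiceType) (X : I -> C)
    (S : C) (inj : forall i, Mor (X i) S) :=
  forall (T : C) (f : forall i, Mor (X i) T),
    exists! h : Mor S T, forall i, h ∘ inj i = f i.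

Definition has_coproducts (C : preadditive) :=
  forall (I : choiceType) (X : I -> C), exists S inj, @is_coproduct C I X S inj.

Definition has_products (C : preadditive) := has_coproducts (op C).

Definition closed_coproducts (C : preadditive) (Q : C -> Prop) :=
  forall (I : choiceType) (X : I -> C) S inj,
    @is_coproduct C I X S inj -> (forall i, Q (X i)) -> Q S.

Definition closed_products (C : preadditive) (Q : C -> Prop) :=
  @closed_coproducts (op C) Q.

Definition closed_retracts (C : preadditive) (Q : C -> Prop) :=
  forall (X Y : C) (i : Mor X Y) (r : Mor Y X),
    r ∘ i = idm X -> Q Y -> Q X.

Definition rperp (C : preadditive) (S : C -> Prop) (Y : C) :=
  forall X, S X -> forall f : Mor X Y, f = 0.

Definition lperp (C : preadditive) (S : C -> Prop) (Y : C) :=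
  forall X, S X -> forall f : Mor Y X, f = 0.

Definition essentially_small (C : preadditive) :=
  exists (I : choiceType) (s : I -> C), forall X, exists i, inhabited (iso X (s i)).

(* The class of the objects [x i]. *)
Definition image_class (I A : Type) (x : I -> A) (a : A) := exists i, a = x i.

Definition full_sub (C : preadditive) (E : C -> Prop) : preadditive :=
  @Preadditive {X : C | E X} (fun X Y => @Mor C (sval X) (sval Y))
    (fun X => idm (sval X)) (fun X Y Z g f => comp g f)
    (fun X Y f => comp1m f) (fun X Y f => compm1 f)
    (fun X Y Z T h g f => compA h g f)
    (fun X Y Z g g' f => compDl g g' f) (fun X Y Z g f f' => compDr g f f').

(* Restriction of an endofunctor to a full subcategory that it preserves. *)
Definition full_sub_functor (C : preadditive) (E : C -> Prop) (F : functor C C)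
    (EF : forall X, E X -> E (F X)) : functor (full_sub E) (full_sub E) :=
  @Functor (full_sub E) (full_sub E)
    (fun X => exist E (F (sval X)) (EF _ (svalP X))) (fun X Y f => fmap F f)
    (fun X => fmap1 F (sval X)) (fun X Y Z g f => fmapM F g f)
    (fun X Y f g => fmapD F f g).

(* [sh] is X |-> X[1] and [unsh] is X |-> X[-1]; these are only required to be
   mutually inverse up to the isomorphisms [sh_unsh] and [unsh_sh]. *)
Record tridata := TriData {
  tbase :> preadditive;
  sh : functor tbase tbase;
  unsh : functor tbase tbase;
  sh_unsh : forall X : tbase, iso (sh (unsh X)) X;
  unsh_sh : forall X : tbase, iso (unsh (sh X)) X;
  dist : forall X Y Z : tbase, Mor X Y -> Mor Y Z -> Mor Z (sh X) -> Prop }.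
Arguments sh {_}.
Arguments unsh {_}.
Arguments sh_unsh {_}.
Arguments unsh_sh {_}.
Arguments dist {_ _ _ _}.

(* n[-1] : C[-1] -> A for n : C -> A[1]. *)
Definition unsh_hom (D : tridata) (C A : D) (n : Mor C (sh A)) : Mor (unsh C) A :=
  iso_to (unsh_sh A) ∘ fmap unsh n.

Record is_triangulated (D : tridata) : Prop := IsTriangulated {
  tri_zero : exists Z : D, is_zero Z;
  tri_biproduct : forall X Y : D,
    exists (S : D) (i : Mor X S) (j : Mor Y S) (p : Mor S X) (q : Mor S Y),
      [/\ p ∘ i = idm X, q ∘ j = idm Y & i ∘ p + j ∘ q = idm S];
  tri_sh_unsh_nat : forall (X Y : D) (f : Mor X Y),
    iso_to (sh_unsh Y) ∘ fmap sh (fmap unsh f) = f ∘ iso_to (sh_unsh X);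
  tri_unsh_sh_nat : forall (X Y : D) (f : Mor X Y),
    iso_to (unsh_sh Y) ∘ fmap unsh (fmap sh f) = f ∘ iso_to (unsh_sh X);
  tri_sh_adj : forall X : D,
    fmap sh (iso_to (unsh_sh X)) = iso_to (sh_unsh (sh X));
  tri_iso : forall (X Y Z X' Y' Z' : D)
      (f : Mor X Y) (g : Mor Y Z) (h : Mor Z (sh X))
      (f' : Mor X' Y') (g' : Mor Y' Z') (h' : Mor Z' (sh X'))
      (a : iso X X') (b : iso Y Y') (c : iso Z Z'),
    f' ∘ iso_to a = iso_to b ∘ f -> g' ∘ iso_to b = iso_to c ∘ g ->
    h' ∘ iso_to c = fmap sh (iso_to a) ∘ h -> dist f g h -> dist f' g' h';
  tri_id : forall X Z : D, is_zero Z -> dist (idm X) (0 : Mor X Z) 0;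
  tri_cone : forall (X Y : D) (f : Mor X Y),
    exists (Z : D) (g : Mor Y Z) (h : Mor Z (sh X)), dist f g h;
  tri_rot : forall (X Y Z : D) (f : Mor X Y) (g : Mor Y Z) (h : Mor Z (sh X)),
    dist f g h <-> dist g h (- fmap sh f);
  tri_mor : forall (X Y Z X' Y' Z' : D)
      (f : Mor X Y) (g : Mor Y Z) (h : Mor Z (sh X))
      (f' : Mor X' Y') (g' : Mor Y' Z') (h' : Mor Z' (sh X'))
      (a : Mor X X') (b : Mor Y Y'),
    dist f g h -> dist f' g' h' -> f' ∘ a = b ∘ f ->
    exists c : Mor Z Z', g' ∘ b = c ∘ g /\ h' ∘ c = fmap sh a ∘ h;
  tri_oct : forall (X Y Z X' Y' Z' : D) (f : Mor X Y) (g : Mor Y Z)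
      (a : Mor Y Z') (b : Mor Z' (sh X)) (c : Mor Z X') (d : Mor X' (sh Y))
      (p : Mor Z Y') (q : Mor Y' (sh X)),
    dist f a b -> dist g c d -> dist (g ∘ f) p q ->
    exists (u : Mor Z' Y') (v : Mor Y' X'),
      [/\ dist u v (fmap sh a ∘ d), u ∘ a = p ∘ g, q ∘ u = b,
          v ∘ p = c & d ∘ v = fmap sh f ∘ q] }.

Record triangulated := Triangulated {
  tdata :> tridata;
  tdataP : is_triangulated tdata }.

(* The opposite category, with shift [unsh]: a triangle A -> B -> C -> A[-1] of
   the opposite category comes from A[-1] -> C -> B -> A in the original one,
   i.e. from the triangle C -> B -> A -> C[1]. *)
Definition op_tri (D : tridata) : tridata :=
  @TriData (op D) (op_functor unsh) (op_functor sh)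
    (fun X => op_iso (unsh_sh X)) (fun X => op_iso (sh_unsh X))
    (fun A B C (f : @Mor D B A) (g : @Mor D C B) (h : @Mor D (unsh A) C) =>
       dist g f (fmap sh h ∘ iso_from (sh_unsh A))).

Record tri_functor (C D : tridata) := TriFunctor {
  tfun :> functor C D;
  tfun_sh : forall X : C, iso (tfun (sh X)) (sh (tfun X));
  tfun_sh_nat : forall (X Y : C) (f : Mor X Y),
    iso_to (tfun_sh Y) ∘ fmap tfun (fmap sh f) =
    fmap sh (fmap tfun f) ∘ iso_to (tfun_sh X);
  tfun_dist : forall (X Y Z : C) (f : Mor X Y) (g : Mor Y Z) (h : Mor Z (sh X)),
    dist f g h ->
    dist (fmap tfun f) (fmap tfun g) (iso_to (tfun_sh X) ∘ fmap tfun h) }.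

Record is_colocalizing (D : tridata) (E : D -> Prop) : Prop := IsColocalizing {
  coloc_strict : forall X Y : D, iso X Y -> E X -> E Y;
  coloc_zero : forall Z : D, is_zero Z -> E Z;
  coloc_sh : forall X : D, E X -> E (sh X);
  coloc_unsh : forall X : D, E X -> E (unsh X);
  coloc_cone : forall (X Y Z : D) (f : Mor X Y) (g : Mor Y Z) (h : Mor Z (sh X)),
    dist f g h -> E X -> E Y -> E Z;
  coloc_products : closed_products E }.

Definition cogenerated (D : tridata) (S : D -> Prop) (X : D) :=
  forall E : D -> Prop, is_colocalizing E -> (forall Y, S Y -> E Y) -> E X.

Lemma cogenerated_sh (D : tridata) (S : D -> Prop) (X : D) :
  cogenerated S X -> cogenerated S (sh X).
Proof. by move=> cX E Eco SE; apply: (coloc_sh Eco); exact: cX. Qed.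

Lemma cogenerated_unsh (D : tridata) (S : D -> Prop) (X : D) :
  cogenerated S X -> cogenerated S (unsh X).
Proof. by move=> cX E Eco SE; apply: (coloc_unsh Eco); exact: cX. Qed.

Definition sub_iso (C : preadditive) (E : C -> Prop) (X Y : full_sub E)
    (i : iso (sval X) (sval Y)) : iso X Y :=
  @Iso (full_sub E) X Y (iso_to i) (iso_from i) (iso_toK i) (iso_fromK i).

(* The colocalizing subcategory cogenerated by S. *)
Definition colocalizing_sub (D : tridata) (S : D -> Prop) : tridata :=
  @TriData (full_sub (cogenerated S))
    (full_sub_functor (@cogenerated_sh D S))
    (full_sub_functor (@cogenerated_unsh D S))
    (fun X => @sub_iso D _ (exist _ (sh (unsh (sval X))) _) X (sh_unsh (sval X)))
    (fun X => @sub_iso D _ (exist _ (unsh (sh (sval X))) _) X (unsh_sh (sval X)))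
    (fun X Y Z (f : @Mor D (sval X) (sval Y)) (g : @Mor D (sval Y) (sval Z))
         (h : @Mor D (sval Z) (sh (sval X))) => dist f g h).

Definition colocalizing_incl (D : tridata) (S : D -> Prop) :
    functor (colocalizing_sub S) D :=
  @Functor (colocalizing_sub S) D (fun X => sval X) (fun X Y f => f)
    (fun _ => erefl) (fun _ _ _ _ _ => erefl) (fun _ _ _ _ => erefl).

Definition torsion_pair (D : tridata) (LO RO : D -> Prop) :=
  [/\ forall Y, RO Y <-> rperp LO Y,
      forall X, LO X <-> lperp RO X &
      forall M : D, exists (L R : D) (f : Mor L M) (g : Mor M R) (h : Mor R (sh L)),
        [/\ LO L, RO R & dist f g h]].

Definition smashing (D : tridata) (LO RO : D -> Prop) :=
  [/\ torsion_pair LO RO, has_coproducts D & closed_coproducts RO].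

Definition cosmashing (D : tridata) (LO RO : D -> Prop) :=
  [/\ torsion_pair LO RO, has_products D & closed_products LO].

Definition is_hocolim (D : tridata) (Y : nat -> D)
    (phi : forall i, Mor (Y i) (Y i.+1)) (T : D) :=
  exists (S : D) (inj : forall i, Mor (Y i) S) (d : Mor S S)
         (g : Mor S T) (h : Mor T (sh S)),
    [/\ is_coproduct inj,
        forall i, d ∘ inj i = inj i - inj i.+1 ∘ phi i & dist d g h].

Definition strongly_ext_closed (D : tridata) (Q : D -> Prop) :=
  (forall Z : D, is_zero Z -> Q Z) /\
  (forall (Y : nat -> D) (phi : forall i, Mor (Y i) (Y i.+1)) (T : D),
     Q (Y 0%N) ->
     (forall i, exists (Z : D) (g : Mor (Y i.+1) Z) (h : Mor Z (sh (Y i))),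
        dist (phi i) g h /\ Q Z) ->
     is_hocolim phi T -> Q T).

Definition strong_ext_closure (D : tridata) (P : D -> Prop) (X : D) :=
  forall Q : D -> Prop,
    strongly_ext_closed Q -> closed_retracts Q -> closed_coproducts Q ->
    (forall Y, P Y -> Q Y) -> Q X.

Definition envelope (D : tridata) (P : D -> Prop) (X : D) :=
  forall Q : D -> Prop,
    (forall Z : D, is_zero Z -> Q Z) -> closed_retracts Q ->
    (forall (A B C : D) (f : Mor A B) (g : Mor B C) (h : Mor C (sh A)),
       dist f g h -> Q A -> Q C -> Q B) ->
    (forall Y, P Y -> Q Y) -> Q X.

(* Small diagrams are indexed by quivers: a functor from a small category is in
   particular a diagram on the underlying quiver, with the same (co)cones, and a
   diagram on a quiver is a functor from the free category on this quiver. *)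
Record quiver := Quiver {
  vertex : choiceType;
  arrow : vertex -> vertex -> choiceType }.

Definition op_quiver (Q : quiver) := @Quiver (vertex Q) (fun u v => arrow v u).

Record diagram (Q : quiver) (C : preadditive) := Diagram {
  dob :> vertex Q -> C;
  dmap : forall u v, arrow u v -> Mor (dob u) (dob v) }.

Definition is_ab_colimit (Q : quiver) (A : vertex Q -> zmodType)
    (m : forall u v, arrow u v -> A u -> A v)
    (S : zmodType) (inj : forall v, A v -> S) :=
  [/\ forall v, GRing.zmod_morphism (inj v),
      forall u v (e : arrow u v) x, inj v (m u v e x) = inj u x &
      forall (T : zmodType) (g : forall v, A v -> T),
        (forall v, GRing.zmod_morphism (g v)) ->
        (forall u v (e : arrow u v) x, g v (m u v e x) = g u x) ->
        exists! h : S -> T,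
          GRing.zmod_morphism h /\ forall v x, h (inj v x) = g v x].

Definition is_ab_coproduct (I : choiceType) (A : I -> zmodType)
    (S : zmodType) (inj : forall i, A i -> S) :=
  @is_ab_colimit (@Quiver I (fun _ _ => void)) A
    (fun _ _ e => match e with end) S inj.

Record ab_functor (C : preadditive) := AbFunctor {
  aob :> C -> zmodType;
  amap : forall X Y : C, Mor X Y -> aob X -> aob Y;
  amapB : forall X Y (f : Mor X Y), GRing.zmod_morphism (amap f);
  amap1 : forall X x, amap (idm X) x = x;
  amapM : forall X Y Z (g : Mor Y Z) (f : Mor X Y) x,
    amap (g ∘ f) x = amap g (amap f x);
  amapD : forall X Y (f g : Mor X Y) x, amap (f + g) x = amap f x + amap g x }.

Arguments amap {C} _ {X Y} f x.

Definition homological (D : tridata) (F : ab_functor D) :=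
  forall (X Y Z : D) (f : Mor X Y) (g : Mor Y Z) (h : Mor Z (sh X)),
    dist f g h -> forall y : F Y, amap F g y = 0 <-> exists x, y = amap F f x.

Definition respects_coproducts (C : preadditive) (F : ab_functor C) :=
  forall (I : choiceType) (X : I -> C) S inj, @is_coproduct C I X S inj ->
    @is_ab_coproduct I (fun i => F (X i)) (F S) (fun i => amap F (inj i)).

(* Bifunctors to abelian groups, contravariant in the first argument and
   covariant in the second one. *)
Record pairing (C C' : preadditive) := Pairing {
  pob :> C -> C' -> zmodType;
  pl : forall (X X' : C) (Y : C'), Mor X' X -> pob X Y -> pob X' Y;
  pr : forall (X : C) (Y Y' : C'), Mor Y Y' -> pob X Y -> pob X Y';
  plB : forall X X' Y (f : Mor X' X), GRing.zmod_morphism (@pl X X' Y f);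
  pl1 : forall (X : C) (Y : C') x, @pl X X Y (idm X) x = x;
  plM : forall X X' X'' Y (f : Mor X' X) (f' : Mor X'' X') (x : pob X Y),
    pl (f ∘ f') x = pl f' (pl f x);
  plD : forall X X' Y (f g : Mor X' X) (x : pob X Y),
    pl (f + g) x = pl f x + pl g x;
  prB : forall X Y Y' (g : Mor Y Y'), GRing.zmod_morphism (@pr X Y Y' g);
  pr1 : forall (X : C) (Y : C') x, @pr X Y Y (idm Y) x = x;
  prM : forall X Y Y' Y'' (g : Mor Y' Y'') (f : Mor Y Y') (x : pob X Y),
    pr (g ∘ f) x = pr g (pr f x);
  prD : forall X Y Y' (f g : Mor Y Y') (x : pob X Y),
    pr (f + g) x = pr f x + pr g x;
  plr : forall X X' Y Y' (f : Mor X' X) (g : Mor Y Y') (x : pob X Y),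
    pl f (pr g x) = pr g (pl f x) }.

Definition pairing_r (C C' : preadditive) (Phi : pairing C C') (X : C) :
    ab_functor C' :=
  @AbFunctor C' (Phi X) (fun Y Y' g => pr g)
    (fun Y Y' g => prB g) (@pr1 _ _ Phi X)
    (fun Y Y' Y'' g f x => prM g f x) (fun Y Y' f g x => prD f g x).

Definition pairing_l (C C' : preadditive) (Phi : pairing C C') (Y : C') :
    ab_functor (op C) :=
  @AbFunctor (op C) (fun X => Phi X Y)
    (fun (X X' : C) (f : Mor X' X) => pl f)
    (fun (X X' : C) (f : Mor X' X) => @plB _ _ Phi X X' Y f)
    (fun X : C => @pl1 _ _ Phi X Y)
    (fun (X X' X'' : C) (g : Mor X'' X') (f : Mor X' X) x =>
       @plM _ _ Phi X X' X'' Y f g x)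
    (fun (X X' : C) (f g : Mor X' X) x => @plD _ _ Phi X X' Y f g x).

Definition pull (C C' D D' : preadditive) (F : functor D C) (G : functor D' C')
    (Phi : pairing C C') : pairing D D'.
Proof.
refine (@Pairing D D' (fun X Y => Phi (F X) (G Y))
  (fun X X' Y f => pl (fmap F f)) (fun X Y Y' g => pr (fmap G g))
  _ _ _ _ _ _ _ _ _).
- by move=> X X' Y f; exact: plB.
- by move=> X Y x; rewrite fmap1 pl1.
- by move=> X X' X'' Y f f' x; rewrite fmapM plM.
- by move=> X X' Y f g x; rewrite fmapD plD.
- by move=> X Y Y' g; exact: prB.
- by move=> X Y x; rewrite fmap1 pr1.
- by move=> X Y Y' Y'' g f x; rewrite fmapM prM.
- by move=> X Y Y' f g x; rewrite fmapD prD.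
- by move=> X X' Y Y' f g x; exact: plr.
Defined.

Lemma comp_zmod_r (C : preadditive) (X Y Z : C) (g : Mor Y Z) :
  GRing.zmod_morphism (fun f : Mor X Y => g ∘ f).
Proof.
by move=> f f'; apply: (@addIr _ (g ∘ f')); rewrite -compDr !subrK.
Qed.

Lemma comp_zmod_l (C : preadditive) (X Y Z : C) (f : Mor X Y) :
  GRing.zmod_morphism (fun g : Mor Y Z => g ∘ f).
Proof.
by move=> g g'; apply: (@addIr _ (g' ∘ f)); rewrite -compDl !subrK.
Qed.

Definition hom_pairing (C : preadditive) : pairing C C :=
  @Pairing C C (@Mor C) (fun X X' Y f u => u ∘ f) (fun X Y Y' g u => g ∘ u)
    (fun X X' Y f => comp_zmod_l f) (fun X Y u => compm1 u)
    (fun X X' X'' Y f f' u => compA u f f') (fun X X' Y f g u => compDr u f g)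
    (fun X Y Y' g => comp_zmod_r g) (fun X Y u => comp1m u)
    (fun X Y Y' Y'' g f u => esym (compA g f u))
    (fun X Y Y' f g u => compDl f g u)
    (fun X X' Y Y' f g u => esym (compA g u f)).

Definition compact (C : preadditive) (K : C) :=
  respects_coproducts (pairing_r (hom_pairing C) K).

Definition cocompact (C : preadditive) (K : C) :=
  respects_coproducts (pairing_l (hom_pairing C) K).

Definition pairing_morphism (C C' : preadditive) (Phi Psi : pairing C C')
    (gamma : forall (X : C) (Y : C'), Phi X Y -> Psi X Y) :=
  [/\ forall X Y, GRing.zmod_morphism (gamma X Y),
      forall X X' Y (f : Mor X' X) (x : Phi X Y),
        gamma X' Y (pl f x) = pl f (gamma X Y x) &
      forall X Y Y' (g : Mor Y Y') (x : Phi X Y),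
        gamma X Y' (pr g x) = pr g (gamma X Y x)].

Definition pairing_iso (C C' : preadditive) (Phi Psi : pairing C C')
    (gamma : forall (X : C) (Y : C'), Phi X Y -> Psi X Y) :=
  pairing_morphism gamma /\ forall X Y, bijective (gamma X Y).

Record shift_iso (C C' : tridata) (Phi : pairing C C') := ShiftIso {
  si_to :> forall X Y, Phi X Y -> Phi (sh X) (sh Y);
  si_from : forall X Y, Phi (sh X) (sh Y) -> Phi X Y;
  si_toK : forall X Y, cancel (@si_to X Y) (@si_from X Y);
  si_fromK : forall X Y, cancel (@si_from X Y) (@si_to X Y);
  si_natural : @pairing_morphism C C' Phi (pull sh sh Phi) si_to }.

(* A duality is a pairing Phi together with [sigma : shift_iso Phi] such that
   [is_duality Phi]. *)
Definition is_duality (C C' : tridata) (Phi : pairing C C') :=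
  (forall X : C, homological (pairing_r Phi X)) /\
  (forall (Y : C') (A B D : C) (l : Mor A B) (m : Mor B D) (n : Mor D (sh A)),
     dist l m n ->
     forall b : Phi B Y, pl l b = 0 <-> exists c, b = pl m c).

(* The isomorphism Phi(C, X[1]) = Phi(C[-1], X). *)
Definition desuspend (C C' : tridata) (Phi : pairing C C') (sigma : shift_iso Phi)
    (A : C) (X : C') (y : Phi A (sh X)) : Phi (unsh A) X :=
  si_from sigma (pl (iso_to (sh_unsh A)) y).

Definition is_nice (C C' : tridata) (Phi : pairing C C') (sigma : shift_iso Phi) :=
  forall (A B D : C) (l : Mor A B) (m : Mor B D) (n : Mor D (sh A))
         (X Y Z : C') (f : Mor X Y) (g : Mor Y Z) (h : Mor Z (sh X)),
    dist l m n -> dist f g h ->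
    forall (a : Phi A X) (b : Phi B Y), pr f a - pl l b = 0 ->
      exists c : Phi D Z,
        [/\ pr f a - pl l b = 0, pr g b - pl m c = 0 &
            desuspend sigma (pr h c) - pl (unsh_hom n) a = 0].

(* Elements of the direct sum of a family (A i). *)
Definition fin_supp (I : choiceType) (A : I -> zmodType) (a : forall i, A i) :=
  finite_set [set i | a i != 0]%classic.

(* Exactness of  ⨁_i A i --d--> ⨁_j B j --e--> G --> 0, where d is given by
   a matrix and e by its components. *)
Definition dsum_right_exact (I J : choiceType) (A : I -> zmodType)
    (B : J -> zmodType) (G : zmodType)
    (d : forall i j, A i -> B j) (e : forall j, B j -> G) :=
  (forall x : G, exists b : forall j, B j,
     fin_supp b /\ x = \sum_(j \in setT) e j (b j)) /\
  (forall b : forall j, B j, fin_supp b ->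
     (\sum_(j \in setT) e j (b j) = 0 <->
      exists a : forall i, A i,
        fin_supp a /\ forall j, b j = \sum_(i \in setT) d i j (a i))).

(* H is the coextension of H0 along iota, via alpha : H0 -> H o iota. By Yoneda,
   the maps of ∐_i C0(-, X i) -> ∐_j C0(-, Y j) -> C'(iota -, Z) -> 0 are given
   by a matrix [m] with finitely supported rows and by a family [p]. *)
Definition is_coextension (C0 C' : preadditive) (iota : functor C0 C')
    (H0 : ab_functor C0) (H : ab_functor C')
    (alpha : forall X, H0 X -> H (iota X)) :=
  [/\ forall X, GRing.zmod_morphism (alpha X),
      forall X Y (f : Mor X Y) x,
        alpha Y (amap H0 f x) = amap H (fmap iota f) (alpha X x) &
      forall Z : C', exists (I J : choiceType) (X : I -> C0) (Y : J -> C0)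
          (m : forall i j, Mor (X i) (Y j)) (p : forall j, Mor (iota (Y j)) Z),
        [/\ forall i, fin_supp (m i),
            forall B : C0,
              dsum_right_exact (fun i j (u : Mor B (X i)) => m i j ∘ u)
                               (fun j (v : Mor B (Y j)) => p j ∘ fmap iota v) &
            dsum_right_exact (fun i j => amap H0 (m i j))
                             (fun j y => amap H (p j) (alpha (Y j) y))]].

(* Phi(X, Y) = H^X(Y), where H^X is the coextension to C' of C(X, -)|C0; alpha
   is natural in both arguments, so this also describes Phi on morphisms. *)
Definition is_coext_pairing (C C' C0 : preadditive)
    (iota : functor C0 C) (iota' : functor C0 C') (Phi : pairing C C')
    (alpha : forall (X : C) (Y : C0), Mor X (iota Y) -> Phi X (iota' Y)) :=
  @pairing_morphism C C0 (pull (idf C) iota (hom_pairing C))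
    (pull (idf C) iota' Phi) alpha /\
  forall X : C, @is_coextension C0 C' iota'
    (pairing_r (pull (idf C) iota (hom_pairing C)) X) (pairing_r Phi X) (alpha X).

(* sigma extends the isomorphisms C(X, Y) = C(X[1], Y[1]) for Y in C0. *)
Definition extends_shift (C C' C0 : tridata)
    (iota : tri_functor C0 C) (iota' : tri_functor C0 C') (Phi : pairing C C')
    (alpha : forall (X : C) (Y : C0), Mor X (iota Y) -> Phi X (iota' Y))
    (sigma : shift_iso Phi) :=
  forall (X : C) (Y : C0) (f : Mor X (iota Y)),
    pr (iso_to (tfun_sh iota' Y))
       (alpha (sh X) (sh Y) (iso_from (tfun_sh iota Y) ∘ fmap sh f)) =
    sigma X (iota' Y) (alpha X Y f).

Definition is_C0_colimit (C C0 : preadditive) (iota : functor C0 C)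
    (Q : quiver) (N_ : diagram Q C) (N : C) (inj : forall v, Mor (N_ v) N) :=
  (forall u v (e : arrow u v), inj v ∘ dmap N_ e = inj u) /\
  forall Y : C0, @is_ab_colimit Q (fun v => Mor (iota Y) (N_ v))
    (fun u v e x => dmap N_ e ∘ x) (Mor (iota Y) N) (fun v x => inj v ∘ x).

Definition is_C0_limit (C C0 : preadditive) (iota : functor C0 C)
    (Q : quiver) (M_ : diagram Q C) (M : C) (proj : forall v, Mor M (M_ v)) :=
  (forall u v (e : arrow u v), dmap M_ e ∘ proj u = proj v) /\
  forall Y : C0, @is_ab_colimit (op_quiver Q) (fun v => Mor (M_ v) (iota Y))
    (fun u v e x => x ∘ dmap M_ e) (Mor M (iota Y)) (fun v x => x ∘ proj v).

Definition vanishes (C C' : preadditive) (Phi : pairing C C')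
    (S : C -> Prop) (S' : C' -> Prop) :=
  forall X Y, S X -> S' Y -> forall x : Phi X Y, x = 0.

Definition left_orthogonal (C C' : preadditive) (Phi : pairing C C')
    (LO RO : C -> Prop) (LO' RO' : C' -> Prop) :=
  vanishes Phi LO LO' /\ vanishes Phi RO RO'.

Definition lperp_pairing (C C' : preadditive) (Phi : pairing C C')
    (S' : C' -> Prop) (X : C) :=
  forall Y, S' Y -> forall x : Phi X Y, x = 0.

(* beta identifies the restriction of Psi to C0 with C0(-,-). *)
Definition determining (C C' C0 : preadditive)
    (iota : functor C0 C) (iota' : functor C0 C') (Psi : pairing C C')
    (beta : forall A B : C0, Mor A B -> Psi (iota A) (iota' B)) :=
  [/\ forall Y, respects_coproducts (pairing_l Psi Y),
      forall X, respects_coproducts (pairing_r Psi X),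
      @pairing_iso C0 C0 (hom_pairing C0) (pull iota iota' Psi) beta,
      vanishes Psi (lperp (image_class iota)) (fun=> True) &
      vanishes Psi (fun=> True) (rperp (image_class iota'))].

(* Compatibility of beta with the shift isomorphisms of C0(-,-) and of Psi. *)
Definition respects_shift (C C' C0 : tridata)
    (iota : tri_functor C0 C) (iota' : tri_functor C0 C') (Psi : pairing C C')
    (tau : shift_iso Psi) (beta : forall A B : C0, Mor A B -> Psi (iota A) (iota' B)) :=
  forall (A B : C0) (f : Mor A B),
    pr (iso_to (tfun_sh iota' B)) (beta (sh A) (sh B) (fmap sh f)) =
    pl (iso_to (tfun_sh iota A)) (tau (iota A) (iota' B) (beta A B f)).

(* Main.v *)
Require Import Defs.
From HB Require Import structures.
From mathcomp Require Import all_boot all_algebra.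
From mathcomp Require Import boolp classical_sets functions cardinality fsbigop.

Set Implicit Arguments.
Unset Strict Implicit.
Unset Printing Implicit Defensive.
Import GRing.Theory.
Local Open Scope ring_scope.
Local Open Scope cat_scope.

(* Elements of Phi(X, Y) are "tensors" a (x) b of maps a : X -> iota A and
   b : iota' A -> Y through an object A of C0: since the category of the maps
   b : iota' A -> Y is filtered, Phi(X, Y) is the colimit of C(X, iota A) over
   it. As C0 is triangulated, a (x) b = 0 if and only if some u : A -> B of C0
   satisfies u a = 0 while b factors through u, if and only if some v : B -> A
   satisfies b v = 0 while a factors through v. The second description is the
   first one for the opposite categories, and the argument is symmetric.

   A balanced biadditive map of such pairs (a, b) extends uniquely to Phi(X, Y);
   this yields the shift isomorphism, the colimit formulas and the comparison
   with other dualities. Exactness in both arguments and niceness come from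
   completing maps between triangles of C, C0 and C'.

   The torsion pairs come from a cellular tower: starting with a coproduct of
   objects of P mapping onto all maps from P to M, one kills step by step the
   kernel of Hom(P, L_k[1]) -> Hom(P, M[1]), and L = hocolim L_k -> M has a cone
   orthogonal to P by compactness. Maps from a compact object to an object built
   in this way factor through a finite stage, i.e. through the envelope of P,
   which gives the orthogonality and envelope statements. The statements on C
   are those on C' for the opposite category. *)

(* The name is shadowed by the associativity of the composition of functions. *)
Local Notation compA := Defs.compA.

(** * Preadditive categories *)

(** Two obstacles shape the proof. A coextension pairing is given only through unspecified
    presentations, and the objects of C0 need not form a set. One model of the tensors is therefore
    built from representatives of the isomorphism classes, and an arbitrary coextension pairing is
    compared with it: a tensor that vanishes in the pairing vanishes in the model, so that the
    pairing inherits both descriptions of zero. Independence of the presentations is thus a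
    consequence, not a preliminary. The two descriptions have different uses: exactness in Y rests
    on the second one, exactness in X on the first, and niceness on a version of the first for
    equalities. Another duality is compared with the tensors one argument at a time, by a five lemma
    along the triangles of the cellular tower. This argument meets shifted objects, so its induction
    has to run over all admissible functors at once instead of a fixed one. *)

Section ZmodMorphism.
Variables (A B : zmodType) (f : A -> B).
Hypothesis fB : GRing.zmod_morphism f.

Lemma zmorph0 : f 0 = 0.
Proof. by have := fB 0 0; rewrite !subrr. Qed.

Lemma zmorphN x : f (- x) = - f x.
Proof. by rewrite -sub0r fB zmorph0 sub0r. Qed.

Lemma zmorphD x y : f (x + y) = f x + f y.
Proof. by rewrite -{1}[y]opprK fB zmorphN opprK. Qed.

Lemma zmorph_sum (I : Type) (r : seq I) (E : I -> A) :
  f (\sum_(i <- r) E i) = \sum_(i <- r) f (E i).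
Proof.
by elim: r => [|i r IH]; rewrite ?big_nil ?zmorph0 // !big_cons zmorphD IH.
Qed.

Lemma zmorph_inj : (forall x, f x = 0 -> x = 0) -> injective f.
Proof. by move=> f0 x y e; apply/subr0_eq/f0; rewrite fB e subrr. Qed.

End ZmodMorphism.

Lemma zmod_morphismD (A B : zmodType) (f : A -> B) :
  {morph f : x y / x + y} -> GRing.zmod_morphism f.
Proof. by move=> fD x y; apply: (@addIr _ (f y)); rewrite -fD !subrK. Qed.

Lemma inj_surj_bij (A B : Type) (f : A -> B) :
  injective f -> (forall y, exists x, f x = y) -> bijective f.
Proof.
move=> fI /choice[g gK]; exists g => // x.
by apply: fI; rewrite gK.
Qed.

Section Preadditive.
Variable C : preadditive.
Implicit Types X Y Z : C.

Lemma comp0m X Y Z (f : Mor X Y) : (0 : Mor Y Z) ∘ f = 0.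
Proof. exact: zmorph0 (comp_zmod_l f). Qed.

Lemma compm0 X Y Z (g : Mor Y Z) : g ∘ (0 : Mor X Y) = 0.
Proof. exact: zmorph0 (comp_zmod_r g). Qed.

Lemma compNm X Y Z (g : Mor Y Z) (f : Mor X Y) : (- g) ∘ f = - (g ∘ f).
Proof. exact: zmorphN (comp_zmod_l f) g. Qed.

Lemma compmN X Y Z (g : Mor Y Z) (f : Mor X Y) : g ∘ (- f) = - (g ∘ f).
Proof. exact: zmorphN (comp_zmod_r g) f. Qed.

Lemma compBl X Y Z (g g' : Mor Y Z) (f : Mor X Y) :
  (g - g') ∘ f = g ∘ f - g' ∘ f.
Proof. exact: comp_zmod_l. Qed.

Lemma compBr X Y Z (g : Mor Y Z) (f f' : Mor X Y) :
  g ∘ (f - f') = g ∘ f - g ∘ f'.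
Proof. exact: comp_zmod_r. Qed.

Lemma comp_suml X Y Z (I : Type) (r : seq I) (g : I -> Mor Y Z) (f : Mor X Y) :
  (\sum_(i <- r) g i) ∘ f = \sum_(i <- r) g i ∘ f.
Proof. exact (zmorph_sum (comp_zmod_l f) r g). Qed.

Lemma comp_sumr X Y Z (I : Type) (r : seq I) (g : Mor Y Z) (f : I -> Mor X Y) :
  g ∘ (\sum_(i <- r) f i) = \sum_(i <- r) g ∘ f i.
Proof. exact (zmorph_sum (comp_zmod_r g) r f). Qed.

Lemma to_zero X Z (f : Mor X Z) : is_zero Z -> f = 0.
Proof. by move=> z0; rewrite -[f]comp1m z0 comp0m. Qed.

Lemma from_zero X Z (f : Mor Z X) : is_zero Z -> f = 0.
Proof. by move=> z0; rewrite -[f]compm1 z0 compm0. Qed.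

Definition iso_refl X : iso X X := Iso (comp1m (idm X)) (comp1m (idm X)).

Definition iso_sym X Y (i : iso X Y) : iso Y X := Iso (iso_fromK i) (iso_toK i).

Lemma iso_trans_proof X Y Z (i : iso X Y) (j : iso Y Z) :
  (iso_from i ∘ iso_from j) ∘ (iso_to j ∘ iso_to i) = idm X.
Proof. by rewrite compA -(compA _ _ (iso_to j)) iso_toK compm1 iso_toK. Qed.

Definition iso_trans X Y Z (i : iso X Y) (j : iso Y Z) : iso X Z :=
  Iso (iso_trans_proof i j) (iso_trans_proof (iso_sym j) (iso_sym i)).

Lemma iso_opp_proof X Y (i : iso X Y) : (- iso_from i) ∘ (- iso_to i) = idm X.
Proof. by rewrite compNm compmN opprK iso_toK. Qed.

Definition iso_opp X Y (i : iso X Y) : iso X Y :=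
  Iso (iso_opp_proof i) (iso_opp_proof (iso_sym i)).

Lemma iso_toKl X Y Z (i : iso X Y) (f : Mor Z X) : iso_from i ∘ (iso_to i ∘ f) = f.
Proof. by rewrite compA iso_toK comp1m. Qed.

Lemma iso_fromKl X Y Z (i : iso X Y) (f : Mor Z Y) : iso_to i ∘ (iso_from i ∘ f) = f.
Proof. by rewrite compA iso_fromK comp1m. Qed.

Lemma iso_toKr X Y Z (i : iso X Y) (f : Mor X Z) : f ∘ iso_from i ∘ iso_to i = f.
Proof. by rewrite -compA iso_toK compm1. Qed.

Lemma iso_fromKr X Y Z (i : iso X Y) (f : Mor Y Z) : f ∘ iso_to i ∘ iso_from i = f.
Proof. by rewrite -compA iso_fromK compm1. Qed.

Lemma rperp_iso (S : C -> Prop) X Y : iso X Y -> rperp S X -> rperp S Y.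
Proof.
by move=> i SX A SA f; rewrite -[f](iso_fromKl i) (SX _ SA (iso_from i ∘ f)) compm0.
Qed.

Section Coproduct.
Variables (I : choiceType) (X : I -> C) (S : C) (inj : forall i, Mor (X i) S).
Hypothesis coprodS : is_coproduct inj.

Lemma coprod_ext T (h h' : Mor S T) : (forall i, h ∘ inj i = h' ∘ inj i) -> h = h'.
Proof.
move=> e; have [k [_ kU]] := coprodS (fun i => h ∘ inj i).
by rewrite -(kU h) // -(kU h') // => i; rewrite e.
Qed.

Lemma coprod_map T (f : forall i, Mor (X i) T) :
  exists h : Mor S T, forall i, h ∘ inj i = f i.
Proof. by have [k [kE _]] := coprodS f; exists k. Qed.

Lemma coprod_proj : exists pi : forall i, Mor S (X i),
  (forall i, pi i ∘ inj i = idm (X i)) /\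
  (forall i j, i != j -> pi j ∘ inj i = 0).
Proof.
have H j : exists p : Mor S (X j),
    p ∘ inj j = idm (X j) /\ forall i, i != j -> p ∘ inj i = 0.
  (* The identity of [X i] has to be transported along [i = j]; proof irrelevance turns the
     transport back into the identity on the diagonal. *)
  pose f i : Mor (X i) (X j) :=
    match pselect (i = j) with
    | left e => match e in _ = k return Mor (X i) (X k) with erefl => idm (X i) end
    | right _ => 0
    end.
  have [p pE] := coprod_map f; exists p; split=> [|i ij]; rewrite pE /f.
    by case: pselect => // e; rewrite (Prop_irrelevance e erefl).
  by case: pselect => // e; rewrite e eqxx in ij.
exists (fun j => projT1 (cid (H j))).
by split=> [i|i j ij]; case: (cid _) => p /= [p1 p0] //; exact: p0.
Qed.

End Coproduct.

(** Only the surjectivity half of compactness: the projections of a coproduct ([coprod_proj]) make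
    the comparison map from the direct sum injective in any case. *)
Definition fs_compact (K : C) :=
  forall (I : choiceType) (X : I -> C) S (inj : forall i, Mor (X i) S),
    is_coproduct inj -> forall x : Mor K S, exists l : seq {i & Mor K (X i)},
    x = \sum_(p <- l) inj (tag p) ∘ tagged p.

(** Once equal indices are merged, the component at i is forced to be [pi i ∘ x]. Hence a map from K
    vanishes as soon as all its components do. *)
Lemma fs_compact_proj K (I : choiceType) (X : I -> C) S (inj : forall i, Mor (X i) S)
    (pi : forall i, Mor S (X i)) :
  fs_compact K -> is_coproduct inj ->
  (forall i, pi i ∘ inj i = idm (X i)) ->
  (forall i j, i != j -> pi j ∘ inj i = 0) ->
  forall x : Mor K S, exists s : seq I, x = \sum_(i <- s) inj i ∘ (pi i ∘ x).
Proof.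
move=> cK cS pi1 pi0 x; have [l xE] := cK _ _ _ _ cS x.
set s := undup (map tag l); exists s.
rewrite [X in _ = \sum_(i <- s) inj i ∘ (pi i ∘ X)]xE.
under [RHS]eq_bigr do rewrite !comp_sumr.
rewrite exchange_big /= {1}xE !big_seq; apply: eq_bigr => -[i y] il /=.
have si : i \in s by rewrite mem_undup (map_f _ il).
rewrite (bigD1_seq i) ?undup_uniq //= big1 => [|j ji].
  by rewrite addr0 (compA (pi i)) pi1 comp1m.
by rewrite (compA (pi j)) pi0 ?comp0m ?compm0 // eq_sym.
Qed.

End Preadditive.

Section Functor.
Variables (C D : preadditive) (F : functor C D).
Implicit Types X Y Z : C.

Lemma fmap_zmod X Y : GRing.zmod_morphism (@fmap C D F X Y).
Proof. by apply: zmod_morphismD => f g; exact: fmapD. Qed.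

Lemma fmap0 X Y : fmap F (0 : Mor X Y) = 0.
Proof. exact: zmorph0 (@fmap_zmod X Y). Qed.

Lemma fmapN X Y (f : Mor X Y) : fmap F (- f) = - fmap F f.
Proof. exact: zmorphN (@fmap_zmod X Y) f. Qed.

Lemma fmapB X Y (f g : Mor X Y) : fmap F (f - g) = fmap F f - fmap F g.
Proof. exact: fmap_zmod. Qed.

Lemma fmap_iso_proof X Y (i : iso X Y) :
  fmap F (iso_from i) ∘ fmap F (iso_to i) = idm (F X).
Proof. by rewrite -fmapM iso_toK fmap1. Qed.

Definition fmap_iso X Y (i : iso X Y) : iso (F X) (F Y) :=
  Iso (fmap_iso_proof i) (fmap_iso_proof (iso_sym i)).

Lemma is_zero_fmap X : is_zero X -> is_zero (F X).
Proof. by rewrite /is_zero -fmap1 => ->; rewrite fmap0. Qed.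

Hypothesis ff : fully_faithful F.

Lemma ff_full X Y (g : Mor (F X) (F Y)) : exists f : Mor X Y, g = fmap F f.
Proof. by have [h _ hK] := ff X Y; exists (h g); rewrite hK. Qed.

Lemma ff_inj X Y : injective (@fmap C D F X Y).
Proof. exact: bij_inj (ff X Y). Qed.

End Functor.

Lemma sub_zmod (A : zmodType) (P : pred A) : GRing.zmod_closed P ->
  exists (B : zmodType) (i : B -> A), [/\ GRing.zmod_morphism i, injective i,
    forall b, P (i b) & forall a, P a -> exists b, a = i b].
Proof.
move=> Pc; pose B : zmodType := HB.pack {x | P x}
  (GRing.SubChoice_isSubZmodule.Build A P {x | P x} Pc).
exists B, (fun b : {x | P x} => val b); split=> [//|||].
- exact: (@val_inj _ _ {x | P x}).
- by move=> b; exact: (valP (b : {x | P x})).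
- by move=> a Pa; exists (exist _ a Pa).
Qed.

(** The finite sums of images form a subgroup through which the cocone factors. The induced map to
    this subgroup, followed by the inclusion, is the identity by uniqueness, so the subgroup is
    everything. *)
Lemma ab_colimit_gen (Q : quiver) (A : vertex Q -> zmodType)
    (m : forall u v, arrow u v -> A u -> A v) (S : zmodType)
    (inj : forall v, A v -> S) :
  is_ab_colimit m inj -> forall x, exists l : seq {v & A v},
    x = \sum_(p <- l) inj (tag p) (tagged p).
Proof.
case=> injB injm univ.
pose P := [pred x : S | `[< exists l : seq {v & A v},
    x = \sum_(p <- l) inj (tag p) (tagged p) >]].
have Pc : GRing.zmod_closed P.
  split; first by apply/asboolP; exists [::]; rewrite big_nil.
  move=> _ _ /asboolP[l ->] /asboolP[l' ->]; apply/asboolP.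
  exists (l ++ map (fun p : {v & A v} => existT (fun v => A v) (tag p) (- tagged p)) l').
  rewrite big_cat big_map /= -sumrN; congr (_ + _).
  by apply: eq_bigr => p _; rewrite (zmorphN (injB _)).
have [B [i [iB iI Pi iP]]] := sub_zmod Pc.
have {}Pinj v a : exists b, inj v a = i b.
  apply: iP; apply/asboolP; exists [:: existT (fun v => A v) v a].
  by rewrite big_seq1.
have [g gE] := choice (fun p : {v & A v} => Pinj (tag p) (tagged p)).
have gm v : GRing.zmod_morphism (fun a => g (existT (fun v => A v) v a)).
  by move=> a b; apply: iI; rewrite iB -!gE /= injB.
have [|h [[hB hE] _]] := univ B (fun v a => g (existT (fun v => A v) v a)) gm.
  by move=> u v e x; apply: iI; rewrite -!gE /= injm.
have [|k [_ kU]] := univ S inj injB; first by move=> *; rewrite injm.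
move=> x; have /asboolP := Pi (h x).
suff -> : i (h x) = x by [].
have e1 : k = fun x => i (h x).
  apply: kU; split=> [y z|v y]; first by rewrite hB iB.
  by rewrite hE -gE.
have e2 : k = id by apply: kU; split.
by rewrite -[LHS]/((fun x => i (h x)) x) -e1 e2.
Qed.

Lemma compact_fs (C : preadditive) (K : C) : compact K -> fs_compact K.
Proof. by move=> cK I X S inj cS x; have := ab_colimit_gen (cK I X S inj cS) x. Qed.

Lemma cocompact_fs (C : preadditive) (K : C) : cocompact K -> @fs_compact (op C) K.
Proof. by move=> cK I X S inj cS x; have := ab_colimit_gen (cK I X S inj cS) x. Qed.

(** * Triangles *)

(* The axioms of [is_triangulated] without biproducts and the octahedral axiom;
   in this form they pass to the opposite category by mere rotations. *)
Record pretriangulated (D : tridata) : Prop := Pretriangulated {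
  pt_zero : exists Z : D, is_zero Z;
  pt_sh_unsh_nat : forall (X Y : D) (f : Mor X Y),
    iso_to (sh_unsh Y) ∘ fmap sh (fmap unsh f) = f ∘ iso_to (sh_unsh X);
  pt_unsh_sh_nat : forall (X Y : D) (f : Mor X Y),
    iso_to (unsh_sh Y) ∘ fmap unsh (fmap sh f) = f ∘ iso_to (unsh_sh X);
  pt_sh_adj : forall X : D,
    fmap sh (iso_to (unsh_sh X)) = iso_to (sh_unsh (sh X));
  pt_iso : forall (X Y Z X' Y' Z' : D)
      (f : Mor X Y) (g : Mor Y Z) (h : Mor Z (sh X))
      (f' : Mor X' Y') (g' : Mor Y' Z') (h' : Mor Z' (sh X'))
      (a : iso X X') (b : iso Y Y') (c : iso Z Z'),
    f' ∘ iso_to a = iso_to b ∘ f -> g' ∘ iso_to b = iso_to c ∘ g ->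
    h' ∘ iso_to c = fmap sh (iso_to a) ∘ h -> dist f g h -> dist f' g' h';
  pt_id : forall X Z : D, is_zero Z -> dist (idm X) (0 : Mor X Z) 0;
  pt_cone : forall (X Y : D) (f : Mor X Y),
    exists (Z : D) (g : Mor Y Z) (h : Mor Z (sh X)), dist f g h;
  pt_rot : forall (X Y Z : D) (f : Mor X Y) (g : Mor Y Z) (h : Mor Z (sh X)),
    dist f g h <-> dist g h (- fmap sh f);
  pt_mor : forall (X Y Z X' Y' Z' : D)
      (f : Mor X Y) (g : Mor Y Z) (h : Mor Z (sh X))
      (f' : Mor X' Y') (g' : Mor Y' Z') (h' : Mor Z' (sh X'))
      (a : Mor X X') (b : Mor Y Y'),
    dist f g h -> dist f' g' h' -> f' ∘ a = b ∘ f ->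
    exists c : Mor Z Z', g' ∘ b = c ∘ g /\ h' ∘ c = fmap sh a ∘ h }.

Lemma triangulated_pre (D : tridata) : is_triangulated D -> pretriangulated D.
Proof. by case. Qed.

Lemma choice_dep (I : Type) (A : I -> Type) (P : forall i, A i -> Prop) :
  (forall i, exists a, P i a) -> exists f : forall i, A i, forall i, P i (f i).
Proof. by move=> H; exists (fun i => sval (cid (H i))) => i; case: (cid _). Qed.

Lemma choice_dep2 (I J : Type) (A : I -> J -> Type) (P : forall i j, A i j -> Prop) :
  (forall i j, exists a, P i j a) -> exists f : forall i j, A i j, forall i j, P i j (f i j).
Proof. by move=> H; exists (fun i j => sval (cid (H i j))) => i j; case: (cid _). Qed.

Section Pretriangulated.
Variable D : tridata.
Hypothesis HD : pretriangulated D.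
Implicit Types W X Y Z A B K : D.

Lemma sh_faithful X Y (f g : Mor X Y) : fmap sh f = fmap sh g -> f = g.
Proof.
move=> e; rewrite -[f](iso_fromKr (unsh_sh X)) -[g](iso_fromKr (unsh_sh X)).
by rewrite -!(pt_unsh_sh_nat HD) e.
Qed.

Lemma fmap_sh_unsh_hom Y X (n : Mor Y (sh X)) :
  fmap sh (unsh_hom n) = n ∘ iso_to (sh_unsh Y).
Proof. by rewrite fmapM (pt_sh_adj HD) (pt_sh_unsh_nat HD). Qed.

Lemma unsh_hom_sh_unsh W X (n : Mor W (sh X)) :
  n = fmap sh (unsh_hom n) ∘ iso_from (sh_unsh W).
Proof. by rewrite fmap_sh_unsh_hom iso_fromKr. Qed.

Lemma sh_full X Y (g : Mor (sh X) (sh Y)) : exists f : Mor X Y, g = fmap sh f.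
Proof.
exists (unsh_hom g ∘ iso_from (unsh_sh X)).
rewrite fmapM fmap_sh_unsh_hom.
rewrite -[iso_to (sh_unsh (sh X))](pt_sh_adj HD) -compA.
by rewrite -fmapM iso_fromK fmap1 compm1.
Qed.

(** The second triangle identity. Up to inverses it is [pt_sh_adj] of the opposite category, and it
    follows from the first because the shift is faithful. *)
Lemma unsh_adj X : fmap unsh (iso_to (sh_unsh X)) = iso_to (unsh_sh (unsh X)).
Proof.
apply: sh_faithful; rewrite (pt_sh_adj HD).
rewrite -[LHS](iso_toKl (sh_unsh X)) (pt_sh_unsh_nat HD).
by rewrite iso_toKl.
Qed.

Lemma unsh_hom_shM W X Y (g : Mor W (sh X)) (f : Mor X Y) :
  unsh_hom (fmap sh f ∘ g) = f ∘ unsh_hom g.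
Proof. by rewrite /unsh_hom fmapM compA (pt_unsh_sh_nat HD) compA. Qed.

Lemma unsh_hom_comp W X Y (g : Mor X (sh Y)) (f : Mor W X) :
  unsh_hom (g ∘ f) = unsh_hom g ∘ fmap unsh f.
Proof. by rewrite /unsh_hom fmapM compA. Qed.

Lemma unsh_hom_from X Y (f : Mor X Y) :
  unsh_hom (iso_from (sh_unsh Y) ∘ f) = fmap unsh f.
Proof. by rewrite /unsh_hom fmapM compA -unsh_adj -fmapM iso_fromK fmap1 comp1m. Qed.

Lemma unsh_hom_inj W X (f g : Mor W (sh X)) : unsh_hom f = unsh_hom g -> f = g.
Proof. by move=> e; rewrite [f]unsh_hom_sh_unsh [g]unsh_hom_sh_unsh e. Qed.

Lemma unsh_hom0 W X : unsh_hom (0 : Mor W (sh X)) = 0.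
Proof. by rewrite /unsh_hom fmap0 compm0. Qed.

Lemma dist_back X Y Z (f : Mor X Y) (g : Mor Y Z) (h : Mor Z (sh X)) :
  dist f g h -> dist (- unsh_hom h) f (iso_from (sh_unsh Z) ∘ g).
Proof.
move=> dfgh; apply/(pt_rot HD); rewrite fmapN opprK fmap_sh_unsh_hom.
apply: (pt_iso HD (a := iso_refl X) (b := iso_refl Y) (c := iso_sym (sh_unsh Z)) _ _ _ dfgh).
- by rewrite /= compm1 comp1m.
- by rewrite /= compm1.
- by rewrite /= fmap1 comp1m -compA iso_fromK compm1.
Qed.

Lemma dist_id_right W Z : is_zero Z -> dist (0 : Mor Z W) (idm W) 0.
Proof.
move=> z0; apply/(pt_rot HD); rewrite fmap0 oppr0.
by apply: (pt_id HD); exact: is_zero_fmap.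
Qed.

Lemma dist_comp0 X Y Z (f : Mor X Y) (g : Mor Y Z) (h : Mor Z (sh X)) :
  dist f g h -> g ∘ f = 0.
Proof.
move=> dfgh; have [O O0] := pt_zero HD.
have [|c [-> _]] := pt_mor HD (a := idm X) (b := f) (pt_id HD X O0) dfgh.
  by rewrite compm1.
by rewrite compm0.
Qed.

Lemma dist_comp0' X Y Z (f : Mor X Y) (g : Mor Y Z) (h : Mor Z (sh X)) :
  dist f g h -> h ∘ g = 0.
Proof. by move/(pt_rot HD); exact: dist_comp0. Qed.

Lemma dist_comp0'' X Y Z (f : Mor X Y) (g : Mor Y Z) (h : Mor Z (sh X)) :
  dist f g h -> fmap sh f ∘ h = 0.
Proof.
by move/(pt_rot HD)/(pt_rot HD)/dist_comp0/eqP; rewrite compNm oppr_eq0 => /eqP.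
Qed.

(** Map the triangle W -> 0 -> W[1] to the rotated triangle by y and 0; since the shift is full, the
    third component is the shift of the wanted lift. The signs of the two rotations cancel. *)
Lemma dist_lift X Y Z (f : Mor X Y) (g : Mor Y Z) (h : Mor Z (sh X)) W
    (y : Mor W Y) : dist f g h -> g ∘ y = 0 -> exists x, y = f ∘ x.
Proof.
move=> dfgh gy; have [O O0] := pt_zero HD.
have dW : dist (0 : Mor W O) 0 (- fmap sh (idm W)).
  exact: (iffLR (pt_rot HD _ _ _) (pt_id HD W O0)).
have [|c [_ cE]] := pt_mor HD (a := y) (b := 0) dW (iffLR (pt_rot HD f g h) dfgh).
  by rewrite gy comp0m.
have [x xE] := sh_full c; exists x; apply: sh_faithful.
move: cE; rewrite fmap1 compmN compm1 compNm => /oppr_inj <-.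
by rewrite xE fmapM.
Qed.

Lemma dist_extend X Y Z (f : Mor X Y) (g : Mor Y Z) (h : Mor Z (sh X)) W
    (y : Mor Y W) : dist f g h -> y ∘ f = 0 -> exists z, y = z ∘ g.
Proof.
move=> dfgh yf; have [O O0] := pt_zero HD.
have [|c [cE _]] := pt_mor HD (a := 0) (b := y) dfgh (dist_id_right W O0).
  by rewrite yf compm0.
by exists c; rewrite -cE comp1m.
Qed.

Lemma dist_lift' X Y Z (f : Mor X Y) (g : Mor Y Z) (h : Mor Z (sh X)) W
    (z : Mor W Z) : dist f g h -> h ∘ z = 0 -> exists y, z = g ∘ y.
Proof. by move/(pt_rot HD); exact: dist_lift. Qed.

Lemma dist_extend' X Y Z (f : Mor X Y) (g : Mor Y Z) (h : Mor Z (sh X)) W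
    (z : Mor Z W) : dist f g h -> z ∘ g = 0 -> exists x, z = x ∘ h.
Proof. by move/(pt_rot HD); exact: dist_extend. Qed.

Lemma dist_extend'' X Y Z (f : Mor X Y) (g : Mor Y Z) (h : Mor Z (sh X)) W
    (z : Mor (sh X) W) : dist f g h -> z ∘ h = 0 -> exists x, z = x ∘ fmap sh f.
Proof.
move=> /(pt_rot HD)/(pt_rot HD) d zh; have [x ->] := dist_extend d zh.
by exists (- x); rewrite compNm compmN.
Qed.

Lemma dist_fiber Y Z (g : Mor Y Z) :
  exists X (f : Mor X Y) (h : Mor Z (sh X)), dist f g h.
Proof.
have [W [h [k d]]] := pt_cone HD g.
exists (unsh W), (- unsh_hom k), (iso_from (sh_unsh W) ∘ h).
exact: dist_back.
Qed.

Lemma dist_ext Z X (h : Mor Z (sh X)) :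
  exists Y (f : Mor X Y) (g : Mor Y Z), dist f g h.
Proof.
have [Y' [f' [g' d]]] := pt_cone HD (unsh_hom h).
exists Y', f', (iso_to (sh_unsh Z) ∘ - g').
have := d => /(pt_rot HD) {}d.
apply: (pt_iso HD (a := iso_refl X) (b := iso_refl Y')
  (c := iso_opp (sh_unsh Z)) _ _ _ d) => /=.
- by rewrite compm1 comp1m.
- by rewrite compm1 compmN compNm.
- by rewrite fmap1 comp1m fmap_sh_unsh_hom compmN.
Qed.

Lemma dist_mor_back X Y Z X' Y' Z' (f : Mor X Y) (g : Mor Y Z) (h : Mor Z (sh X))
    (f' : Mor X' Y') (g' : Mor Y' Z') (h' : Mor Z' (sh X'))
    (b : Mor Y Y') (c : Mor Z Z') :
  dist f g h -> dist f' g' h' -> g' ∘ b = c ∘ g ->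
  exists a : Mor X X', f' ∘ a = b ∘ f /\ h' ∘ c = fmap sh a ∘ h.
Proof.
move=> /(pt_rot HD) d /(pt_rot HD) d' e.
have [s [e1 e2]] := pt_mor HD d d' e; have [a aE] := sh_full s.
exists a; split; last by rewrite e1 aE.
apply: sh_faithful; apply: oppr_inj.
by rewrite !fmapM -compNm -compmN -aE.
Qed.

Lemma dist_mor_mid X Y Z X' Y' Z' (f : Mor X Y) (g : Mor Y Z) (h : Mor Z (sh X))
    (f' : Mor X' Y') (g' : Mor Y' Z') (h' : Mor Z' (sh X'))
    (a : Mor X X') (c : Mor Z Z') :
  dist f g h -> dist f' g' h' -> h' ∘ c = fmap sh a ∘ h ->
  exists b : Mor Y Y', f' ∘ a = b ∘ f /\ g' ∘ b = c ∘ g.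
Proof.
move=> /(pt_rot HD) d /(pt_rot HD) d' e.
have [b [e1 e2]] := dist_mor_back d d' e; exists b; split=> //.
apply: sh_faithful; apply: oppr_inj.
by rewrite !fmapM -compNm e2 compmN.
Qed.

Lemma dist_sh X Y Z (f : Mor X Y) (g : Mor Y Z) (h : Mor Z (sh X)) :
  dist f g h -> dist (fmap sh f) (fmap sh g) (- fmap sh h).
Proof.
move=> /(pt_rot HD)/(pt_rot HD)/(pt_rot HD) d.
(* Three rotations put a minus sign on every map; the automorphism -1 of the middle object removes
   the first two. *)
apply: (pt_iso HD (a := iso_refl _) (b := iso_opp (iso_refl _))
  (c := iso_refl _) _ _ _ d) => /=.
- by rewrite compm1 compNm compmN comp1m opprK.
- by rewrite comp1m compmN compm1.
- by rewrite fmap1 compm1 comp1m.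
Qed.

Lemma dist_unsh X Y Z (f : Mor X Y) (g : Mor Y Z) (h : Mor Z (sh X)) :
  dist f g h -> exists k, dist (fmap unsh f) (fmap unsh g) k.
Proof.
move=> /dist_back/dist_back/dist_back; rewrite !unsh_hom_from => d; eexists.
apply: (pt_iso HD (a := iso_refl _) (b := iso_opp (iso_refl _))
  (c := iso_refl _) _ _ _ d) => /=.
- by rewrite compm1 compNm compmN comp1m opprK.
- by rewrite comp1m compmN compm1.
- by rewrite fmap1 compm1 comp1m.
Qed.

Lemma dist_split X Y Z (f : Mor X Y) (g : Mor Y Z) (h : Mor Z (sh X)) :
  dist f g h -> g = 0 -> exists s : Mor Y X, f ∘ s = idm Y.
Proof.
move=> d g0; have [|s sE] := dist_lift (y := idm Y) d; first by rewrite g0 comp0m.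
by exists s.
Qed.

(** Biproducts are not among the axioms of [pretriangulated]; they come from the triangle with zero
    connecting map. Keeping this triangle in the statement shows that classes closed under
    extensions contain the sum. *)
Lemma split_extension X Y :
  exists S (f : Mor X S) (g : Mor S Y) (s : Mor Y S) (r : Mor S X),
    [/\ dist f g 0, r ∘ f = idm X, g ∘ s = idm Y, g ∘ f = 0 & r ∘ s = 0].
Proof.
have [S [f [g d]]] := dist_ext (0 : Mor Y (sh X)).
have gf := dist_comp0 d.
have [|s sE] := dist_lift' (z := idm Y) d; first by rewrite comp0m.
have [|r rE] := dist_extend (y := idm X) (dist_back d).
  by rewrite unsh_hom0 oppr0 compm0.
(* Subtracting [r ∘ s ∘ g] makes the retraction vanish on s and leaves [r ∘ f] unchanged, as
   [g ∘ f = 0]. *)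
exists S, f, g, s, (r - r ∘ s ∘ g); split=> //.
  by rewrite compBl -compA gf compm0 subr0.
by rewrite compBl -compA -sE compm1 subrr.
Qed.

Lemma rperp_sh (S : D -> Prop) Y :
  (forall X, S X -> exists2 X', S X' & inhabited (iso X (sh X'))) ->
  rperp S Y -> rperp S (sh Y).
Proof.
move=> Ssh SY X /Ssh[X' SX' [i]] f.
have [k kE] := sh_full (f ∘ iso_from i).
by rewrite -[f](iso_toKr i) kE (SY _ SX' k) fmap0 comp0m.
Qed.

Lemma rperp_unsh (S : D -> Prop) Y :
  (forall X, S X -> exists2 X', S X' & inhabited (iso (sh X) X')) ->
  rperp S Y -> rperp S (unsh Y).
Proof.
move=> Ssh SY X /Ssh[X' SX' [i]] f; apply: sh_faithful; rewrite fmap0.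
rewrite -[fmap sh f](iso_toKl (sh_unsh Y)) -[X in _ ∘ X](iso_toKr i).
by rewrite (SY _ SX' (_ ∘ iso_from i)) comp0m compm0.
Qed.

Lemma unsh_full X Y (g : Mor (unsh X) (unsh Y)) : exists f : Mor X Y, g = fmap unsh f.
Proof.
exists (iso_to (sh_unsh Y) ∘ fmap sh g ∘ iso_from (sh_unsh X)).
rewrite !fmapM unsh_adj (pt_unsh_sh_nat HD) -unsh_adj -compA -fmapM.
by rewrite iso_fromK fmap1 compm1.
Qed.

Lemma coproduct_sh (I : choiceType) (X : I -> D) S (inj : forall i, Mor (X i) S) :
  is_coproduct inj -> is_coproduct (fun i => fmap sh (inj i)).
Proof.
move=> cS T f.
have /choice_dep[f' f'E] i : exists f' : Mor (X i) (unsh T),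
    iso_from (sh_unsh T) ∘ f i = fmap sh f' by exact: sh_full.
have [h [hE hU]] := cS (unsh T) f'.
exists (iso_to (sh_unsh T) ∘ fmap sh h); split=> [i|g gE].
  by rewrite -compA -fmapM hE -f'E iso_fromKl.
have [g' g'E] := sh_full (iso_from (sh_unsh T) ∘ g).
rewrite -[g](iso_fromKl (sh_unsh T)) g'E (hU g') // => i.
by apply: sh_faithful; rewrite fmapM -g'E -f'E -gE compA.
Qed.

Lemma coproduct_unsh (I : choiceType) (X : I -> D) S (inj : forall i, Mor (X i) S) :
  is_coproduct inj -> is_coproduct (fun i => fmap unsh (inj i)).
Proof.
move=> cS T f.
have unshK Z (k : Mor (unsh Z) T) : unsh_hom (fmap sh k ∘ iso_from (sh_unsh Z)) = k.
  by rewrite unsh_hom_shM -[iso_from _]compm1 unsh_hom_from fmap1 compm1.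
have [h [hE hU]] := cS (sh T) (fun i => fmap sh (f i) ∘ iso_from (sh_unsh (X i))).
exists (unsh_hom h); split=> [i|k kE]; first by rewrite -unsh_hom_comp hE unshK.
rewrite (hU (fmap sh k ∘ iso_from (sh_unsh S))) ?unshK // => i.
apply: unsh_hom_inj; rewrite unshK unsh_hom_comp unshK; exact: kE.
Qed.

Lemma fs_compact_unsh K : fs_compact K -> fs_compact (unsh K).
Proof.
move=> cK I X S inj cS x.
have [l xE] := cK _ _ _ _ (coproduct_sh cS) (fmap sh x ∘ iso_from (sh_unsh K)).
have /choice[u uE] (p : {i & Mor K (sh (X i))}) :
    exists q : {i & Mor (unsh K) (X i)},
    inj (tag q) ∘ tagged q = unsh_hom (fmap sh (inj (tag p)) ∘ tagged p).
  by exists (existT _ (tag p) (unsh_hom (tagged p))); rewrite unsh_hom_shM.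
exists (map u l); rewrite big_map; under eq_bigr do rewrite uE.
apply: sh_faithful; rewrite -[LHS](iso_toKr (sh_unsh K)) xE comp_suml.
rewrite (zmorph_sum (@fmap_zmod _ _ sh _ _)); apply: eq_bigr => p _.
by rewrite fmap_sh_unsh_hom.
Qed.

End Pretriangulated.

(** * Opposite categories and opposite functors *)

Definition unop_iso (C : preadditive) (X Y : C) (i : @iso (op C) X Y) : @iso C Y X :=
  @Iso C Y X (iso_to i) (iso_from i) (iso_fromK i) (iso_toK i).

Section Opposite.
Variable D : tridata.
Hypothesis HD : pretriangulated D.
Implicit Types W X Y Z A B K : D.

Lemma unsh_sh_nat_from X Y (f : Mor X Y) :
  fmap unsh (fmap sh f) ∘ iso_from (unsh_sh X) = iso_from (unsh_sh Y) ∘ f.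
Proof.
by rewrite -[LHS](iso_toKl (unsh_sh Y)) (compA (iso_to _)) (pt_unsh_sh_nat HD) iso_fromKr.
Qed.

Lemma sh_unsh_nat_from X Y (f : Mor X Y) :
  fmap sh (fmap unsh f) ∘ iso_from (sh_unsh X) = iso_from (sh_unsh Y) ∘ f.
Proof.
by rewrite -[LHS](iso_toKl (sh_unsh Y)) (compA (iso_to _)) (pt_sh_unsh_nat HD) iso_fromKr.
Qed.

Lemma unsh_adj_from X : fmap unsh (iso_from (sh_unsh X)) = iso_from (unsh_sh (unsh X)).
Proof.
rewrite -[LHS](iso_toKl (unsh_sh (unsh X))) -(unsh_adj HD).
by rewrite -fmapM iso_fromK fmap1 compm1.
Qed.

Lemma op_distP X Y Z (f : Mor Y X) (g : Mor Z Y) (h : Mor (unsh X) Z) :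
  @dist (op_tri D) X Y Z f g h <-> dist g f (fmap sh h ∘ iso_from (sh_unsh X)).
Proof. by []. Qed.

Lemma op_dist X Y Z (f : Mor X Y) (g : Mor Y Z) (h : Mor Z (sh X)) :
  dist f g h -> @dist (op_tri D) Z Y X g f (unsh_hom h).
Proof. by move=> d; apply/op_distP; rewrite -(unsh_hom_sh_unsh HD). Qed.

Lemma op_tri_iso X Y Z X' Y' Z' (f : Mor Y X) (g : Mor Z Y) (h : Mor (unsh X) Z)
    (f' : Mor Y' X') (g' : Mor Z' Y') (h' : Mor (unsh X') Z')
    (a : iso X' X) (b : iso Y' Y) (c : iso Z' Z) :
  iso_to a ∘ f' = f ∘ iso_to b -> iso_to b ∘ g' = g ∘ iso_to c ->
  iso_to c ∘ h' = h ∘ fmap unsh (iso_to a) ->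
  @dist (op_tri D) X Y Z f g h -> @dist (op_tri D) X' Y' Z' f' g' h'.
Proof.
move=> ea eb ec /op_distP d; apply/op_distP.
apply: (pt_iso HD (a := iso_sym c) (b := iso_sym b) (c := iso_sym a)) d => /=.
- by rewrite -[LHS](iso_toKl b) (compA (iso_to b)) eb iso_fromKr.
- by rewrite -[LHS](iso_toKl a) (compA (iso_to a)) ea iso_fromKr.
have {}ec : h' ∘ fmap unsh (iso_from a) = iso_from c ∘ h.
  rewrite -[LHS](iso_toKl c) (compA (iso_to c)) ec -compA.
  by rewrite -fmapM iso_fromK fmap1 compm1.
by rewrite -compA -sh_unsh_nat_from compA -fmapM ec fmapM compA.
Qed.

Lemma op_tri_rot X Y Z (f : Mor Y X) (g : Mor Z Y) (h : Mor (unsh X) Z) :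
  @dist (op_tri D) X Y Z f g h <-> @dist (op_tri D) Y Z (unsh X) g h (- fmap unsh f).
Proof.
split=> [/op_distP d|/op_distP d]; apply/op_distP.
  apply/(pt_rot HD); rewrite fmapN compNm sh_unsh_nat_from.
  apply: (pt_iso HD (a := iso_refl Z) (b := iso_refl Y)
    (c := iso_opp (iso_sym (sh_unsh X)))) d => /=.
  - by rewrite compm1 comp1m.
  - by rewrite compm1 compNm.
  - by rewrite fmap1 comp1m compNm compmN opprK.
move: d; rewrite fmapN compNm sh_unsh_nat_from => /(pt_rot HD) d.
apply: (pt_iso HD (a := iso_refl Z) (b := iso_refl Y)
  (c := iso_opp (sh_unsh X))) d => /=.
- by rewrite compm1 comp1m.
- by rewrite compm1 compNm compmN opprK iso_fromKl.
- by rewrite fmap1 comp1m compmN iso_toKr.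
Qed.

Lemma op_tri_mor X Y Z X' Y' Z' (f : Mor Y X) (g : Mor Z Y) (h : Mor (unsh X) Z)
    (f' : Mor Y' X') (g' : Mor Z' Y') (h' : Mor (unsh X') Z')
    (a : Mor X' X) (b : Mor Y' Y) :
  @dist (op_tri D) X Y Z f g h -> @dist (op_tri D) X' Y' Z' f' g' h' ->
  a ∘ f' = f ∘ b ->
  exists c : Mor Z' Z, b ∘ g' = g ∘ c /\ c ∘ h' = h ∘ fmap unsh a.
Proof.
move=> /op_distP d /op_distP d' e.
have [c [cE1 cE2]] := dist_mor_back HD d' d (esym e).
exists c; split=> //; apply: (sh_faithful HD).
rewrite !fmapM -[LHS](iso_fromKr (iso_sym (sh_unsh X'))) /=.
by rewrite -(compA (fmap sh c)) -cE2 -(compA (fmap sh h)) -sh_unsh_nat_from compA iso_toKr.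
Qed.

End Opposite.

Lemma pretriangulated_op (D : tridata) : pretriangulated D -> pretriangulated (op_tri D).
Proof.
move=> HD; split.
- exact: (pt_zero HD).
- move=> X Y f; exact: (unsh_sh_nat_from HD).
- move=> X Y f; exact: (sh_unsh_nat_from HD).
- move=> X; exact: (unsh_adj_from HD).
- move=> X Y Z X' Y' Z' f g h f' g' h' a b c ea eb ec.
  exact: (op_tri_iso HD (a := unop_iso a) (b := unop_iso b) (c := unop_iso c)).
- move=> X Z Z0; apply/op_distP; rewrite fmap0 comp0m.
  exact: (dist_id_right HD).
- move=> X Y f; have [Z [g [h d]]] := dist_fiber HD f.
  by exists Z, g, (unsh_hom h); exact: op_dist.
- move=> X Y Z f g h; exact: (op_tri_rot HD).
- move=> X Y Z X' Y' Z' f g h f' g' h' a b d d' e.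
  have [c [e1 e2]] := op_tri_mor HD d d' e.
  by exists c; split.
Qed.

Section OppositeFunctor.
Variables (D0 D : tridata).
Hypotheses (HD0 : pretriangulated D0) (HD : pretriangulated D).
Variable F : tri_functor D0 D.

(** A triangulated functor carries only its comparison with [1]. The comparison with [-1], which the
    opposite functor requires, is assembled from it and the isomorphisms relating [1] and [-1]. *)
Definition tfun_sh_unsh (X : D0) : iso (sh (F (unsh X))) (F X) :=
  iso_trans (iso_sym (tfun_sh F (unsh X))) (fmap_iso F (sh_unsh X)).

Lemma tfun_sh_unsh_nat X Y (f : Mor X Y) :
  fmap F f ∘ iso_to (tfun_sh_unsh X) =
  iso_to (tfun_sh_unsh Y) ∘ fmap sh (fmap F (fmap unsh f)).
Proof.
rewrite /= compA -fmapM -(pt_sh_unsh_nat HD0) fmapM -!compA; congr (_ ∘ _).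
by rewrite -[LHS](iso_toKl (tfun_sh F (unsh Y))) (compA (iso_to _)) tfun_sh_nat iso_fromKr.
Qed.

Definition tfun_unsh (X : D0) : iso (F (unsh X)) (unsh (F X)) :=
  iso_trans (iso_sym (unsh_sh _)) (fmap_iso unsh (tfun_sh_unsh X)).

Lemma tfun_unsh_nat X Y (f : Mor X Y) :
  fmap unsh (fmap F f) ∘ iso_to (tfun_unsh X) = iso_to (tfun_unsh Y) ∘ fmap F (fmap unsh f).
Proof.
change (fmap unsh (fmap F f) ∘ (fmap unsh (iso_to (tfun_sh_unsh X)) ∘ iso_from (unsh_sh _)) =
  fmap unsh (iso_to (tfun_sh_unsh Y)) ∘ iso_from (unsh_sh _) ∘ fmap F (fmap unsh f)).
rewrite compA -fmapM tfun_sh_unsh_nat fmapM -!compA; congr (_ ∘ _).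
exact: unsh_sh_nat_from.
Qed.

Lemma op_tfun_nat (X Y : D0) (f : Mor Y X) :
  fmap F (fmap unsh f) ∘ iso_from (tfun_unsh Y) = iso_from (tfun_unsh X) ∘ fmap unsh (fmap F f).
Proof.
by rewrite -[LHS](iso_toKl (tfun_unsh X)) (compA (iso_to _)) -tfun_unsh_nat iso_fromKr.
Qed.

Lemma op_tfun_dist (X Y Z : D0) (f : Mor Y X) (g : Mor Z Y) (h : Mor (unsh X) Z) :
  @dist (op_tri D0) X Y Z f g h ->
  @dist (op_tri D) (F X) (F Y) (F Z) (fmap F f) (fmap F g)
    (fmap F h ∘ iso_from (tfun_unsh X)).
Proof.
move=> /op_distP/(tfun_dist F)/(op_dist HD).
by rewrite fmapM compA tfun_sh_nat -compA unsh_hom_shM.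
Qed.

Definition op_tri_functor : tri_functor (op_tri D0) (op_tri D) :=
  @TriFunctor (op_tri D0) (op_tri D) (op_functor F)
    (fun X : D0 => op_iso (tfun_unsh X))
    (fun X Y f => @op_tfun_nat X Y f) op_tfun_dist.

End OppositeFunctor.

(** * Torsion pairs generated by compact objects *)

Section Hocolim.
Variable D : tridata.
Hypothesis HD : pretriangulated D.
Variables (Y : nat -> D) (phi : forall i, Mor (Y i) (Y i.+1)).
Variables (S T : D) (inj : forall i, Mor (Y i) S) (d : Mor S S).
Variables (g : Mor S T) (h : Mor T (sh S)).
Hypothesis coprodS : is_coproduct inj.
Hypothesis dE : forall i, d ∘ inj i = inj i - inj i.+1 ∘ phi i.
Hypothesis distT : dist d g h.

Lemma hocolim_compat i : g ∘ inj i = g ∘ inj i.+1 ∘ phi i.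
Proof.
apply/subr0_eq; rewrite -[g ∘ inj i.+1 ∘ _]compA -compBr -dE compA.
by rewrite (dist_comp0 HD distT) comp0m.
Qed.

Lemma hocolim_map M (lam : forall i, Mor (Y i) M) :
  (forall i, lam i.+1 ∘ phi i = lam i) ->
  exists f : Mor T M, forall i, f ∘ (g ∘ inj i) = lam i.
Proof.
move=> lamE; have [f fE] := coprod_map coprodS lam.
have [|f' f'E] := dist_extend HD (y := f) distT.
  apply: (coprod_ext coprodS) => i.
  by rewrite -compA dE compBr compA !fE lamE subrr comp0m.
by exists f' => i; rewrite compA -f'E fE.
Qed.

(** The components of d are [pi 0] and [pi i.+1 - phi i ∘ pi i], so [d ∘ x = 0] kills all components
    of x by induction, and compactness recovers x from its components. *)
Lemma hocolim_shift_mono K (x : Mor K S) : fs_compact K -> d ∘ x = 0 -> x = 0.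
Proof.
move=> cK dx; have [pi [pi1 pi0]] := coprod_proj coprodS.
have d0 : pi 0%N ∘ d = pi 0%N.
  apply: (coprod_ext coprodS) => i; rewrite -compA dE compBr compA (pi0 i.+1) //.
  by rewrite comp0m subr0.
have dS i : pi i.+1 ∘ d = pi i.+1 - phi i ∘ pi i.
  apply: (coprod_ext coprodS) => j; rewrite -compA dE compBr compBl compA.
  congr (_ - _); case: (eqVneq j i) => [->|ji]; first by rewrite pi1 comp1m -compA pi1 compm1.
  by rewrite pi0 ?eqSS // comp0m -compA pi0 ?compm0.
have [s ->] := fs_compact_proj cK coprodS pi1 pi0 x.
suff pix i : pi i ∘ x = 0 by rewrite big1 // => i _; rewrite pix compm0.
elim: i => [|i IH].
  by rewrite -d0 -compA dx compm0.
have := congr1 (fun u => u ∘ x) (dS i).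
by rewrite -compA dx compm0 compBl -compA IH compm0 subr0 => <-.
Qed.

Lemma hocolim_push K i n (z : Mor K (Y i)) :
  exists z' : Mor K (Y (n + i)%N), g ∘ inj i ∘ z = g ∘ inj (n + i)%N ∘ z'.
Proof.
elim: n => [|n [z' ->]]; first by exists z.
by exists (phi (n + i) ∘ z'); rewrite hocolim_compat -!compA.
Qed.

(** Since [h ∘ x = 0], the map x lifts to the coproduct, where it is a finite sum, and finitely many
    stages have a common later one. *)
Lemma hocolim_factor K (x : Mor K T) : fs_compact K ->
  exists i (z : Mor K (Y i)), x = g ∘ inj i ∘ z.
Proof.
move=> cK; have hx : h ∘ x = 0.
  (* Desuspended, [h ∘ x] is a map from K[-1] to the coproduct that d kills, and K[-1] is again
     compact. *)
  apply: (unsh_hom_inj HD); rewrite unsh_hom0.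
  apply: hocolim_shift_mono (fs_compact_unsh HD cK) _.
  by rewrite -(unsh_hom_shM HD) compA (dist_comp0'' HD distT) comp0m unsh_hom0.
have [y ->] := dist_lift' HD distT hx; have [l ->] := cK _ _ _ _ coprodS y.
elim: l => [|[i y1] l [j [z zE]]].
  by exists 0%N, 0; rewrite big_nil !compm0.
rewrite big_cons compDr zE /= compA.
have [y2 ->] := hocolim_push j y1; have [z2 ->] := hocolim_push i z.
rewrite addnC in z2 *; exists (j + i)%N, (y2 + z2).
by rewrite compDr.
Qed.

End Hocolim.

(** The stages are successive extensions, and the rotated triangle S -> T -> S[1] shows the homotopy
    colimit T as an extension of S[1] by S, where S is the coproduct of the stages. *)
Lemma strongly_ext_closed_of (D : tridata) (Q : D -> Prop) : pretriangulated D ->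
  (forall Z, is_zero Z -> Q Z) ->
  (forall (X Y Z : D) (f : Mor X Y) (g : Mor Y Z) (h : Mor Z (sh X)),
     dist f g h -> Q X -> Q Z -> Q Y) ->
  (forall X, Q X -> Q (sh X)) -> closed_coproducts Q -> strongly_ext_closed Q.
Proof.
move=> HD Q0 Qe Qsh Qc; split=> // Y phi T QY0 QZ [S [inj [d [g [h [cS _ dT]]]]]].
have QY i : Q (Y i).
  elim: i => [//|i IH].
  by have [Z [a [b [di QZi]]]] := QZ i; exact: Qe di IH QZi.
have QS : Q S := Qc _ _ _ _ cS QY.
by move: dT => /(pt_rot HD) dT; exact: Qe dT QS (Qsh _ QS).
Qed.

(** * Vanishing of maps out of strong extension-closures *)

Section HomVanishing.
Variable D : tridata.
Hypothesis HD : pretriangulated D.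
Variable R : D.
Let Q (X : D) := forall f : Mor X R, f = 0.

Lemma lperp1_extension X Y Z (f : Mor X Y) (g : Mor Y Z) (h : Mor Z (sh X)) :
  dist f g h -> Q X -> Q Z -> Q Y.
Proof.
move=> d X0 Z0 u; have [z ->] := dist_extend HD d (X0 (u ∘ f)).
by rewrite (Z0 z) comp0m.
Qed.

Lemma lperp1_coproducts : closed_coproducts Q.
Proof.
move=> I X S inj cS X0 f; apply: (coprod_ext cS) => i.
by rewrite comp0m; exact: X0.
Qed.

Lemma lperp1_retracts : closed_retracts Q.
Proof. by move=> X Y i r ri Y0 f; rewrite -[f]compm1 -ri compA (Y0 (f ∘ r)) comp0m. Qed.

(* The maps Hom(Y_{i+1}[1], R) -> Hom(Y_i[1], R) are onto, so that the derived
   limit obstructing the vanishing of Hom(hocolim Y_i, R) is zero. *)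
Lemma lperp1_strongly_ext : strongly_ext_closed Q.
Proof.
split=> [Z Z0 f|Y phi T Y0 Yc [S [inj [d [g [h [cS dE dT]]]]]] f].
  exact: from_zero.
have YQ i : Q (Y i).
  elim: i => [//|i IH].
  by have [Z [a [b [dist_i QZ]]]] := Yc i; exact: lperp1_extension dist_i IH QZ.
have [|f' ->] := dist_extend' HD (z := f) dT.
  by apply: (coprod_ext cS) => i; rewrite comp0m; exact: YQ.
have /choice_dep[wS wSE] i : exists F : Mor (sh (Y i)) R -> Mor (sh (Y i.+1)) R,
    forall w, F w ∘ fmap sh (phi i) = w - f' ∘ fmap sh (inj i).
  have /choice[F FE] w : exists x : Mor (sh (Y i.+1)) R,
      w - f' ∘ fmap sh (inj i) = x ∘ fmap sh (phi i).
    have [Z [a [b [dist_i QZ]]]] := Yc i; exact (dist_extend'' HD dist_i (QZ _)).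
  by exists F.
(* W will solve [W ∘ fmap sh d = f']: the equation at stage i determines a choice at stage i.+1 from
   the one at i, starting from 0. *)
pose w := nat_rect (fun i => Mor (sh (Y i)) R) 0 wS.
have [W WE] := coprod_map (coproduct_sh HD cS) w.
suff -> : f' = W ∘ fmap sh d by rewrite -compA (dist_comp0'' HD dT) compm0.
apply: (coprod_ext (coproduct_sh HD cS)) => i.
rewrite -compA -fmapM dE fmapB fmapM compBr compA !WE /= wSE.
by rewrite opprB addrCA subrr addr0.
Qed.

Lemma strong_ext_closure_lperp1 (P : D -> Prop) X :
  (forall Y, P Y -> Q Y) -> strong_ext_closure P X -> Q X.
Proof.
move=> PQ; apply => //; first exact: lperp1_strongly_ext.
  exact: lperp1_retracts.
exact: lperp1_coproducts.
Qed.

End HomVanishing.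

(** * The cellular tower *)

Section CompactlyGenerated.
Variable D : tridata.
Hypotheses (HD : pretriangulated D) (coprodD : has_coproducts D).
Variables (I : choiceType) (P : I -> D).
Hypothesis cP : forall i, fs_compact (P i).

Definition coproduct_of (C : D) := exists (J : choiceType) (k : J -> I)
  (inj : forall j, Mor (P (k j)) C), is_coproduct inj.

(** Every map in A contributes one summand, so the index set is small and a single u represents all
    of them; [{classic _}] supplies the choice structure. *)
Lemma coproduct_all M (A : forall i, Mor (P i) M -> Prop) :
  exists (C : D) (u : Mor C M), [/\ coproduct_of C,
    forall N (v : Mor M N), (forall i x, A i x -> v ∘ x = 0) -> v ∘ u = 0 &
    forall i x, A i x -> exists y, x = u ∘ y].
Proof.
pose J : choiceType := {classic {i : I & {x : Mor (P i) M | A i x}}}.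
have [C [inj cC]] := coprodD (fun j : J => P (tag j)).
have [u uE] := coprod_map cC (fun j : J => sval (tagged j)).
exists C, u; split; first by exists J, (fun j : J => tag j), inj.
- move=> N v v0; apply: (coprod_ext cC) => -[i [x Ax]].
  by rewrite -compA uE comp0m; exact: v0.
- move=> i x Ax; pose j : J := existT _ i (exist _ x Ax).
  by exists (inj j); exact: esym (uE j).
Qed.

(** Complete u : C -> L[1] to L -> L' -> C -> L[1]. The map to M extends to L' because its shift
    kills u, and the cone of phi is the coproduct C itself, without a shift, as strong
    extension-closure demands. *)
Lemma tower_step M (s : {L : D & Mor L M}) : exists s' : {L : D & Mor L M},
  exists phi : Mor (tag s) (tag s'), [/\ tagged s' ∘ phi = tagged s,
    exists C g h, @dist D _ _ C phi g h /\ coproduct_of C &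
    forall i (y : Mor (P i) (sh (tag s))),
      fmap sh (tagged s) ∘ y = 0 -> fmap sh phi ∘ y = 0].
Proof.
case: s => L lam /=.
have [C [u [cC u0 uA]]] := coproduct_all (fun i (y : Mor (P i) (sh L)) => fmap sh lam ∘ y = 0).
have [L' [phi [g d]]] := dist_ext HD u.
have [|lam' lamE] := dist_extend HD (y := lam) (dist_back HD d).
  rewrite compmN -(unsh_hom_shM HD) u0 ?unsh_hom0 ?oppr0 //.
exists (existT _ L' lam'), phi; split=> //=.
  by exists C, g, u.
move=> i y /uA[z ->]; by rewrite compA (dist_comp0'' HD d) comp0m.
Qed.

(** The last clause tests L against classes closed under strong extensions and coproducts only, so
    that it applies to [computable] and [cogenerated] without an argument on retracts. *)
Lemma compact_approx M : exists (L R : D) (f : Mor L M) (g : Mor M R) (h : Mor R (sh L)),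
  [/\ dist f g h, rperp (image_class P) R &
      forall Q : D -> Prop, strongly_ext_closed Q -> closed_coproducts Q ->
        (forall i, Q (P i)) -> Q L].
Proof.
have [C0 [u [cC0 _ uA]]] := coproduct_all (fun i (y : Mor (P i) M) => True).
have [step stepP] := choice (@tower_step M).
pose st n := iter n step (existT _ C0 u).
pose Y n := tag (st n); pose lam n : Mor (Y n) M := tagged (st n).
have /choice_dep[phi phiP] n := stepP (st n).
have [S [inj cS]] := coprodD Y.
have [d dE] := coprod_map cS (fun i => inj i - inj i.+1 ∘ phi i).
have [T [g [h dT]]] := pt_cone HD d.
have [|f fE] := hocolim_map HD cS dE dT (lam := lam).
  by move=> n; case: (phiP n).
have [R [g' [h' dR]]] := pt_cone HD f.
exists T, R, f, g', h'; split=> // [_ [i ->] x|Q Qs Qc QP].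
  (* Desuspended, this map factors through a finite stage k and dies in M, so the passage from stage
     k to stage k.+1 kills it. *)
  have hx : h' ∘ x = 0.
    apply: (unsh_hom_inj HD); rewrite unsh_hom0.
    have cK := fs_compact_unsh HD (cP (i := i)).
    have [k [z zE]] := hocolim_factor HD cS dE dT (unsh_hom (h' ∘ x)) cK.
    have lz : lam k ∘ z = 0.
      rewrite -fE -compA -zE -(unsh_hom_shM HD) compA.
      by rewrite (dist_comp0'' HD dR) comp0m unsh_hom0.
    have [_ _ kP] := phiP k.
    have := kP i (fmap sh z ∘ iso_from (sh_unsh _)).
    rewrite !compA -!fmapM lz fmap0 comp0m => /(_ erefl) e.
    have /(sh_faithful HD) e' : fmap sh (phi k ∘ z) = fmap sh 0.
      by rewrite fmap0 -[LHS](iso_toKr (iso_sym (iso_sym (sh_unsh (P i))))) /= e comp0m.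
    by rewrite zE (hocolim_compat HD dE dT) -compA e' compm0.
  have [y ->] := dist_lift' HD dR hx.
  (* The lift of x to M factors through the initial coproduct [C0] of the tower, hence through f. *)
  have [z ->] := uA i y Logic.I.
  by rewrite -[u](fE 0%N) !compA (dist_comp0 HD dR) !comp0m.
have QC C : coproduct_of C -> Q C by case=> J [k [ij cC]]; apply: Qc cC _.
apply: (Qs.2 Y phi T); first exact: QC.
  by move=> n; have [_ [C [a [b [dn /QC QCC]]]] _] := phiP n; exists C, a, b.
by exists S, inj, d, g, h.
Qed.

Theorem compactly_generated_torsion_pair :
  smashing (strong_ext_closure (image_class P)) (rperp (image_class P)).
Proof.
split=> //; last first.
  move=> J X S inj cS XP _ [i ->] f; have [l ->] := cP cS f.
  by rewrite big1 // => p _; rewrite (XP _ (P i) _ (tagged p)) ?compm0 //; exists i.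
split=> [Y|X|M].
- split=> [YP X SX f|YS _ [i ->] f].
    by apply: (strong_ext_closure_lperp1 HD _ SX) => Z PZ; exact: YP.
  by apply: (YS (P i)) => Q _ _ _ QP; apply: QP; exists i.
- split=> [SX R RP f|XP].
    by apply: (strong_ext_closure_lperp1 HD _ SX) => Z PZ; exact: RP.
  have [L [R [f [g [h [d RP LQ]]]]]] := compact_approx X.
  (* For X left orthogonal to the right class, g is zero and X is a retract of its approximation;
     this is where closure under retracts enters. *)
  have [s sE] := dist_split HD d (XP _ RP g).
  move=> Q Qs Qr Qc QP; apply: (Qr _ _ _ _ sE); apply: LQ => // i.
  by apply: QP; exists i.
- have [L [R [f [g [h [d RP LQ]]]]]] := compact_approx M.
  exists L, R, f, g, h; split=> // Q Qs Qr Qc QP; apply: LQ => // i.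
  by apply: QP; exists i.
Qed.

End CompactlyGenerated.

(** * Compact objects inside strong extension-closures *)

Section Envelope.
Variables (D0 D : tridata).
Hypotheses (HD0 : pretriangulated D0) (HD : pretriangulated D).
Variable F : tri_functor D0 D.
Hypotheses (ffF : fully_faithful F) (cF : forall A, fs_compact (F A)).
Variables (I : Type) (P : I -> D0).
Let E := envelope (image_class P).

Lemma envelope_zero Z : is_zero Z -> E Z.
Proof. by move=> Z0 Q Qz *; exact: Qz. Qed.

Lemma envelope_ext (X Y Z : D0) (f : Mor X Y) (g : Mor Y Z) (h : Mor Z (sh X)) :
  dist f g h -> E X -> E Z -> E Y.
Proof.
move=> d EX EZ Q Q0 Qr Qe QP; exact: Qe d (EX Q Q0 Qr Qe QP) (EZ Q Q0 Qr Qe QP).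
Qed.

Definition env_factor (L : D) (K : D0) (x : Mor (F K) L) :=
  exists K' (u : Mor K K') (v : Mor (F K') L), E K' /\ x = v ∘ fmap F u.

Lemma env_factorD L K (x y : Mor (F K) L) : env_factor x -> env_factor y -> env_factor (x + y).
Proof.
move=> [A [u [v [EA ->]]]] [B [u' [v' [EB ->]]]].
have [S [f [g [s [r [d rf gs gf rs]]]]]] := split_extension HD0 A B.
exists S, (f ∘ u + s ∘ u'), (v ∘ fmap F r + v' ∘ fmap F g); split.
  exact: envelope_ext d EA EB.
rewrite fmapD compDr !compDl -!compA -!fmapM !(compA r) !(compA g) rf rs gf gs.
by rewrite !comp0m !comp1m !fmap0 !compm0 addr0 add0r.
Qed.

Lemma env_factorM L L' K (x : Mor (F K) L) (w : Mor L L') :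
  env_factor x -> env_factor (w ∘ x).
Proof. by case=> [A [u [v [EA ->]]]]; exists A, u, (w ∘ v); rewrite compA. Qed.

Lemma env_factor0 L K : env_factor (0 : Mor (F K) L).
Proof.
have [Z Z0] := pt_zero HD0; exists Z, 0, 0; split; last by rewrite comp0m.
exact: envelope_zero.
Qed.

Let Q (L : D) := forall K (x : Mor (F K) L), env_factor x.

Lemma env_factor_coproducts : closed_coproducts Q.
Proof.
move=> J X S inj cS QX K x; have [l ->] := cF cS x.
elim: l => [|p l IH]; first by rewrite big_nil; exact: env_factor0.
rewrite big_cons; apply: env_factorD IH; apply: env_factorM; exact: QX.
Qed.

(** Let [g ∘ x] factor through K2 via u, and let G be the fiber of u. The induced map from G to A
    factors through some K1, and pushing the triangle G -> K -> K2 out along G -> K1 gives an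
    extension W of K2 by K1 with maps K -> W and W -> B. Their composite differs from x by a map
    that g kills, hence by one coming from A. *)
Lemma env_factor_ext (A B C : D) (f : Mor A B) (g : Mor B C) (h : Mor C (sh A)) :
  dist f g h -> Q A -> Q C -> Q B.
Proof.
move=> d QA QC K x; have [K2 [u [v [EK2 gx]]]] := QC _ (g ∘ x).
have [G [k [w dk]]] := dist_fiber HD0 u; have dFk := tfun_dist F dk.
have [a [fa hv]] := dist_mor_back HD dFk d gx.
have [K1 [u1 [v1 [EK1 aE]]]] := QA _ a.
have [W [k2 [q dW]]] := dist_ext HD0 (fmap sh u1 ∘ w); have dFW := tfun_dist F dW.
have [|b [fv1 gb]] := dist_mor_mid HD (a := v1) (c := v) dFW d.
  by rewrite hv aE fmapM (fmapM F) (compA (iso_to _)) tfun_sh_nat !compA.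
have [|b0 [_ qb0]] := dist_mor_mid HD0 (a := u1) (c := idm K2) dk dW.
  by rewrite compm1.
have [|y yE] := dist_lift HD (y := x - b ∘ fmap F b0) d.
  by rewrite compBr gx compA gb -compA -fmapM qb0 comp1m subrr.
rewrite -[x](subrK (b ∘ fmap F b0)) yE; apply: env_factorD.
  by apply: env_factorM; exact: QA.
exists W, b0, b; split=> //; exact: envelope_ext dW EK1 EK2.
Qed.

Lemma env_factor_strongly_ext : strongly_ext_closed Q.
Proof.
split=> [Z Z0 K x|Y phi T Q0 Qc [S [inj [d [g [h [cS dE dT]]]]]] K x].
  by rewrite (to_zero x Z0); exact: env_factor0.
have QY i : Q (Y i).
  elim: i => [//|i IH].
  by have [Z [a [b [di QZ]]]] := Qc i; exact: env_factor_ext di IH QZ.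
have [i [z ->]] := hocolim_factor HD cS dE dT x (cF (A := K)).
by apply: env_factorM; exact: QY.
Qed.

Lemma strong_ext_closure_factor L K (x : Mor (F K) L) :
  strong_ext_closure (image_class (fun i => F (P i))) L ->
  exists K' (u : Mor K K') (v : Mor (F K') L), E K' /\ x = v ∘ fmap F u.
Proof.
move=> SL; suff : Q L by apply.
apply: SL; first exact: env_factor_strongly_ext.
- move=> X Y i r ri QY A y; rewrite -[y]comp1m -ri -compA.
  by apply: env_factorM; exact: QY.
- exact: env_factor_coproducts.
- move=> _ [i ->] A y; have [u ->] := ff_full ffF y.
  exists (P i), u, (idm _); split; last by rewrite comp1m.
  by move=> R _ _ _ RP; apply: RP; exists i.
Qed.

(** If F X lies in the closure, its identity factors through the envelope, and full faithfulness
    makes X a retract. The torsion pair serves the converse: it presents the closure as a left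
    orthogonal, which is closed under extensions. *)
Lemma strong_ext_closure_envelope (T : torsion_pair
    (strong_ext_closure (image_class (fun i => F (P i))))
    (rperp (image_class (fun i => F (P i))))) X :
  strong_ext_closure (image_class (fun i => F (P i))) (F X) <-> E X.
Proof.
split=> [SX|EX].
  have [K [u [v [EK e]]]] := strong_ext_closure_factor (idm (F X)) SX.
  have [w wE] := ff_full ffF v; rewrite wE -fmapM -fmap1 in e.
  have {}e := ff_inj ffF e; move=> R R0 Rr Re RP; apply: (Rr _ _ _ _ (esym e)).
  exact: (EK R R0 Rr Re RP).
case: T => _ T _; apply: (EX (fun X => strong_ext_closure _ (F X)))
  => [Z Z0|A B i r ri SB|A B C f g h d SA SC|].
- by move=> R [Rz _] *; apply: Rz; exact: is_zero_fmap.
- move=> R Rz Rr Rc RP.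
  have e : fmap F r ∘ fmap F i = idm (F A) by rewrite -fmapM ri fmap1.
  exact: (Rr _ _ _ _ e (SB R Rz Rr Rc RP)).
- apply/T => R RR; apply: (lperp1_extension HD (tfun_dist F d)).
    by move: SA => /T; exact.
  by move: SC => /T; exact.
- by move=> _ [i ->] R _ _ _ RP; apply: RP; exists i.
Qed.

End Envelope.

(** * Functors determined on compact objects *)

Section AbFunctor.
Variables (C : preadditive) (G : ab_functor C).

Lemma amap0x X Y (x : G X) : amap G (0 : Mor X Y) x = 0.
Proof. by apply: (@addIr _ (amap G 0 x)); rewrite -amapD !add0r. Qed.

Lemma amapNx X Y (f : Mor X Y) x : amap G (- f) x = - amap G f x.
Proof. by apply: (@addIr _ (amap G f x)); rewrite -amapD !addNr amap0x. Qed.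

Lemma amapx0 X Y (f : Mor X Y) : amap G f 0 = 0.
Proof. exact: zmorph0 (@amapB _ G _ _ f). Qed.

Lemma amap_isoK X Y (i : iso X Y) x : amap G (iso_from i) (amap G (iso_to i) x) = x.
Proof. by rewrite -amapM iso_toK amap1. Qed.

End AbFunctor.

Definition ab_comp (C D : preadditive) (G : ab_functor D) (T : functor C D) : ab_functor C :=
  @AbFunctor C (fun X => G (T X)) (fun X Y f => amap G (fmap T f))
    (fun X Y f => @amapB _ G _ _ (fmap T f))
    (fun X x => eq_trans (congr1 (fun u => amap G u x) (fmap1 T X)) (amap1 x))
    (fun X Y Z g f x => eq_trans (congr1 (fun u => amap G u x) (fmapM T g f))
       (amapM (fmap T g) (fmap T f) x))
    (fun X Y f g x => eq_trans (congr1 (fun u => amap G u x) (fmapD T f g))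
       (amapD (fmap T f) (fmap T g) x)).

Section Coextended.
Variables (D0 D : tridata).
Hypotheses (HD0 : pretriangulated D0) (HD : pretriangulated D).
Variable F : tri_functor D0 D.
Hypotheses (ffF : fully_faithful F) (cF : forall A, fs_compact (F A)).
Hypotheses (coprodD : has_coproducts D) (smallD0 : essentially_small D0).
Implicit Types (G : ab_functor D) (Y : D) (A K : D0).

(** These properties hold for each one-variable functor of a duality satisfying [determining]:
    directly in the second argument, over the opposite categories in the first. *)
Definition good_functor G := [/\ homological G, respects_coproducts G &
  forall Y, rperp (image_class F) Y -> forall x : G Y, x = 0].

Definition generated G Y (x : G Y) :=
  exists A (b : Mor (F A) Y) (z : G (F A)), x = amap G b z.

Definition killed G Y A (z : G (F A)) (b : Mor (F A) Y) :=
  exists A' (u : Mor A A') (d : Mor (F A') Y), b = d ∘ fmap F u /\ amap G (fmap F u) z = 0.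

Lemma generatedD G Y (x y : G Y) : generated x -> generated y -> generated (x + y).
Proof.
move=> [A [b [z ->]]] [A' [b' [z' ->]]].
have [S [f [g [s [r [_ rf gs gf rs]]]]]] := split_extension HD0 A A'.
exists S, (b ∘ fmap F r + b' ∘ fmap F g), (amap G (fmap F f) z + amap G (fmap F s) z').
rewrite (zmorphD (@amapB _ G _ _ _)) -!amapM !compDl -!compA -!fmapM rf rs gf gs !fmap0 !fmap1.
by rewrite !compm0 !compm1 addr0 add0r.
Qed.

Lemma generatedM G Y Y' (x : G Y) (f : Mor Y Y') : generated x -> generated (amap G f x).
Proof. by move=> [A [b [z ->]]]; exists A, (f ∘ b), z; rewrite amapM. Qed.

Lemma generated0 G Y : generated (0 : G Y).
Proof.
have [Z Z0] := pt_zero HD0.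
by exists Z, 0, 0; rewrite amapx0.
Qed.

Lemma killed0 G Y A (z : G (F A)) : killed z (0 : Mor (F A) Y).
Proof.
have [Z Z0] := pt_zero HD0.
by exists Z, 0, 0; rewrite comp0m fmap0 amap0x.
Qed.

Lemma killedD G Y A (z : G (F A)) (b c : Mor (F A) Y) :
  killed z b -> killed z c -> killed z (b + c).
Proof.
move=> [A1 [u [d [-> uz]]]] [A2 [v [e [-> vz]]]].
have [S [f [g [s [r [_ rf gs gf rs]]]]]] := split_extension HD0 A1 A2.
exists S, (f ∘ u + s ∘ v), (d ∘ fmap F r + e ∘ fmap F g); split.
  rewrite fmapD compDr !compDl -!compA -!fmapM !(compA r) !(compA g) rf rs gf gs.
  by rewrite !comp0m !comp1m !fmap0 !compm0 addr0 add0r.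
by rewrite fmapD amapD !fmapM !amapM uz vz !amapx0 addr0.
Qed.

Lemma killedM G Y Y' A (z : G (F A)) (b : Mor (F A) Y) (f : Mor Y Y') :
  killed z b -> killed z (f ∘ b).
Proof. by move=> [A' [u [d [-> uz]]]]; exists A', u, (f ∘ d); rewrite compA. Qed.

(** The clauses are surjectivity and injectivity of colim G(F A) -> G(Y), over the maps F A -> Y: at
    Y, the functor G is the left Kan extension of its restriction. *)
Definition computed G Y := (forall x : G Y, generated x) /\
  (forall A (b : Mor (F A) Y) (z : G (F A)), amap G b z = 0 -> killed z b).

(** The cone u of v kills z, and b factors through it. Together with [homological_fiber] this
    exchanges the two ways in which a pair (z, b) can be zero. *)
Lemma killed_back G Y A (z : G (F A)) (b : Mor (F A) Y) A' (v : Mor A' A) z' :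
  z = amap G (fmap F v) z' -> b ∘ fmap F v = 0 -> killed z b.
Proof.
move=> -> bv; have [B [u [w d]]] := pt_cone HD0 v.
have [c ->] := dist_extend HD (tfun_dist F d) bv.
exists B, u, c; split=> //.
by rewrite -amapM -fmapM (dist_comp0 HD0 d) fmap0 amap0x.
Qed.

Lemma homological_fiber G A A' (u : Mor A A') (z : G (F A)) :
  homological G -> amap G (fmap F u) z = 0 ->
  exists B (v : Mor B A) z', u ∘ v = 0 /\ z = amap G (fmap F v) z'.
Proof.
move=> hG uz; have [B [v [w d]]] := dist_fiber HD0 u.
have [z' ->] := (hG _ _ _ _ _ _ (tfun_dist F d) z).1 uz.
by exists B, v, z'; split=> //; exact: (dist_comp0 HD0 d).
Qed.

Section Shift.
Variables (T : functor D D) (T0 : functor D0 D0) (t : forall A, iso (T (F A)) (F (T0 A))).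
Hypothesis tN : forall A B (f : Mor A B),
  iso_to (t B) ∘ fmap T (fmap F f) = fmap F (fmap T0 f) ∘ iso_to (t A).
Hypothesis T0_surj : forall A, exists A', inhabited (iso A (T0 A')).
Hypothesis T_full : forall X Y (g : Mor (T X) (T Y)), exists f : Mor X Y, g = fmap T f.

(** The functor T is abstract so that one proof serves both [1] and [-1]. *)
Lemma computed_shift G Y : computed (ab_comp G T) Y -> computed G (T Y).
Proof.
move=> [gen kill]; split=> [x|A b z bz].
  have [A [b [z /= ->]]] := gen x.
  exists (T0 A), (fmap T b ∘ iso_from (t A)), (amap G (iso_to (t A)) z).
  by rewrite amapM amap_isoK.
have [A0 [i]] := T0_surj A.
have [b' b'E] := T_full (b ∘ fmap F (iso_from i) ∘ iso_to (t A0)).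
have bE : b = fmap T b' ∘ (iso_from (t A0) ∘ fmap F (iso_to i)).
  by rewrite -b'E compA iso_fromKr -compA -fmapM iso_toK fmap1 compm1.
have [|A' [u [d [dE uz]]]] := kill A0 b' (amap G (iso_from (t A0) ∘ fmap F (iso_to i)) z).
  by rewrite /= -amapM -bE.
have tu : fmap T (fmap F u) ∘ iso_from (t A0) = iso_from (t A') ∘ fmap F (fmap T0 u).
  by rewrite -[LHS](iso_toKl (t A')) (compA (iso_to _)) tN iso_fromKr.
exists (T0 A'), (fmap T0 u ∘ iso_to i), (fmap T d ∘ iso_from (t A')); split.
  by rewrite bE dE !fmapM -!compA (compA (fmap T (fmap F u))) tu -!compA.
move: uz; rewrite /= -amapM compA tu -compA -fmapM amapM => uz.
by rewrite -[LHS](amap_isoK (iso_sym (t A'))) /= uz amapx0.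
Qed.

End Shift.

(** The quantifier over G makes this class stable under shifts: G at Y[1] is the good functor
    [ab_comp G sh] at Y. *)
Definition computable Y := forall G, good_functor G -> computed G Y.

Lemma good_sh G : good_functor G -> good_functor (ab_comp G sh).
Proof.
move=> [hG cG vG]; split.
- by move=> X Y Z f g h /(dist_sh HD); exact: hG.
- by move=> I X S inj /(coproduct_sh HD); exact: cG.
- move=> Y RY; apply/vG/(rperp_sh HD _ RY) => _ [A ->].
  exists (F (unsh A)); first by exists (unsh A).
  by split; exact: iso_sym (tfun_sh_unsh F A).
Qed.

Lemma good_unsh G : good_functor G -> good_functor (ab_comp G unsh).
Proof.
move=> [hG cG vG]; split.
- by move=> X Y Z f g h /(dist_unsh HD)[k]; exact: hG.
- by move=> I X S inj /(coproduct_unsh HD); exact: cG.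
- move=> Y RY; apply/vG/(rperp_unsh HD _ RY) => _ [A ->].
  exists (F (sh A)); first by exists (sh A).
  by split; exact: iso_sym (tfun_sh F A).
Qed.

Lemma computable_sh Y : computable Y -> computable (sh Y).
Proof.
move=> QY G /good_sh/QY; apply: (computed_shift (t := fun A => iso_sym (tfun_sh F A))).
- move=> A B f /=.
  by rewrite -[LHS](iso_fromKr (tfun_sh F A)) -(compA (iso_from _)) -tfun_sh_nat iso_toKl.
- by move=> A; exists (unsh A); split; exact: iso_sym (sh_unsh A).
- exact: sh_full.
Qed.

Lemma computable_unsh Y : computable Y -> computable (unsh Y).
Proof.
move=> QY G /good_unsh/QY; apply: (computed_shift (t := fun A => iso_sym (tfun_unsh F A))).
- by move=> A B f; exact: esym (op_tfun_nat HD0 HD _ _).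
- by move=> A; exists (sh A); split; exact: iso_sym (unsh_sh A).
- exact: unsh_full.
Qed.

(** A five lemma. Surjectivity at Y uses surjectivity at X and Z and injectivity at X[1];
    injectivity at Y uses injectivity at X and Z and surjectivity at Z[-1]. *)
Lemma computable_ext (X Y Z : D) (f : Mor X Y) (g : Mor Y Z) (h : Mor Z (sh X)) :
  dist f g h -> computable X -> computable Z -> computable Y.
Proof.
move=> d QX QZ G gG; have [hG _ _] := gG.
split=> [x|K b z bz].
- have [K [c [z gx]]] := (QZ G gG).1 (amap G g x).
  have hc : amap G (h ∘ c) z = 0.
    by rewrite amapM -gx -amapM (dist_comp0' HD d) amap0x.
  have [A' [u [e [eE uz]]]] := (computable_sh QX gG).2 _ _ _ hc.
  have [K' [v [z' [uv zE]]]] := homological_fiber hG uz.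
  have [|b' b'E] := dist_lift' HD (z := c ∘ fmap F v) d.
    by rewrite compA eE -compA -fmapM uv fmap0 compm0.
  have [|y yE] := (hG _ _ _ _ _ _ d (x - amap G b' z')).1.
    by rewrite (@amapB _ G _ _ g) gx -amapM -b'E zE amapM subrr.
  rewrite -[x](subrK (amap G b' z')) yE; apply: generatedD.
    by apply: generatedM; exact: (QX G gG).1.
  by exists K', b', z'.
have [|A' [u [e [eE uz]]]] := (QZ G gG).2 K (g ∘ b) z.
  by rewrite amapM bz amapx0.
have [K' [v [z' [uv zE]]]] := homological_fiber hG uz.
have [|a aE] := dist_lift HD (y := b ∘ fmap F v) d.
  by rewrite compA eE -compA -fmapM uv fmap0 compm0.
have [|w wE] := (hG _ _ _ _ _ _ (dist_back HD d) (amap G a z')).1.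
  by rewrite -amapM -aE amapM -zE.
have [L [c [y yE]]] := (computable_unsh QZ gG).1 w.
have [S [i [q [j [p [_ pi qj qi pj]]]]]] := split_extension HD0 K' L.
(* The images in G(X) of z' under a and of y under the map through Z[-1] agree. Over the biproduct
   of K' and L this becomes the vanishing of one element under m, to which injectivity at X
   applies. *)
pose m := a ∘ fmap F p - (- unsh_hom h ∘ c) ∘ fmap F q.
have [|A2 [u2 [e2 [e2E u2z]]]] :=
    (QX G gG).2 S m (amap G (fmap F i) z' + amap G (fmap F j) y).
  rewrite (zmorphD (@amapB _ G _ _ _)) -!amapM !compBl -!compA -!fmapM pi qj qi pj.
  rewrite !fmap0 !fmap1 !compm0 !compm1 subr0 sub0r amapNx wE yE -amapM.
  by rewrite subrr.
have [B [v2 [z2 [u2v2 z2E]]]] := homological_fiber hG u2z.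
(* On the image of v2 the two parts of m agree, and f annihilates the part through Z[-1]; so b
   vanishes along [v ∘ p ∘ v2], while z comes from z2. *)
apply: (killed_back (v := v ∘ p ∘ v2) (z' := z2)).
  rewrite fmapM amapM -z2E (zmorphD (@amapB _ G _ _ _)) -!amapM -!fmapM -!compA pi pj.
  by rewrite compm1 compm0 fmap0 amap0x addr0.
have mv2 : m ∘ fmap F v2 = 0 by rewrite e2E -compA -fmapM u2v2 fmap0 compm0.
move: mv2; rewrite compBl => /subr0_eq mv2.
rewrite !fmapM !compA aE -!compA (compA a) mv2 !compA compmN.
by rewrite -(compmN f) (dist_comp0 HD (dist_back HD d)) !comp0m.
Qed.

Lemma computable_coproducts : closed_coproducts computable.
Proof.
move=> I X S inj cS QX G gG; have [_ cG _] := gG; split=> [x|A b z bz].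
  have [l ->] := ab_colimit_gen (cG _ _ _ _ cS) x.
  elim: l => [|p l IH]; first by rewrite big_nil; exact: generated0.
  rewrite big_cons; apply: generatedD IH; apply: generatedM.
  exact: (QX _ G gG).1.
have [pi [pi1 pi0]] := coprod_proj cS.
have [s ->] := fs_compact_proj (cF (A := A)) cS pi1 pi0 b.
elim: s => [|i s IH]; first by rewrite big_nil; exact: killed0.
rewrite big_cons; apply: killedD IH; apply: killedM.
by apply: (QX i G gG).2; rewrite amapM bz amapx0.
Qed.

Lemma computable_trivial Y : rperp (image_class F) Y -> computable Y.
Proof.
move=> RY G [_ _ vG]; split=> [x|A b z _].
  by rewrite (vG _ RY x); exact: generated0.
by rewrite (RY (F A) _ b); [exact: killed0 | exists A].
Qed.

Lemma computable_strongly_ext : strongly_ext_closed computable.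
Proof.
apply: (strongly_ext_closed_of HD).
- by move=> Z Z0; apply: computable_trivial => X _ f; exact: to_zero.
- exact: computable_ext.
- exact: computable_sh.
- exact: computable_coproducts.
Qed.

(* Dévissage: Y is an extension of an object of the right orthogonal of D0 by an
   object built from D0. *)
Theorem good_functor_computed G Y : good_functor G -> computed G Y.
Proof.
have [J [s sP]] := smallD0.
have [L [R [f [g [h [d RP LQ]]]]]] :=
  compact_approx HD coprodD (fun j => cF (A := s j)) Y.
apply: computable_ext d _ _ G.
  apply: LQ computable_strongly_ext computable_coproducts _ => j G gG.
  split=> [x|A b z bz]; first by exists (s j), (idm _), x; rewrite amap1.
  have [u uE] := ff_full ffF b; exists (s j), u, (idm _); rewrite -uE.
  by rewrite comp1m.
apply: computable_trivial => _ [A ->] x; have [j [i]] := sP A.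
rewrite -[x](iso_toKr (fmap_iso F i)) (RP (F (s j)) _ (x ∘ _)) ?comp0m //.
by exists j.
Qed.

End Coextended.

(** * Tensor pairings *)

(** The transition maps of a diagram without arrows are functions out of an empty type, yet two of
    them need not be convertible. *)
Lemma ab_coproduct_indep (I : choiceType) (A : I -> zmodType)
    (m m' : forall u v : I, void -> A u -> A v) (S : zmodType) (inj : forall i, A i -> S) :
  @is_ab_colimit (@Quiver I (fun _ _ => void)) A m S inj ->
  @is_ab_colimit (@Quiver I (fun _ _ => void)) A m' S inj.
Proof.
case=> iB _ univ; split=> [//|u v []|T g gB _]; apply: univ => // u v [].
Qed.

Section Tensor.
Variables (C C' C0 : preadditive) (iota : functor C0 C) (iota' : functor C0 C').

(** Such a G amounts to a homomorphism from the coend of the groups C(X, iota A) ⊗ C'(iota' A, Y)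
    over A. *)
Definition balanced X Y (T : zmodType) (G : forall A, Mor X (iota A) -> Mor (iota' A) Y -> T) :=
  [/\ forall A a a' b, G A (a + a') b = G A a b + G A a' b,
      forall A a b b', G A a (b + b') = G A a b + G A a b' &
      forall A B (f : Mor A B) a b, G B (fmap iota f ∘ a) b = G A a (b ∘ fmap iota' f)].

(* The pairings of the form (X, Y) |-> colim C(X, iota A), over the maps
   b : iota' A -> Y; the two descriptions of the zero elements are exchanged by
   passing to the opposite categories. *)
Record is_tensor (Phi : pairing C C')
    (t : forall X Y A, Mor X (iota A) -> Mor (iota' A) Y -> Phi X Y) : Prop := IsTensor {
  tens_balanced : forall X Y, balanced (t X Y);
  tens_pl : forall X X' Y A (f : Mor X' X) a b, pl f (t X Y A a b) = t X' Y A (a ∘ f) b;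
  tens_pr : forall X Y Y' A (g : Mor Y Y') a b, pr g (t X Y A a b) = t X Y' A a (g ∘ b);
  tens_surj : forall X Y x, exists A a b, x = t X Y A a b;
  tens_null : forall X Y A a b, t X Y A a b = 0 ->
    exists B (u : Mor A B) (d : Mor (iota' B) Y), b = d ∘ fmap iota' u /\ fmap iota u ∘ a = 0;
  tens_conull : forall X Y A a b, t X Y A a b = 0 ->
    exists B (v : Mor B A) (c : Mor X (iota B)), a = fmap iota v ∘ c /\ b ∘ fmap iota' v = 0 }.

Section Balanced.
Variables (X : C) (Y : C') (T : zmodType).
Variable G : forall A, Mor X (iota A) -> Mor (iota' A) Y -> T.
Hypothesis Gb : balanced G.

Lemma balanced_zmodl A b : GRing.zmod_morphism (fun a => G (A := A) a b).
Proof. by case: Gb => H _ _; apply: zmod_morphismD => a a'; exact: H. Qed.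

Lemma balanced_zmodr A a : GRing.zmod_morphism (fun b => G (A := A) a b).
Proof. by case: Gb => _ H _; apply: zmod_morphismD => b b'; exact: H. Qed.

Lemma balanced0l A b : G (A := A) 0 b = 0.
Proof. exact: zmorph0 (balanced_zmodl b). Qed.

Lemma balanced0r A a : G (A := A) a 0 = 0.
Proof. exact: zmorph0 (balanced_zmodr a). Qed.

Lemma balancedNr A a b : G (A := A) a (- b) = - G a b.
Proof. exact: zmorphN (balanced_zmodr a) b. Qed.

(** Thanks to this identity, single tensors without sums can exhaust the group. *)
Lemma balanced_sum A B S (f : Mor A S) (g : Mor S B) (s : Mor B S) (r : Mor S A) a b a' b' :
  r ∘ f = idm A -> g ∘ s = idm B -> g ∘ f = 0 -> r ∘ s = 0 ->
  G (fmap iota f ∘ a + fmap iota s ∘ a') (b ∘ fmap iota' r + b' ∘ fmap iota' g) =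
  G a b + G a' b'.
Proof.
case: Gb => Dl Dr bal rf gs gf rs.
rewrite Dl !bal !compDl -!compA -!fmapM rf gs gf rs !fmap0 !fmap1.
by rewrite !compm0 !compm1 addr0 add0r.
Qed.

End Balanced.

End Tensor.

Section Opposite.
Variables (C C' C0 : preadditive) (iota : functor C0 C) (iota' : functor C0 C').

Definition op_pairing (Phi : pairing C C') : pairing (op C') (op C) :=
  @Pairing (op C') (op C) (fun Y X => Phi X Y)
    (fun (Y Y' : C') (X : C) (g : Mor Y Y') => pr g)
    (fun (Y : C') (X X' : C) (f : Mor X' X) => pl f)
    (fun (Y Y' : C') (X : C) (g : Mor Y Y') => @prB _ _ Phi X Y Y' g)
    (fun (Y : C') (X : C) x => @pr1 _ _ Phi X Y x)
    (fun (Y Y' Y'' : C') (X : C) (g : Mor Y Y') (g' : Mor Y' Y'') x => @prM _ _ Phi X Y Y' Y'' g' g x)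
    (fun (Y Y' : C') (X : C) (g g' : Mor Y Y') x => @prD _ _ Phi X Y Y' g g' x)
    (fun (Y : C') (X X' : C) (f : Mor X' X) => @plB _ _ Phi X X' Y f)
    (fun (Y : C') (X : C) x => @pl1 _ _ Phi X Y x)
    (fun (Y : C') (X X' X'' : C) (f' : Mor X'' X') (f : Mor X' X) x =>
       @plM _ _ Phi X X' X'' Y f f' x)
    (fun (Y : C') (X X' : C) (f g : Mor X' X) x => @plD _ _ Phi X X' Y f g x)
    (fun (Y Y' : C') (X X' : C) (g : Mor Y Y') (f : Mor X' X) x =>
       esym (@plr _ _ Phi X X' Y Y' f g x)).

Lemma is_tensor_op (Phi : pairing C C') t :
  @is_tensor C C' C0 iota iota' Phi t ->
  @is_tensor (op C') (op C) (op C0) (op_functor iota') (op_functor iota) (op_pairing Phi)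
    (fun (Y : C') (X : C) A b a => t X Y A a b).
Proof.
case=> tb tl tr ts tn tc; split.
- move=> Y X; have [Dl Dr bal] := tb X Y; split=> // A B f b a.
  exact: esym (bal B A f a b).
- by move=> Y Y' X A g b a; exact: tr.
- by move=> Y X X' A f b a; exact: tl.
- by move=> Y X x; have [A [a [b ->]]] := ts X Y x; exists A, b, a.
- by move=> Y X A b a /tc[B [v [c [-> bv]]]]; exists B, v, c.
- by move=> Y X A b a /tn[B [u [d [-> ua]]]]; exists B, u, d.
Qed.

End Opposite.

(** * Universal property of tensors and colimits *)

Section TensorColimit.
Variables (C C' : preadditive) (C0 : tridata) (HC0 : pretriangulated C0).
Variables (iota : functor C0 C) (iota' : functor C0 C') (Phi : pairing C C').
Variable t : forall X Y A, Mor X (iota A) -> Mor (iota' A) Y -> Phi X Y.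
Hypothesis Ht : is_tensor t.

(** The biproduct is chosen before G, because [tens_lift] evaluates both t and another balanced map
    on the same sum. *)
Lemma tensD X Y (A B : C0) (a : Mor X (iota A)) (b : Mor (iota' A) Y)
    (a' : Mor X (iota B)) (b' : Mor (iota' B) Y) :
  exists S (f : Mor A S) (g : Mor S B) (s : Mor B S) (r : Mor S A),
  forall (T : zmodType) (G : forall A, Mor X (iota A) -> Mor (iota' A) Y -> T), balanced G ->
    G _ (fmap iota f ∘ a + fmap iota s ∘ a') (b ∘ fmap iota' r + b' ∘ fmap iota' g) =
    G _ a b + G _ a' b'.
Proof.
have [S [f [g [s [r [_ rf gs gf rs]]]]]] := split_extension HC0 A B.
by exists S, f, g, s, r => T G Gb; exact: balanced_sum.
Qed.

(** If t a b = t a' b', the sum of (a, b) and (a', - b') is a null tensor, and [tens_null] certifies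
    this by a factorization on which every balanced map vanishes. *)
Lemma tens_lift X Y (T : zmodType) (G : forall A, Mor X (iota A) -> Mor (iota' A) Y -> T) :
  balanced G -> exists h : Phi X Y -> T,
    GRing.zmod_morphism h /\ forall A a b, h (t a b) = G A a b.
Proof.
move=> Gb; have tb := tens_balanced Ht X Y.
have wd A a b B a' b' : t a b = t (Y := Y) (A := B) a' b' -> G A a b = G B a' b'.
  move=> e; have [S [f [g [s [r sumE]]]]] := tensD a b a' (- b').
  have := sumE _ _ tb; rewrite (balancedNr tb) e subrr => /(tens_null Ht)[E [u [d [bE ua]]]].
  have := sumE _ _ Gb; rewrite bE; have [_ _ bal] := Gb.
  by rewrite -bal ua (balanced0l Gb) (balancedNr Gb) => /esym/subr0_eq.
have /choice[h hE] (x : Phi X Y) : exists z, forall A a b, x = t a b -> z = G A a b.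
  by have [A [a [b ->]]] := tens_surj Ht x; exists (G A a b) => B a' b'; exact: wd.
exists h; split=> [|A a b]; last exact: hE.
apply: zmod_morphismD => x y.
have [A [a [b xE]]] := tens_surj Ht x; have [B [a' [b' yE]]] := tens_surj Ht y.
have [S [f [g [s [r sumE]]]]] := tensD a b a' b'.
have := sumE _ _ tb; rewrite -xE -yE => /esym/hE ->.
by rewrite sumE // (hE _ _ _ _ xE) (hE _ _ _ _ yE).
Qed.

Lemma tens_ext X Y (T : zmodType) (h h' : Phi X Y -> T) :
  (forall A a b, h (t (A := A) a b) = h' (t a b)) -> h = h'.
Proof. by move=> e; apply/funext => x; have [A [a [b ->]]] := tens_surj Ht x. Qed.

(** For fixed a, the maps sending b to [g v (t a b)] extend along the colimit of the groups of maps
    from iota' A; uniqueness of the extensions makes the result balanced, and it descends to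
    tensors. *)
Lemma tensor_colimit (M : C) (N : C') (Q : quiver) (N_ : diagram Q C')
    (inj : forall v, Mor (N_ v) N) : is_C0_colimit iota' inj ->
  @is_ab_colimit Q (fun v => Phi M (N_ v))
    (fun u v e => pr (dmap N_ e)) (Phi M N) (fun v => pr (inj v)).
Proof.
move=> [injE colim]; split=> [v|u v e x|T g gB gE]; first exact: prB.
  by rewrite -prM injE.
have tDl v A a a' b : t (a + a') b = t (X := M) (Y := N_ v) (A := A) a b + t a' b.
  by have [H _ _] := tens_balanced Ht M (N_ v); exact: H.
have /choice_dep[G GP] A : exists GA : Mor M (iota A) -> Mor (iota' A) N -> T,
    forall a, GRing.zmod_morphism (GA a) /\
      forall v b, GA a (inj v ∘ b) = g v (t a b).
  have /choice[GA GAP] (a : Mor M (iota A)) : exists k : Mor (iota' A) N -> T,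
      GRing.zmod_morphism k /\ forall v b, k (inj v ∘ b) = g v (t a b).
    have [_ _ univ] := colim A.
    have [||h [hP _]] := univ T (fun v b => g v (t a b)).
    - move=> v b b'; rewrite -gB; congr (g v _).
      exact: (balanced_zmodr (tens_balanced Ht M (N_ v))).
    - by move=> u v e b; rewrite -(tens_pr Ht) gE.
    - by exists h.
  by exists GA.
have GU A (h h' : Mor (iota' A) N -> T) : GRing.zmod_morphism h -> GRing.zmod_morphism h' ->
    (forall v b, h (inj v ∘ b) = h' (inj v ∘ b)) -> forall b, h b = h' b.
  move=> hB h'B e b0; have [_ injcE univ] := colim A.
  have [||k [_ kU]] := univ T (fun v b => h (inj v ∘ b)).
  - by move=> v b b'; rewrite compBr hB.
  - by move=> u v a b; rewrite injcE.
  by rewrite -(kU h) // -(kU h') //; split=> // v b; rewrite e.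
have Gb : balanced G.
  split=> [A a a' b|A a b b'|A B f a b].
  - refine (GU A (G A (a + a')) (fun b => G A a b + G A a' b) _ _ _ b) => [|b1 b2|v b1].
    + exact: (GP A (a + a')).1.
    + by rewrite (GP A a).1 (GP A a').1 opprD addrACA.
    + by rewrite !(GP A _).2 tDl (zmorphD (gB v)).
  - exact: (zmorphD (GP A a).1).
  - refine (GU B (G B (fmap iota f ∘ a)) (fun b => G A a (b ∘ fmap iota' f)) _ _ _ b) => [|b1 b2|v b1].
    + exact: (GP B _).1.
    + by rewrite compBl (GP A a).1.
    + have [_ _ bal] := tens_balanced Ht M (N_ v).
      by rewrite (GP B _).2 bal -compA (GP A a).2.
have [h [hB hE]] := tens_lift Gb.
exists h; split=> [|h' [h'B h'E]].
  split=> // v x; have [A [a [b ->]]] := tens_surj Ht x.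
  by rewrite (tens_pr Ht) hE (GP A a).2.
apply: tens_ext => A a b; rewrite hE.
refine (GU A (G A a) (fun b => h' (t a b)) _ _ _ b) => [|b1 b2|v b1].
- exact: (GP A a).1.
- by rewrite (balanced_zmodr (tens_balanced Ht M N)) h'B.
- by rewrite (GP A a).2 -(tens_pr Ht) h'E.
Qed.

(** Compactness says that a coproduct is the C0-colimit of its summands, viewed as a diagram without
    arrows. *)
Lemma tensor_respects_coproducts M :
  (forall A, compact (iota' A)) -> respects_coproducts (pairing_r Phi M).
Proof.
move=> cC0 I X S inj cS.
pose N_ : diagram (@Quiver I (fun _ _ => void)) C' := 
    @Diagram (@Quiver I (fun _ _ => void)) C' X (fun _ _ e => match e with end).
have colim : is_C0_colimit (N_ := N_) iota' inj.
  by split=> [u v []|A]; exact: ab_coproduct_indep (cC0 A I X S inj cS).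
exact: ab_coproduct_indep (tensor_colimit M colim).
Qed.

End TensorColimit.

(** * Construction of the group of tensors *)

Section TensorConstruction.
Variables (C C' C0 : tridata).
Hypotheses (HC : pretriangulated C) (HC' : pretriangulated C') (HC0 : pretriangulated C0).
Variables (iota : tri_functor C0 C) (iota' : tri_functor C0 C').
Variables (J : choiceType) (s : J -> C0).
Hypothesis sP : forall A, exists j, inhabited (iso A (s j)).

Section Representatives.
Variables (X : C) (Y : C').

Record rep := Rep { rA : C0; ra : Mor X (iota rA); rb : Mor (iota' rA) Y }.

Definition rle (r q : rep) := exists u : Mor (rA r) (rA q),
  ra q = fmap iota u ∘ ra r /\ rb r = rb q ∘ fmap iota' u.

(** A single common upper bound replaces chains of zigzags: [weak_pushout] makes this relation
    transitive. *)
Definition req (r q : rep) := exists m, rle r m /\ rle q m.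

Lemma rle_refl r : rle r r.
Proof. by exists (idm _); rewrite !fmap1 comp1m compm1. Qed.

Lemma rle_trans q r m : rle r q -> rle q m -> rle r m.
Proof.
move=> [u [au bu]] [v [av bv]]; exists (v ∘ u).
by rewrite !fmapM -compA -au compA -bv.
Qed.

Lemma rle_req r q : rle r q -> req r q.
Proof. by move=> rq; exists q; split=> //; exact: rle_refl. Qed.

Lemma req_sym r q : req r q -> req q r.
Proof. by case=> m [? ?]; exists m. Qed.

(* With sums, this says that the maps iota' A -> Y form a filtered category. *)
Lemma weak_pushout A B B' (f : Mor A B) (g : Mor A B') (b : Mor (iota' B) Y) b' :
  b ∘ fmap iota' f = b' ∘ fmap iota' g ->
  exists E (q : Mor B E) (q' : Mor B' E) (e : Mor (iota' E) Y),
    [/\ q ∘ f = q' ∘ g, b = e ∘ fmap iota' q & b' = e ∘ fmap iota' q'].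
Proof.
move=> bf; have [S [i [p [j [r [_ ri pj pi rj]]]]]] := split_extension HC0 B B'.
have [E [q [k d]]] := pt_cone HC0 (i ∘ f - j ∘ g).
have [|e eE] := dist_extend HC' (y := b ∘ fmap iota' r + b' ∘ fmap iota' p) (tfun_dist iota' d).
  rewrite fmapB compBr !compDl -!compA -!fmapM !(compA r) !(compA p) ri pj pi rj.
  by rewrite !comp1m !comp0m !fmap0 !compm0 addr0 add0r bf subrr.
exists E, (q ∘ i), (q ∘ j), e; split.
- by apply: subr0_eq; rewrite -!compA -compBr (dist_comp0 HC0 d).
- rewrite fmapM compA -eE compDl -!compA -!fmapM ri pi.
  by rewrite fmap1 fmap0 compm1 compm0 addr0.
- rewrite fmapM compA -eE compDl -!compA -!fmapM rj pj.
  by rewrite fmap1 fmap0 compm1 compm0 add0r.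
Qed.

Lemma req_trans q r m : req r q -> req q m -> req r m.
Proof.
move=> [[E a d] [rE [u /= [au bu]]]] [[E' a' d'] [[v /= [av bv]] mE']].
have [|W [w [w' [e [wu dE d'E]]]]] := weak_pushout (f := u) (g := v) (b := d) (b' := d').
  by rewrite -bu -bv.
exists (Rep (fmap iota w ∘ a) e); split.
  by apply: rle_trans rE _; exists w.
apply: rle_trans mE' _; exists w'; split=> //=.
by rewrite au av !compA -!fmapM wu.
Qed.

(** The type [rep] is as large as the objects of C0, whereas the carrier of a [zmodType] must be
    small; this type only ranges over the chosen objects [s j]. *)
Definition small_rep := {j : J & (Mor X (iota (s j)) * Mor (iota' (s j)) Y)%type}.

Definition rep_of (p : small_rep) : rep := Rep (tagged p).1 (tagged p).2.

Lemma req_small r : exists p, req r (rep_of p).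
Proof.
case: r => A a b; have [j [i]] := sP A.
exists (existT _ j (fmap iota (iso_to i) ∘ a, b ∘ fmap iota' (iso_from i))).
apply: rle_req; exists (iso_to i); split=> //=.
by rewrite -compA -fmapM iso_toK fmap1 compm1.
Qed.

(* Elements are classes of representatives, which are determined by their small
   members. *)
Definition tcarrier := {classic {c : small_rep -> Prop | exists r, c = req r \o rep_of}}.

HB.instance Definition _ := Choice.on tcarrier.

Definition tmk (r : rep) : tcarrier := exist _ (req r \o rep_of) (ex_intro _ r erefl).

Lemma tmk_eq r q : req r q -> tmk r = tmk q.
Proof.
move=> rq; apply: eq_exist => /=; apply/funext => p; apply/propext; split.
  by apply: req_trans; exact: req_sym.
exact: req_trans.
Qed.

Lemma tmk_inj r q : tmk r = tmk q -> req r q.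
Proof.
move=> /(congr1 sval) /= e; have [p qp] := req_small q.
apply: req_trans (req_sym qp).
by have := congr1 (fun c => c p) e; rewrite /= => ->.
Qed.

Lemma tmk_surj (x : tcarrier) : exists r, x = tmk r.
Proof. by case: x => c [r cE]; exists r; exact: eq_exist. Qed.

Definition trep (x : tcarrier) : rep := sval (cid (tmk_surj x)).

Lemma trepK x : tmk (trep x) = x.
Proof. by rewrite /trep; case: (cid _). Qed.

(** Addition is first a relation, free of the choice of a biproduct. [rsum_ex] gives a sum that maps
    to every other one, so all sums define the same class. *)
Definition rsum (r q w : rep) := exists (f : Mor (rA r) (rA w)) (g : Mor (rA q) (rA w)),
  [/\ rb w ∘ fmap iota' f = rb r, rb w ∘ fmap iota' g = rb q &
      ra w = fmap iota f ∘ ra r + fmap iota g ∘ ra q].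

Lemma rsum_le r r' q w : rle r r' -> rsum r' q w -> rsum r q w.
Proof.
move=> [u [au bu]] [f [g [bf bg aw]]]; exists (f ∘ u), g; split=> //.
  by rewrite fmapM compA bf.
by rewrite fmapM -compA -au.
Qed.

Lemma rsum_sym r q w : rsum r q w -> rsum q r w.
Proof. by move=> [f [g [? ? ?]]]; exists g, f; rewrite addrC. Qed.

Lemma rsum_ex r q : exists w, rsum r q w /\
  forall m (f : Mor (rA r) (rA m)) (g : Mor (rA q) (rA m)),
    rb m ∘ fmap iota' f = rb r -> rb m ∘ fmap iota' g = rb q ->
    exists u : Mor (rA w) (rA m), rb m ∘ fmap iota' u = rb w /\
      fmap iota u ∘ ra w = fmap iota f ∘ ra r + fmap iota g ∘ ra q.
Proof.
have [S [i [p [j [k [_ ki pj pi kj]]]]]] := split_extension HC0 (rA r) (rA q).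
exists (Rep (fmap iota i ∘ ra r + fmap iota j ∘ ra q)
            (rb r ∘ fmap iota' k + rb q ∘ fmap iota' p)); split.
  exists i, j; rewrite /= !compDl -!compA -!fmapM ki pj pi kj.
  by rewrite !fmap1 !fmap0 !compm1 !compm0 !(addr0, add0r).
move=> m f g fE gE; exists (f ∘ k + g ∘ p); rewrite /= !fmapD; split.
  by rewrite compDr !fmapM !compA fE gE.
rewrite compDr !compDl !compA -!fmapM -!compA ki pj pi kj.
by rewrite !compm0 !compm1 !fmap0 !comp0m addr0 add0r.
Qed.

Definition radd r q := sval (cid (rsum_ex r q)).

Lemma raddP r q : rsum r q (radd r q).
Proof. by rewrite /radd; case: (cid _) => w []. Qed.

Lemma radd_map r q m (f : Mor (rA r) (rA m)) (g : Mor (rA q) (rA m)) :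
  rb m ∘ fmap iota' f = rb r -> rb m ∘ fmap iota' g = rb q ->
  exists u : Mor (rA (radd r q)) (rA m), rb m ∘ fmap iota' u = rb (radd r q) /\
    fmap iota u ∘ ra (radd r q) = fmap iota f ∘ ra r + fmap iota g ∘ ra q.
Proof. by rewrite /radd; case: (cid _) => w /= [_ H]; exact: H. Qed.

Lemma rsum_radd r q w : rsum r q w -> req (radd r q) w.
Proof.
move=> [f [g [bf bg aw]]]; have [u [bu au]] := radd_map bf bg.
by apply: rle_req; exists u; rewrite au bu.
Qed.

Lemma req_radd r r' q : req r r' -> req (radd r q) (radd r' q).
Proof.
move=> [m [rm r'm]]; apply: (@req_trans (radd m q)).
  by apply: rsum_radd; apply: rsum_le rm _; exact: raddP.
by apply/req_sym/rsum_radd; apply: rsum_le r'm _; exact: raddP.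
Qed.

Definition tadd (x y : tcarrier) := tmk (radd (trep x) (trep y)).

Lemma tadd_comm : commutative tadd.
Proof. by move=> x y; apply/tmk_eq/rsum_radd/rsum_sym; exact: raddP. Qed.

Lemma tadd_mk r q w : rsum r q w -> tadd (tmk r) (tmk q) = tmk w.
Proof.
move=> /rsum_radd e; have tr z : req (trep (tmk z)) z by apply: tmk_inj; rewrite trepK.
rewrite -(tmk_eq e) /tadd (tmk_eq (req_radd _ (tr r))).
rewrite (tmk_eq (rsum_radd (rsum_sym (raddP _ _)))).
rewrite (tmk_eq (req_radd _ (tr q))).
exact/tmk_eq/rsum_radd/rsum_sym/raddP.
Qed.

Lemma tadd_assoc : associative tadd.
Proof.
move=> x y z; rewrite -[x]trepK -[y]trepK -[z]trepK.
move: (trep x) (trep y) (trep z) => r q m {x y z}.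
rewrite !(tadd_mk (raddP _ _)); apply/tmk_eq/rsum_radd.
have [f [g [bf bg af]]] := raddP r q.
have [F [G [bF bG aF]]] := raddP (radd r q) m.
have [||u [bu au]] := radd_map (r := q) (q := m) (m := radd (radd r q) m) (f := F ∘ g) (g := G).
- by rewrite fmapM compA bF bg.
- by [].
exists (F ∘ f), u; split=> //; first by rewrite fmapM compA bF bf.
by rewrite au aF af compDr !fmapM !compA addrA.
Qed.

Definition tzero : tcarrier := tmk (@Rep (s (sval (cid (sP (sval (cid (pt_zero HC0))))))) 0 0).

Lemma tzeroE A (b : Mor (iota' A) Y) : tmk (Rep 0 b) = tzero.
Proof. by apply/esym/tmk_eq/rle_req; exists 0; rewrite /= compm0 fmap0 compm0. Qed.

Lemma tadd0 : left_id tzero tadd.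
Proof.
move=> x; rewrite -[x]trepK; apply: tadd_mk; exists 0, (idm _).
by rewrite /= !fmap0 !fmap1 compm0 comp0m compm1 comp1m add0r.
Qed.

Definition topp (x : tcarrier) := tmk (Rep (- ra (trep x)) (rb (trep x))).

Lemma taddN : left_inverse tzero topp tadd.
Proof.
move=> x; rewrite -{2}[x]trepK -(tzeroE (rb (trep x))).
apply: tadd_mk; exists (idm _), (idm _); rewrite /= !fmap1 !compm1 !comp1m.
by rewrite addNr.
Qed.

Definition tzmod : zmodType :=
  HB.pack tcarrier (GRing.isZmodule.Build tcarrier tadd_assoc tadd_comm tadd0 taddN).

Lemma tzmodD r q w : rsum r q w -> (tmk r : tzmod) + tmk q = tmk w.
Proof. exact: tadd_mk. Qed.

Lemma tzmod0 A a b : tmk (@Rep A a b) = 0 :> tzmod ->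
  exists B (u : Mor A B) (d : Mor (iota' B) Y), b = d ∘ fmap iota' u /\ fmap iota u ∘ a = 0.
Proof.
move=> /tmk_inj[[B c d] [[u /= [au bu]] [v /= [av _]]]].
by exists B, u, d; rewrite -au av compm0.
Qed.

End Representatives.

Lemma tmap_proof X X' Y Y' (f : Mor X' X) (g : Mor Y Y') :
  exists h : tzmod X Y -> tzmod X' Y',
    forall A a b, h (tmk (@Rep X Y A a b)) = tmk (Rep (a ∘ f) (g ∘ b)).
Proof.
exists (fun x => tmk (Rep (ra (trep x) ∘ f) (g ∘ rb (trep x)))) => A a b.
have [m [[u [au bu]] [v [av bv]]]] := tmk_inj (trepK (tmk (Rep a b))).
apply: tmk_eq; exists (Rep (ra m ∘ f) (g ∘ rb m)); split.
  by exists u; rewrite /= au bu !compA.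
by move: av bv => /= -> ->; exists v; rewrite /= !compA.
Qed.

Definition tmap X X' Y Y' (f : Mor X' X) (g : Mor Y Y') := sval (cid (tmap_proof f g)).

Lemma tmapE X X' Y Y' (f : Mor X' X) (g : Mor Y Y') A a b :
  tmap f g (tmk (@Rep X Y A a b)) = tmk (Rep (a ∘ f) (g ∘ b)).
Proof. by rewrite /tmap; case: (cid _). Qed.

Lemma tmapB X X' Y Y' (f : Mor X' X) (g : Mor Y Y') : GRing.zmod_morphism (tmap f g).
Proof.
apply: zmod_morphismD => x y; have [r ->] := tmk_surj x; have [q ->] := tmk_surj y.
have [i [j [bi bj aw]]] := raddP r q; rewrite (tzmodD (raddP r q)).
case: r q (radd r q) i j bi bj aw => A a b [A' a' b'] [W c d] /= i j bi bj aw.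
rewrite !tmapE (@tzmodD _ _ _ _ (Rep (c ∘ f) (g ∘ d))) //.
exists i, j => /=; split; [by rewrite -compA bi | by rewrite -compA bj |].
by rewrite aw compDl !compA.
Qed.

Lemma tmk_Dl X Y A (a a' : Mor X (iota A)) (b : Mor (iota' A) Y) :
  tmk (Rep (a + a') b) = (tmk (Rep a b) : tzmod X Y) + tmk (Rep a' b).
Proof.
apply/esym/tzmodD; exists (idm _), (idm _) => /=.
by rewrite !fmap1 !compm1 !comp1m.
Qed.

(** The sum of the two tensors receives two maps i and j from A, and i + j is a morphism to it from
    the representative (a, b + b'). *)
Lemma tmk_Dr X Y A (a : Mor X (iota A)) (b b' : Mor (iota' A) Y) :
  tmk (Rep a (b + b')) = (tmk (Rep a b) : tzmod X Y) + tmk (Rep a b').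
Proof.
rewrite (tzmodD (raddP _ _)); have [i [j [bi bj aw]]] := raddP (Rep a b) (Rep a b').
apply/tmk_eq/rle_req; exists (i + j).
by rewrite !fmapD /= compDl compDr bi bj aw.
Qed.

Definition tpairing : pairing C C'.
Proof.
refine (@Pairing C C' tzmod (fun X X' Y f => tmap f (idm Y))
  (fun X Y Y' g => tmap (idm X) g) (fun X X' Y f => tmapB f (idm Y)) _ _ _
  (fun X Y Y' g => tmapB (idm X) g) _ _ _ _).
- by move=> X Y x; have [[A a b] ->] := tmk_surj x; rewrite tmapE compm1 comp1m.
- move=> X X' X'' Y f f' x; have [[A a b] ->] := tmk_surj x.
  by rewrite !tmapE !comp1m compA.
- move=> X X' Y f g x; have [[A a b] ->] := tmk_surj x.
  by rewrite !tmapE compDr tmk_Dl.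
- by move=> X Y x; have [[A a b] ->] := tmk_surj x; rewrite tmapE compm1 comp1m.
- move=> X Y Y' Y'' g f x; have [[A a b] ->] := tmk_surj x.
  by rewrite !tmapE !compm1 compA.
- move=> X Y Y' f g x; have [[A a b] ->] := tmk_surj x.
  by rewrite !tmapE compDl tmk_Dr.
- move=> X X' Y Y' f g x; have [[A a b] ->] := tmk_surj x.
  by rewrite !tmapE !comp1m !compm1.
Defined.

Lemma tpairing_is_tensor :
  @is_tensor C C' C0 iota iota' tpairing (fun X Y A a b => tmk (Rep a b)).
Proof.
split.
- move=> X Y; split=> [A a a' b|A a b b'|A B f a b].
  + exact: tmk_Dl.
  + exact: tmk_Dr.
  + by apply/esym/tmk_eq/rle_req; exists f.
- by move=> X X' Y A f a b; rewrite /= tmapE comp1m.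
- by move=> X Y Y' A g a b; rewrite /= tmapE compm1.
- by move=> X Y x; have [[A a b] ->] := tmk_surj x; exists A, a, b.
- move=> X Y A a b; exact: tzmod0.
(* The second description of zero: a lifts to the fiber v of u, and b vanishes along v because it
   factors through u. *)
- move=> X Y A a b /tzmod0[B [u [d [-> ua]]]].
  have [D [v [w dv]]] := dist_fiber HC0 u.
  have [c ->] := dist_lift HC (tfun_dist iota dv) ua.
  exists D, v, c; split=> //.
  by rewrite -compA -fmapM (dist_comp0 HC0 dv) fmap0 compm0.
Qed.

End TensorConstruction.

(** * Coextensions *)

Section DirectSum.
Variables (I : choiceType) (A : I -> zmodType).

Lemma fsum_seqE (T : zmodType) (f : I -> T) (s : seq I) :
  uniq s -> (forall i, i \notin s -> f i = 0) ->
  \sum_(i \in setT) f i = \sum_(i <- s) f i.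
Proof.
move=> us f0; rewrite (fsbigE s) //; last by move=> i _; exact: f0.
by apply: eq_bigl => i; exact: mem_set.
Qed.

Lemma fin_supp_seq (a : forall i, A i) :
  fin_supp a -> exists s : seq I, uniq s /\ forall i, i \notin s -> a i = 0.
Proof.
move=> /finite_seqP[s sE]; exists (undup s); split=> [|i]; first exact: undup_uniq.
rewrite mem_undup => si; apply/eqP; apply: contraNT si => ai.
by have : [set` s]%classic i by rewrite -sE.
Qed.

Lemma seq_fin_supp (a : forall i, A i) (s : seq I) :
  (forall i, i \notin s -> a i = 0) -> fin_supp a.
Proof.
move=> a0; apply: sub_finite_set (finite_seq s) => i /= ai.
by apply: contraNT ai => /a0 ->.
Qed.

Lemma dsum_point i (x : A i) : exists a : forall i, A i,
  [/\ fin_supp a, a i = x, forall j, j != i -> a j = 0 &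
  forall (T : zmodType) (e : forall i, A i -> T), (forall j, GRing.zmod_morphism (e j)) ->
    \sum_(j \in setT) e j (a j) = e i x].
Proof.
pose a j : A j := match pselect (i = j) with
  | left e => match e in _ = k return A k with erefl => x end
  | right _ => 0 end.
have aE : a i = x by rewrite /a; case: pselect => // e; rewrite (Prop_irrelevance e erefl).
have a0 j : j != i -> a j = 0.
  by move=> /eqP ji; rewrite /a; case: pselect => // e; case: ji.
exists a; split=> //.
  by apply: (@seq_fin_supp a [:: i]) => j; rewrite inE; exact: a0.
move=> T e eB; rewrite (@fsum_seqE _ _ [:: i]) ?big_seq1 ?aE // => j.
by rewrite inE => /a0 ->; exact: zmorph0 (eB j).
Qed.

End DirectSum.

(** The supports of the rows met by a lie in a common finite set, over which the two sums are
    exchanged. *)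
Lemma dsum_complex (I J : choiceType) (A : I -> zmodType) (B : J -> zmodType) (T : zmodType)
    (d : forall i j, A i -> B j) (e : forall j, B j -> T) (a : forall i, A i) :
  (forall i j, GRing.zmod_morphism (d i j)) -> (forall j, GRing.zmod_morphism (e j)) ->
  (forall i x, fin_supp (fun j => d i j x)) ->
  (forall i x, \sum_(j \in setT) e j (d i j x) = 0) -> fin_supp a ->
  \sum_(j \in setT) e j (\sum_(i \in setT) d i j (a i)) = 0.
Proof.
move=> dB eB dfin ed0 /fin_supp_seq[r [ur a0]].
have [s sP] := choice (fun i => fin_supp_seq (dfin i (a i))).
pose S := undup (flatten (map s r)).
have dE j : \sum_(i \in setT) d i j (a i) = \sum_(i <- r) d i j (a i).
  by apply: fsum_seqE => // i /a0 ->; exact: zmorph0 (dB i j).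
have dS i j : i \in r -> j \notin S -> d i j (a i) = 0.
  move=> ir; rewrite mem_undup => jS; apply: (sP i).2; apply: contraNN jS => js.
  by apply/flattenP; exists (s i) => //; exact: map_f.
rewrite (@fsum_seqE _ _ _ S) ?undup_uniq //; last first.
  move=> j jS; rewrite dE big1_seq ?(zmorph0 (eB j)) // => i /andP[_ ir].
  exact: dS.
under eq_bigr do rewrite dE (zmorph_sum (eB _)).
rewrite exchange_big big1_seq // => i /andP[_ ir].
rewrite -[RHS](ed0 i (a i)) (@fsum_seqE _ _ _ S) ?undup_uniq // => j jS.
by rewrite dS // (zmorph0 (eB j)).
Qed.

(** * Coextension pairings as tensor pairings *)

Section Coextension.
Variables (C C' C0 : tridata).
Hypotheses (HC : pretriangulated C) (HC' : pretriangulated C') (HC0 : pretriangulated C0).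
Variables (iota : tri_functor C0 C) (iota' : tri_functor C0 C').

Section OfTensor.
Variables (Phi : pairing C C') (t : forall X Y A, Mor X (iota A) -> Mor (iota' A) Y -> Phi X Y).
Hypothesis Ht : is_tensor t.

(** A is a finite biproduct of the [Y j], and z has the components [y j]. This turns a finite sum of
    tensors into a single one. *)
Lemma tens_gather X (J : eqType) (Y : J -> C0) (y : forall j, Mor X (iota (Y j))) (s : seq J) :
  exists (A : C0) (z : Mor X (iota A)) (q : forall j, Mor A (Y j)),
    forall j, j \in s -> y j = fmap iota (q j) ∘ z.
Proof.
suff [A [z H]] : exists (A : C0) (z : Mor X (iota A)),
    forall j, j \in s -> exists q : Mor A (Y j), y j = fmap iota q ∘ z.
  have /choice_dep[q qE] j : exists q : Mor A (Y j), j \in s -> y j = fmap iota q ∘ z.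
    case: (boolP (j \in s)) => [/H[q qE]|_]; last by exists 0.
    by exists q.
  by exists A, z, q.
elim: s => [|i s [A [z IH]]].
  by have [Z _] := pt_zero HC0; exists Z, 0.
have [S [f [g [k [r [_ rf gk gf rk]]]]]] := split_extension HC0 A (Y i).
exists S, (fmap iota f ∘ z + fmap iota k ∘ y i) => j; rewrite inE => /orP[/eqP->|/IH[q ->]].
  exists g; rewrite compDr !compA -!fmapM gf gk.
  by rewrite fmap0 fmap1 comp0m comp1m add0r.
exists (q ∘ r); rewrite compDr !compA -!fmapM -!compA rf rk.
by rewrite !compm1 compm0 fmap0 comp0m addr0.
Qed.

Lemma tens_sumr X Y A (a : Mor X (iota A)) (J : Type) (r : seq J) (b : J -> Mor (iota' A) Y) :
  t a (\sum_(j <- r) b j) = \sum_(j <- r) t a (b j).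
Proof. exact (zmorph_sum (balanced_zmodr (tens_balanced Ht X Y) a) r b). Qed.

(** The generators are all maps from chosen objects to Z, the relations all finite families of maps
    composing with them to zero, so exactness over C0 is immediate. For exactness after applying
    C(X, -), gather the terms of a vanishing sum into one tensor with left factor z; [tens_conull]
    writes z as v followed after c, where v yields a relation and c its coefficient. *)
Lemma tens_coext_pairing : essentially_small C0 ->
  is_coext_pairing (fun X Y (a : Mor X (iota Y)) => t a (idm (iota' Y))).
Proof.
have bal X Y A B (f : Mor A B) a b : t (fmap iota f ∘ a) b = t (X := X) (Y := Y) a (b ∘ fmap iota' f).
  by have [_ _ H] := tens_balanced Ht X Y; exact: H.
have tBl X Y A b : GRing.zmod_morphism (fun a => t (X := X) (Y := Y) (A := A) a b).
  exact: (balanced_zmodl (tens_balanced Ht X Y)).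
have aN X A B (f : Mor A B) (x : Mor X (iota A)) :
    t (fmap iota f ∘ x) (idm (iota' B)) = pr (fmap iota' f) (t x (idm (iota' A))).
  by rewrite bal (tens_pr Ht) comp1m compm1.
move=> [J0 [s sP]]; split.
  split=> [X A|X X' A f x|X A B f x]; first exact: tBl.
    by rewrite /= (tens_pl Ht).
  exact: aN.
move=> X; split=> [A|A B f x|Z]; [exact: tBl | exact: aN |].
pose J : choiceType := {j : J0 & Mor (iota' (s j)) Z}.
pose Y (j : J) := s (tag j); pose p (j : J) : Mor (iota' (Y j)) Z := tagged j.
pose I : choiceType := {classic {w : {i : J0 & forall j : J, Mor (s i) (Y j)} |
  fin_supp (projT2 w) /\ \sum_(j \in setT) p j ∘ fmap iota' (projT2 w j) = 0}}.
pose XI (i : I) := s (projT1 (sval i)); pose m (i : I) : forall j, Mor (XI i) (Y j) := projT2 (sval i).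
have mfin i : fin_supp (m i) by case: i => w [].
have pm i : \sum_(j \in setT) p j ∘ fmap iota' (m i j) = 0 by case: i => w [].
have eB (B : C0) j : GRing.zmod_morphism (fun v : Mor B (Y j) => p j ∘ fmap iota' v).
  by move=> v v'; rewrite fmapB compBr.
have tB j : GRing.zmod_morphism (fun y => pr (p j) (t y (idm (iota' (Y j)))) : Phi X Z).
  by move=> y y'; rewrite tBl prB.
have tpE j y : pr (p j) (t y (idm (iota' (Y j)))) = t y (p j) :> Phi X Z.
  by rewrite (tens_pr Ht) compm1.
exists I, J, XI, Y, m, p; split=> // [B|]; split.
- move=> x; have [j0 [phi]] := sP B.
  pose j : J := existT _ j0 (x ∘ fmap iota' (iso_from phi)).
  have [b [bf bj _ bE]] := @dsum_point J (fun j => Mor B (Y j)) j (iso_to phi).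
  exists b; split=> //; rewrite (bE _ _ (@eB B)) /p /=.
  by rewrite -compA -fmapM iso_toK fmap1 compm1.
- move=> b bf; split=> [b0|[a [af abE]]]; last first.
    rewrite (eq_fsbigr (fun j => p j ∘ fmap iota' (\sum_(i \in setT) m i j ∘ a i))); last first.
      by move=> j _; rewrite abE.
    apply: (@dsum_complex _ _ (fun i => Mor B (XI i)) (fun j => Mor B (Y j)) _
      (fun i j u => m i j ∘ u) (fun j v => p j ∘ fmap iota' v)) => // [i j|i x|i x].
    + exact: comp_zmod_r.
    + have [S [_ mS]] := fin_supp_seq (mfin i).
      by apply: (@seq_fin_supp _ _ _ S) => j /mS ->; rewrite comp0m.
    + have [S [uS mS]] := fin_supp_seq (mfin i).
      rewrite (@fsum_seqE _ _ _ S) // => [|j /mS ->]; last by rewrite comp0m fmap0 compm0.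
      under eq_bigr do rewrite fmapM compA.
      rewrite -comp_suml -(@fsum_seqE _ _ _ S) // => [|j /mS ->].
        by rewrite pm comp0m.
      by rewrite fmap0 compm0.
  have [i0 [phi]] := sP B; have [S [uS bS]] := fin_supp_seq bf.
  have wf : fin_supp (fun j => b j ∘ iso_from phi).
    by apply: (@seq_fin_supp _ _ _ S) => j /bS ->; rewrite comp0m.
  have w0 : \sum_(j \in setT) p j ∘ fmap iota' (b j ∘ iso_from phi) = 0.
    rewrite (@fsum_seqE _ _ _ S) // => [|j /bS ->]; last by rewrite comp0m fmap0 compm0.
    under eq_bigr do rewrite fmapM compA.
    rewrite -comp_suml -(@fsum_seqE _ _ _ S) // => [|j /bS ->].
      by rewrite b0 comp0m.
    by rewrite fmap0 compm0.
  pose k : I := exist _ (existT _ i0 _) (conj wf w0).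
  have [a [af _ _ aE]] := @dsum_point I (fun i => Mor B (XI i)) k (iso_to phi).
  exists a; split=> // j.
  by rewrite (aE _ (fun i u => m i j ∘ u)) => [|i]; [rewrite iso_toKr | exact: comp_zmod_r].
- move=> x; have [A [a [b ->]]] := tens_surj Ht x; have [j0 [phi]] := sP A.
  pose j : J := existT _ j0 (b ∘ fmap iota' (iso_from phi)).
  have [y [yf _ _ yE]] := @dsum_point J (fun j => Mor X (iota (Y j))) j (fmap iota (iso_to phi) ∘ a).
  exists y; split=> //; rewrite (yE _ (fun j y => pr (p j) (t y (idm (iota' (Y j)))))) // tpE.
  by rewrite bal /p /= -compA -fmapM iso_toK fmap1 compm1.
- move=> y yf; split=> [y0|[a [af ayE]]]; last first.
    rewrite (eq_fsbigr (fun j => pr (p j) (t (\sum_(i \in setT) fmap iota (m i j) ∘ a i)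
        (idm (iota' (Y j)))))); last by move=> j _; rewrite ayE.
    apply: (@dsum_complex _ _ (fun i => Mor X (iota (XI i))) (fun j => Mor X (iota (Y j))) _
      (fun i j u => fmap iota (m i j) ∘ u) (fun j y => pr (p j) (t y (idm (iota' (Y j)))))) => // [i j|i x|i x].
    + exact: comp_zmod_r.
    + have [S [_ mS]] := fin_supp_seq (mfin i).
      by apply: (@seq_fin_supp _ _ _ S) => j /mS ->; rewrite fmap0 comp0m.
    + have [S [uS mS]] := fin_supp_seq (mfin i).
      rewrite (@fsum_seqE _ _ _ S) // => [|j /mS ->]; last first.
        by rewrite fmap0 comp0m; exact: zmorph0 (tB j).
      under eq_bigr do rewrite tpE bal.
      rewrite -tens_sumr -(@fsum_seqE _ _ _ S) // => [|j /mS ->].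
        by rewrite pm (balanced0r (tens_balanced Ht X Z)).
      by rewrite fmap0 compm0.
  have [S [uS yS]] := fin_supp_seq yf.
  have [A [z [q qE]]] := tens_gather y S.
  have [|B [v [c [zE bv]]]] := tens_conull Ht (a := z) (b := \sum_(j <- S) p j ∘ fmap iota' (q j)).
    rewrite tens_sumr -[RHS]y0 (@fsum_seqE _ _ _ S) // => [|j /yS ->]; last exact: zmorph0 (tB j).
    by apply: eq_big_seq => j jS; rewrite -bal -qE //; exact: esym (tpE _ _).
  have [i0 [phi]] := sP B.
  (* Nothing is known about q outside S; the value zero there makes w finitely supported. *)
  pose w j : Mor (s i0) (Y j) := if j \in S then q j ∘ v ∘ iso_from phi else 0.
  have wS j : j \notin S -> w j = 0 by rewrite /w => /negPf ->.
  have wf : fin_supp w by exact: seq_fin_supp wS.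
  have w0 : \sum_(j \in setT) p j ∘ fmap iota' (w j) = 0.
    rewrite (@fsum_seqE _ _ _ S) // => [|j /wS ->]; last by rewrite fmap0 compm0.
    rewrite (@eq_big_seq _ _ _ _ _ _ (fun j => p j ∘ fmap iota' (q j) ∘ fmap iota' (v ∘ iso_from phi))).
      by rewrite -comp_suml fmapM compA bv comp0m.
    by move=> j jS; rewrite /w jS -compA fmapM compA.
  pose k : I := exist _ (existT _ i0 _) (conj wf w0).
  have [a [af _ _ aE]] := @dsum_point I (fun i => Mor X (iota (XI i))) k (fmap iota (iso_to phi) ∘ c).
  exists a; split=> // j.
  rewrite (aE _ (fun i u => fmap iota (m i j) ∘ u)) => [|i]; last exact: comp_zmod_r.
  rewrite /m /= /w; case: ifP => [jS|/negbT /yS ->]; last by rewrite fmap0 comp0m.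
  by rewrite compA -fmapM iso_toKr fmapM -compA -zE -qE.
Qed.

End OfTensor.

Section ToTensor.
Variables (Phi : pairing C C') (alpha : forall (X : C) (Y : C0), Mor X (iota Y) -> Phi X (iota' Y)).
Hypothesis Halpha : is_coext_pairing alpha.

Definition coext_tens X Y A (a : Mor X (iota A)) (b : Mor (iota' A) Y) : Phi X Y :=
  pr b (alpha a).

Lemma coext_tens_balanced X Y : balanced (@coext_tens X Y).
Proof.
have [[aB _ aN] _] := Halpha.
split=> [A a a' b|A a b b'|A B f a b]; rewrite /coext_tens.
- by rewrite (zmorphD (aB X A)) (zmorphD (prB b)).
- exact: prD.
- by rewrite prM; congr (pr b _); exact: aN.
Qed.

Variables (Phi0 : pairing C C') (t : forall X Y A, Mor X (iota A) -> Mor (iota' A) Y -> Phi0 X Y).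
Hypothesis Ht : is_tensor t.

(** Expand b through the generators p of a presentation of Y. Vanishing in Phi makes the
    coefficients a combination of relations, and relations are null in every tensor pairing by
    balancing. *)
Lemma coext_tens_null X Y A (a : Mor X (iota A)) (b : Mor (iota' A) Y) :
  coext_tens a b = 0 -> t a b = 0.
Proof.
have [[aB _ aN] Hco] := Halpha; have tb := tens_balanced Ht X Y.
have [_ _ /(_ Y)[I [J [XI [YJ [m [p [mfin exrep exH]]]]]]]] := Hco X.
have [v [vf bE]] := (exrep A).1 b; have [S [uS vS]] := fin_supp_seq vf.
have {}bE : b = \sum_(j <- S) p j ∘ fmap iota' (v j).
  by rewrite bE; apply: fsum_seqE => // j /vS ->; rewrite fmap0 compm0.
pose y j : Mor X (iota (YJ j)) := fmap iota (v j) ∘ a.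
have yS j : j \notin S -> y j = 0 by rewrite /y => /vS ->; rewrite fmap0 comp0m.
have sumE (T : zmodType) (G : forall A, Mor X (iota A) -> Mor (iota' A) Y -> T) : balanced G ->
    G A a b = \sum_(j \in setT) G _ (y j) (p j).
  move=> Gb; rewrite bE (zmorph_sum (balanced_zmodr Gb a)) (@fsum_seqE _ _ _ S) //.
    by apply: eq_bigr => j _; have [_ _ ->] := Gb.
  by move=> j /yS ->; exact: (balanced0l Gb (p j)).
rewrite (sumE _ _ (@coext_tens_balanced X Y)) => e.
have [c [cf yE]] := (exH.2 y (seq_fin_supp yS)).1 e.
rewrite (sumE _ _ tb) (eq_fsbigr (fun j => t (\sum_(i \in setT) fmap iota (m i j) ∘ c i) (p j))); last first.
  by move=> j _; rewrite yE.
apply: (@dsum_complex _ _ (fun i => Mor X (iota (XI i))) (fun j => Mor X (iota (YJ j))) _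
  (fun i j u => fmap iota (m i j) ∘ u) (fun j y => t y (p j))) => // [i j|j|i x|i x].
- exact: comp_zmod_r.
- exact: (balanced_zmodl tb (p j)).
- have [R [_ mR]] := fin_supp_seq (mfin i).
  by apply: (@seq_fin_supp _ _ _ R) => j /mR ->; rewrite fmap0 comp0m.
- have [R [uR mR]] := fin_supp_seq (mfin i).
  rewrite (@fsum_seqE _ _ _ R) // => [|j /mR ->]; last first.
    by rewrite fmap0 comp0m; exact: (balanced0l tb (p j)).
  have [_ _ bal] := tb; under eq_bigr do rewrite bal.
  rewrite -(zmorph_sum (balanced_zmodr tb x)) -(@fsum_seqE _ _ _ R) // => [|j /mR ->]; last first.
    by rewrite fmap0 compm0.
  suff -> : \sum_(j \in setT) p j ∘ fmap iota' (m i j) = 0 by exact: (balanced0r tb x).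
  (* The relation [m i] is the image of the identity of [XI i], so exactness over C0 applies to
     it. *)
  apply/((exrep (XI i)).2 (m i) (mfin i)).
  have [u [uf _ _ uE]] := @dsum_point I (fun k => Mor (XI i) (XI k)) i (idm _).
  exists u; split=> // j; rewrite (uE _ (fun k u => m k j ∘ u)) ?compm1 // => k.
  exact: comp_zmod_r.
Qed.

Lemma coext_is_tensor : is_tensor coext_tens.
Proof.
have [[aB aL aN] Hco] := Halpha; split.
- exact: coext_tens_balanced.
- by move=> X X' Y A f a b; rewrite /coext_tens plr; congr (pr b _); exact: esym (aL _ _ _ f a).
- by move=> X Y Y' A g a b; rewrite /coext_tens prM.
- move=> X Y x; have [_ _ /(_ Y)[I [J [XI [YJ [m [p [_ _ [surj _]]]]]]]]] := Hco X.
  have [y [yf ->]] := surj x; have [S [uS yS]] := fin_supp_seq yf.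
  rewrite (@fsum_seqE _ _ _ S) // => [|j /yS ->]; last first.
    exact: (balanced0l (@coext_tens_balanced X Y) (p j)).
  elim: S {uS yS} => [|j S [A [a [b IH]]]].
    have [Z _] := pt_zero HC0; exists Z, 0, 0; rewrite big_nil.
    exact: esym (balanced0r (@coext_tens_balanced X Y) _).
  have [S' [f [g [k [r sE]]]]] := tensD HC0 (y j) (p j) a b.
  have {}sE := sE _ _ (@coext_tens_balanced X Y).
  by rewrite big_cons IH; do 3!eexists; exact: esym sE.
- by move=> X Y A a b /coext_tens_null; exact: tens_null.
- by move=> X Y A a b /coext_tens_null; exact: tens_conull.
Qed.

End ToTensor.

End Coextension.

(** * Duality *)

Lemma tfun_sh_nat_from (C D : tridata) (F : tri_functor C D) X Y (f : Mor X Y) :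
  fmap F (fmap sh f) ∘ iso_from (tfun_sh F X) = iso_from (tfun_sh F Y) ∘ fmap sh (fmap F f).
Proof. by rewrite -[LHS](iso_toKl (tfun_sh F Y)) (compA (iso_to _)) tfun_sh_nat iso_fromKr. Qed.

Section TensorDuality.
Variables (C C' C0 : tridata).
Hypotheses (HC : pretriangulated C) (HC' : pretriangulated C') (HC0 : pretriangulated C0).
Variables (iota : tri_functor C0 C) (iota' : tri_functor C0 C').
Variables (Phi : pairing C C') (t : forall X Y A, Mor X (iota A) -> Mor (iota' A) Y -> Phi X Y).
Hypothesis Ht : is_tensor t.

Lemma tens_bal X Y A B (f : Mor A B) (a : Mor X (iota A)) (b : Mor (iota' B) Y) :
  t (fmap iota f ∘ a) b = t a (b ∘ fmap iota' f).
Proof. by have [_ _ H] := tens_balanced Ht X Y; exact: H. Qed.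

Lemma tens0l X Y A (b : Mor (iota' A) Y) : t (0 : Mor X (iota A)) b = 0.
Proof. exact: (balanced0l (tens_balanced Ht X Y) b). Qed.

Lemma tens0r X Y A (a : Mor X (iota A)) : t a (0 : Mor (iota' A) Y) = 0.
Proof. exact: (balanced0r (tens_balanced Ht X Y) a). Qed.

(** Apply the description of zero to the difference, formed over a biproduct: the two components of
    the resulting u are q and - q'. *)
Lemma tens_eq X Y A B (a : Mor X (iota A)) (b : Mor (iota' A) Y)
    (a' : Mor X (iota B)) (b' : Mor (iota' B) Y) : t a b = t a' b' ->
  exists E (q : Mor A E) (q' : Mor B E) (e : Mor (iota' E) Y),
    [/\ b = e ∘ fmap iota' q, b' = e ∘ fmap iota' q' & fmap iota q ∘ a = fmap iota q' ∘ a'].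
Proof.
move=> e; have tb := tens_balanced Ht X Y.
have [S [f [g [s [r [_ rf gs gf rs]]]]]] := split_extension HC0 A B.
have := balanced_sum tb a b a' (- b') rf gs gf rs.
rewrite (balancedNr tb) e subrr => /(tens_null Ht)[E [u [d [bE ua]]]].
exists E, (u ∘ f), (- (u ∘ s)), d; split.
- rewrite fmapM compA -bE compDl -!compA -!fmapM rf gf.
  by rewrite fmap1 fmap0 compm1 compm0 addr0.
- rewrite fmapN fmapM compmN compA -bE compDl -!compA -!fmapM rs gs.
  by rewrite fmap1 fmap0 compm1 compm0 add0r opprK.
- apply: subr0_eq; rewrite -[RHS]ua fmapN compNm opprK compDr.
  by rewrite !fmapM !compA.
Qed.

(** Once a is v after c with [g ∘ b] vanishing along v, the restriction of b along v lifts to the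
    source of f, and balancing moves v back. *)
Lemma tensor_homological X : homological (pairing_r Phi X).
Proof.
move=> Y Y' Z f g h d y; split=> [|[x ->]]; last first.
  by rewrite -amapM (dist_comp0 HC' d) amap0x.
have [A [a [b ->]]] := tens_surj Ht y; rewrite /= (tens_pr Ht).
move=> /(tens_conull Ht)[B [v [c [-> bv]]]].
have [|e eE] := dist_lift HC' (y := b ∘ fmap iota' v) d; first by rewrite compA.
by exists (t c e); rewrite (tens_pr Ht) tens_bal eE.
Qed.

(** The identity factors through the map u that kills f, and full faithfulness makes this a left
    inverse of u in C0. *)
Lemma tens_id_inj X A (f : Mor X (iota A)) : fully_faithful iota' -> t f (idm (iota' A)) = 0 -> f = 0.
Proof.
move=> ff' /(tens_null Ht)[B [u [d [e uf]]]].
have [d' dE] := ff_full ff' d; move: e; rewrite dE -fmapM -fmap1 => /(ff_inj ff') e.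
by rewrite -[f]comp1m -(fmap1 iota) e fmapM -compA uf compm0.
Qed.

Definition tens_sh X Y A (a : Mor X (iota A)) (b : Mor (iota' A) Y) : Phi (sh X) (sh Y) :=
  t (iso_from (tfun_sh iota A) ∘ fmap sh a) (fmap sh b ∘ iso_to (tfun_sh iota' A)).

Lemma tens_sh_balanced X Y : balanced (@tens_sh X Y).
Proof.
have [Dl Dr _] := tens_balanced Ht (sh X) (sh Y).
split=> [A a a' b|A a b b'|A B f a b]; rewrite /tens_sh.
- by rewrite fmapD compDr Dl.
- by rewrite fmapD compDl Dr.
- rewrite !fmapM compA -tfun_sh_nat_from -compA tens_bal -!compA.
  by rewrite tfun_sh_nat.
Qed.

Lemma tens_sh_null X Y A (a : Mor X (iota A)) (b : Mor (iota' A) Y) :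
  tens_sh a b = 0 -> t a b = 0.
Proof.
move=> /(tens_null Ht)[B [u [d [bE ua]]]].
(* Since B is a shift up to isomorphism, u and d come from maps u' and d' through [unsh B]. *)
have [u' uE] := sh_full HC0 (iso_from (sh_unsh B) ∘ u).
have [d' dE] := sh_full HC' (d ∘ fmap iota' (iso_to (sh_unsh B)) ∘ iso_from (tfun_sh iota' (unsh B))).
have -> : b = d' ∘ fmap iota' u'.
  apply: (sh_faithful HC'); rewrite fmapM -dE -compA -tfun_sh_nat_from -uE.
  rewrite compA -[d ∘ _ ∘ _]compA -fmapM iso_fromKl -bE iso_fromKr //.
rewrite -tens_bal; suff -> : fmap iota u' ∘ a = 0 by rewrite tens0l.
apply: (sh_faithful HC); rewrite fmap0 fmapM.
rewrite -[fmap sh (fmap iota u')](iso_fromKl (tfun_sh iota _)) -tfun_sh_nat_from -uE.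
by rewrite fmapM -!compA ua !compm0.
Qed.

Lemma tens_sh_surj X Y (x : Phi (sh X) (sh Y)) :
  exists A (a : Mor X (iota A)) (b : Mor (iota' A) Y), x = tens_sh a b.
Proof.
have [A [a [b ->]]] := tens_surj Ht x; set e := sh_unsh A.
have [a' aE] := sh_full HC (iso_to (tfun_sh iota (unsh A)) ∘ fmap iota (iso_from e) ∘ a).
have [b' bE] := sh_full HC' (b ∘ fmap iota' (iso_to e) ∘ iso_from (tfun_sh iota' (unsh A))).
exists (unsh A), a', b'; rewrite /tens_sh -aE -bE iso_toKr -compA iso_toKl -tens_bal.
by rewrite compA -fmapM iso_fromK fmap1 comp1m.
Qed.

Lemma tensor_shift : exists sigma : shift_iso Phi,
  forall X Y A (a : Mor X (iota A)) (b : Mor (iota' A) Y), sigma X Y (t a b) = tens_sh a b.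
Proof.
have /choice_dep2[f fP] X Y : exists k : Phi X Y -> Phi (sh X) (sh Y),
    GRing.zmod_morphism k /\ forall A a b, k (t a b) = @tens_sh X Y A a b.
  exact: (tens_lift HC0 Ht (@tens_sh_balanced X Y)).
have fB X Y : GRing.zmod_morphism (f X Y) := (fP X Y).1.
have fE X Y A a b : f X Y (t a b) = @tens_sh X Y A a b := (fP X Y).2 A a b.
have fbij X Y : bijective (f X Y).
  apply: inj_surj_bij => [|y].
    apply: (zmorph_inj (fB X Y)) => x; have [A [a [b ->]]] := tens_surj Ht x.
    by rewrite fE; exact: tens_sh_null.
  by have [A [a [b ->]]] := tens_sh_surj y; exists (t a b).
have /choice_dep2[g gP] X Y : exists k : Phi (sh X) (sh Y) -> Phi X Y,
    cancel (f X Y) k /\ cancel k (f X Y).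
  by case: (fbij X Y) => k fK kK; exists k.
have fN : @pairing_morphism C C' Phi (pull sh sh Phi) f.
  split=> [//|X X' Y l x|X Y Y' l x]; have [A [a [b ->]]] := tens_surj Ht x.
    by rewrite /= (tens_pl Ht) !fE (tens_pl Ht) /tens_sh fmapM compA.
  by rewrite /= (tens_pr Ht) !fE (tens_pr Ht) /tens_sh fmapM compA.
exists (@ShiftIso C C' Phi f g (fun X Y => (gP X Y).1) (fun X Y => (gP X Y).2) fN).
exact: fE.
Qed.

(* A compatible pair of elements lifts to a map u of C0, whose cone provides the
   third component. *)
Lemma tensor_nice (sigma : shift_iso Phi) :
  (forall X Y A (a : Mor X (iota A)) (b : Mor (iota' A) Y), sigma X Y (t a b) = tens_sh a b) ->
  is_nice sigma.
Proof.
move=> sigmaE A B D l m n X Y Z f g h dl df a b ab.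
have [K [al [xi aE]]] := tens_surj Ht a; have [L [be [eta bE]]] := tens_surj Ht b.
have /tens_eq : t al (f ∘ xi) = t (be ∘ l) eta.
  by rewrite -(tens_pr Ht) -(tens_pl Ht) -aE -bE; exact: subr0_eq ab.
move=> [W [u [u' [d [fxi etaE uE]]]]].
have {}bE : b = t (fmap iota u' ∘ be) d by rewrite bE etaE tens_bal.
have [V [w [v du]]] := pt_cone HC0 u.
have [|ga [wga vga]] := pt_mor HC (a := al) (b := fmap iota u' ∘ be) dl (tfun_dist iota du).
  by rewrite uE compA.
have [ze [gd hze]] := pt_mor HC' (a := xi) (b := d) (tfun_dist iota' du) df fxi.
exists (t ga ze); split; [exact: ab | |]; apply/eqP; rewrite subr_eq0; apply/eqP.
  by rewrite bE (tens_pr Ht) (tens_pl Ht) gd -wga (tens_bal w).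
(* The last identity is checked after applying the injective map sigma, which undoes the
   desuspension. *)
rewrite /desuspend; apply: (can_inj (@si_toK _ _ _ sigma _ _)); rewrite si_fromK.
have [_ sl _] := si_natural sigma; rewrite sl /= (fmap_sh_unsh_hom HC) plM.
rewrite aE sigmaE /tens_sh (tens_pr Ht) hze compA -tens_bal (tens_pl Ht n); congr (pl _ (t _ _)).
by rewrite -[LHS](iso_toKl (tfun_sh iota K)) (compA (iso_to _)) vga compA.
Qed.

Section Determining.
Hypotheses (ff_iota : fully_faithful iota) (ff_iota' : fully_faithful iota').

Let alpha0 (A B : C0) (f : Mor A B) : Phi (iota A) (iota' B) := t (fmap iota f) (idm _).

Lemma tensor_pairing_iso : @pairing_iso C0 C0 (hom_pairing C0) (pull iota iota' Phi) alpha0.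
Proof.
have aB A B : GRing.zmod_morphism (@alpha0 A B).
  move=> f g; rewrite /alpha0 fmapB.
  exact: (balanced_zmodl (tens_balanced Ht _ _) (idm (iota' B))).
split=> [|A B].
  split=> [//|A A' B f x|A B B' g x]; rewrite /alpha0 /= fmapM.
    by rewrite (tens_pl Ht).
  by rewrite tens_bal (tens_pr Ht) comp1m compm1.
apply: inj_surj_bij => [|y].
  apply: (zmorph_inj (aB A B)) => f /(tens_id_inj ff_iota').
  by rewrite -(fmap0 iota) => /(ff_inj ff_iota).
have [D [a [b ->]]] := tens_surj Ht y.
have [a' ->] := ff_full ff_iota a; have [b' ->] := ff_full ff_iota' b.
by exists (b' ∘ a'); rewrite /alpha0 fmapM tens_bal comp1m.
Qed.

Lemma tensor_vanishes_l : vanishes Phi (lperp (image_class iota)) (fun=> True).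
Proof.
move=> X Y XP _ x; have [A [a [b ->]]] := tens_surj Ht x.
suff -> : a = 0 by exact: tens0l.
by apply: (XP (iota A)); exists A.
Qed.

Lemma tensor_vanishes_r : vanishes Phi (fun=> True) (rperp (image_class iota')).
Proof.
move=> X Y _ YP x; have [A [a [b ->]]] := tens_surj Ht x.
suff -> : b = 0 by exact: tens0r.
by apply: (YP (iota' A)); exists A.
Qed.

End Determining.

End TensorDuality.

(** * Comparison with other dualities *)

Section Uniqueness.
Variables (C C' C0 : tridata).
Hypotheses (HC : pretriangulated C) (HC' : pretriangulated C') (HC0 : pretriangulated C0).
Hypotheses (prodC : has_products C) (coprodC' : has_coproducts C') (smallC0 : essentially_small C0).
Variables (iota : tri_functor C0 C) (iota' : tri_functor C0 C').
Hypotheses (ff_iota : fully_faithful iota) (ff_iota' : fully_faithful iota').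
Hypothesis cocompactC0 : forall Y : C0, cocompact (iota Y).
Hypothesis compactC0 : forall Y : C0, compact (iota' Y).
Variables (Phi : pairing C C') (t : forall X Y A, Mor X (iota A) -> Mor (iota' A) Y -> Phi X Y).
Hypothesis Ht : is_tensor t.
Variables (Psi : pairing C C') (beta : forall A B : C0, Mor A B -> Psi (iota A) (iota' B)).
Hypotheses (dualPsi : is_duality Psi) (detPsi : determining beta).

Lemma essentially_small_op : essentially_small (op C0).
Proof.
have [J [s sP]] := smallC0; exists J, s => A; have [j [i]] := sP A.
by exists j; split; exact: op_iso i.
Qed.

Lemma determined_r X Y : computed iota' (pairing_r Psi X) Y.
Proof.
have [_ cr _ _ vr] := detPsi; apply: (good_functor_computed HC0 HC' ff_iota') => //.
  by move=> A; apply: compact_fs.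
by split=> [||Z ZP x]; [exact: dualPsi.1 | exact: cr | exact: vr].
Qed.

Lemma determined_l X Y :
  computed (op_tri_functor HC0 HC iota) (pairing_l Psi Y : ab_functor (op_tri C)) X.
Proof.
have [cl _ _ vl _] := detPsi.
apply: (good_functor_computed (pretriangulated_op HC0) (pretriangulated_op HC)) => //.
- by move=> A B; exact: ff_iota.
- by move=> A; exact: (cocompact_fs (cocompactC0 A)).
- exact: essentially_small_op.
- split=> [A B D f g h /op_distP d b|I Z S inj|Z ZP x].
  + exact: (dualPsi.2 Y D B A g f _ d b).
  + exact: cl.
  + exact: (vl Z Y ZP).
Qed.

(** This value is forced: a natural map that sends the tensors of identities to [beta (idm A)] takes
    the tensor of a and b to it. *)
Let pure X Y A (a : Mor X (iota A)) (b : Mor (iota' A) Y) : Psi X Y :=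
  pl a (pr b (beta (idm A))).

Lemma beta_pl A B (f : Mor A B) : beta f = pl (fmap iota f) (beta (idm B)).
Proof.
have [_ _ [[_ bl _] _] _ _] := detPsi.
by have := bl _ _ _ f (idm B); rewrite /= comp1m.
Qed.

Lemma beta_pr A B (f : Mor A B) : beta f = pr (fmap iota' f) (beta (idm A)).
Proof.
have [_ _ [[_ _ br] _] _ _] := detPsi.
by have := br _ _ _ f (idm A); rewrite /= compm1.
Qed.

Lemma pure_balanced X Y : balanced (@pure X Y).
Proof.
split=> [A a a' b|A a b b'|A B f a b]; rewrite /pure.
- exact: plD.
- by rewrite prD (zmorphD (plB a)).
- by rewrite plM plr -beta_pl prM -beta_pr.
Qed.

(** Reduce first Y, then X, to objects of C0, where beta is onto. *)
Lemma pure_surj X Y (x : Psi X Y) : exists A a b, x = @pure X Y A a b.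
Proof.
have [A [b [z ->]]] := (determined_r X Y).1 x.
have [B [a [w ->]]] := (determined_l X (iota' A)).1 z.
have [_ _ [_ /(_ B A)[k _ bK]] _ _] := detPsi.
exists A, (fmap iota (k w) ∘ a), b; rewrite /pure plM plr -beta_pl bK /=.
by rewrite plr.
Qed.

(** Computing in Y replaces a by its composite with u, which kills the identity element of D.
    Computing in X writes this composite as v after c with [beta v = 0], and injectivity of beta
    gives v = 0. *)
Lemma pure_null X Y A (a : Mor X (iota A)) (b : Mor (iota' A) Y) : pure a b = 0 -> t a b = 0.
Proof.
rewrite /pure plr => /((determined_r X Y).2 A)[D [u [d [-> uz]]]].
rewrite -(tens_bal Ht); suff -> : fmap iota u ∘ a = 0 by exact: tens0l.
have uaz : pl (fmap iota u ∘ a) (beta (idm D)) = 0.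
  by rewrite plM -beta_pl beta_pr plr.
have [B [v [c [-> vz]]]] := (determined_l X (iota' D)).2 D _ _ uaz.
have [_ _ [[bB _ _] /(_ B D)/bij_inj bI] _ _] := detPsi.
suff v0 : (v : @Mor C0 B D) = 0.
  by rewrite v0; change (fmap iota (0 : @Mor C0 B D) ∘ (c : @Mor C X (iota B)) = 0);
    rewrite fmap0 comp0m.
by apply: bI; rewrite (zmorph0 (bB B D)) beta_pl; exact: vz.
Qed.

Let alpha0 (A B : C0) (f : Mor A B) : Phi (iota A) (iota' B) := t (fmap iota f) (idm _).

Lemma determining_unique (sigma : shift_iso Phi) (tau : shift_iso Psi) :
  (forall X Y A (a : Mor X (iota A)) (b : Mor (iota' A) Y),
     sigma X Y (t a b) = tens_sh t a b) ->
  exists gamma : forall (X : C) (Y : C'), Phi X Y -> Psi X Y,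
    [/\ pairing_iso gamma,
        forall (A B : C0) (f : Mor A B), gamma _ _ (alpha0 f) = beta f,
        forall gamma' : forall (X : C) (Y : C'), Phi X Y -> Psi X Y,
          pairing_morphism gamma' ->
          (forall (A B : C0) (f : Mor A B), gamma' _ _ (alpha0 f) = beta f) ->
          forall (X : C) (Y : C') x, gamma' X Y x = gamma X Y x &
        respects_shift tau beta ->
          forall (X : C) (Y : C') x, gamma _ _ (sigma X Y x) = tau X Y (gamma X Y x)].
Proof.
move=> sigmaE.
have /choice_dep2[f fP] X Y : exists k : Phi X Y -> Psi X Y,
    GRing.zmod_morphism k /\ forall A a b, k (t a b) = @pure X Y A a b.
  exact: (tens_lift HC0 Ht (@pure_balanced X Y)).
have fB X Y : GRing.zmod_morphism (f X Y) := (fP X Y).1.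
have fE X Y A a b : f X Y (t a b) = @pure X Y A a b := (fP X Y).2 A a b.
exists f; split.
- split.
    split=> [//|X X' Y l x|X Y Y' l x]; have [A [a [b ->]]] := tens_surj Ht x.
      by rewrite (tens_pl Ht) !fE /pure plM.
    by rewrite (tens_pr Ht) !fE /pure prM plr.
  move=> X Y; apply: inj_surj_bij => [|y].
    apply: (zmorph_inj (fB X Y)) => x; have [A [a [b ->]]] := tens_surj Ht x.
    by rewrite fE; exact: pure_null.
  by have [A [a [b ->]]] := pure_surj y; exists (t a b).
- by move=> A B u; rewrite fE /pure pr1 -beta_pl.
- move=> f' [_ f'l f'r] f'E X Y x; have [A [a [b ->]]] := tens_surj Ht x.
  rewrite fE /pure -f'E -f'r -f'l /alpha0 fmap1 (tens_pr Ht) (tens_pl Ht).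
  by rewrite compm1 comp1m.
- move=> tb X Y x; have [A [a [b ->]]] := tens_surj Ht x.
  have [_ tl tr] := si_natural tau.
  rewrite sigmaE fE fE /pure tl tr /= plM prM; have := tb A A (idm A).
  rewrite fmap1 => ->; rewrite plr; congr (pl _ (pr _ _)).
  by rewrite -plM iso_fromK pl1.
Qed.

End Uniqueness.

(** * Reflection and orthogonality *)

(** Functoriality and additivity of L follow from the uniqueness in the universal arrows. *)
Lemma left_adjoint_ex (C D : preadditive) (G : functor D C) :
  (forall X : C, exists (R : D) (eta : Mor X (G R)),
     forall (Y : D) (f : Mor X (G Y)), exists! g : Mor R Y, fmap G g ∘ eta = f) ->
  exists L : functor C D, is_left_adjoint L G.
Proof.
move=> /choice[R] /choice_dep[eta univ].
have ext X Y (g g' : Mor (R X) Y) : fmap G g ∘ eta X = fmap G g' ∘ eta X -> g = g'.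
  move=> e; have [k [_ kU]] := univ X Y (fmap G g ∘ eta X).
  by rewrite -(kU g erefl) -(kU g' (esym e)).
have /choice_dep2[l lE] X Y : exists l : Mor X Y -> Mor (R X) (R Y),
    forall f, fmap G (l f) ∘ eta X = eta Y ∘ f.
  have /choice[l lE] f : exists g : Mor (R X) (R Y), fmap G g ∘ eta X = eta Y ∘ f.
    by have [g [gE _]] := univ X (R Y) (eta Y ∘ f); exists g.
  by exists l.
have l1 X : l X X (idm X) = idm (R X).
  by apply: ext; rewrite lE fmap1 compm1 comp1m.
have lM X Y Z (g : Mor Y Z) (f : Mor X Y) : l X Z (g ∘ f) = l Y Z g ∘ l X Y f.
  by apply: ext; rewrite lE fmapM -compA lE !compA lE.
have lD X Y (f g : Mor X Y) : l X Y (f + g) = l X Y f + l X Y g.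
  by apply: ext; rewrite lE fmapD compDl !lE compDr.
exists (@Functor C D R l l1 lM lD), eta; split; last exact: univ.
by move=> X X' f; rewrite /= lE.
Qed.

(** * The colocalizing subcategory and its reflection *)

Section Colocalizing.
Variable D : tridata.
Hypothesis HD : pretriangulated D.
Variable S : D -> Prop.

Lemma cogenerated_colocalizing : is_colocalizing (cogenerated S).
Proof.
split.
- by move=> X Y i SX E cE SE; exact: (coloc_strict cE i (SX E cE SE)).
- by move=> Z Z0 E cE SE; exact: (coloc_zero cE Z0).
- by move=> X; exact: cogenerated_sh.
- by move=> X; exact: cogenerated_unsh.
- move=> X Y Z f g h d SX SY E cE SE.
  exact: (coloc_cone cE d (SX E cE SE) (SY E cE SE)).
- move=> I X T inj cT SX E cE SE.
  exact: (coloc_products cE cT (fun i => SX i E cE SE)).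
Qed.

Lemma cogenerated_ext (X Y Z : D) (f : Mor X Y) (g : Mor Y Z) (h : Mor Z (sh X)) :
  dist f g h -> cogenerated S X -> cogenerated S Z -> cogenerated S Y.
Proof.
move=> /(dist_back HD) d SX SZ.
exact: (coloc_cone cogenerated_colocalizing d (cogenerated_unsh SZ) SX).
Qed.

Lemma cogenerated_strongly_ext : @strongly_ext_closed (op_tri D) (cogenerated S).
Proof.
apply: (strongly_ext_closed_of (pretriangulated_op HD)).
- by move=> Z Z0; exact: (coloc_zero cogenerated_colocalizing Z0).
- by move=> X Y Z f g h /op_distP d SX SZ; exact: cogenerated_ext d SZ SX.
- by move=> X; exact: cogenerated_unsh.
- exact: (coloc_products cogenerated_colocalizing).
Qed.

End Colocalizing.

Section Reflection.
Variables (C C' C0 : tridata).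
Hypotheses (HC : pretriangulated C) (HC0 : pretriangulated C0).
Hypotheses (prodC : has_products C) (smallC0 : essentially_small C0).
Variables (iota : tri_functor C0 C) (iota' : tri_functor C0 C').
Hypothesis cocompactC0 : forall Y : C0, cocompact (iota Y).

Let HopC := pretriangulated_op HC.
Let objC0 : C -> Prop := image_class iota.

Lemma lperp_image_sh K : lperp objC0 K -> lperp objC0 (sh K).
Proof.
apply: (rperp_unsh HopC) => _ [A ->]; exists (iota (unsh A)); first by exists (unsh A).
by split; exact: op_iso (iso_sym (tfun_unsh iota A)).
Qed.

Lemma lperp_image_unsh K : lperp objC0 K -> lperp objC0 (unsh K).
Proof.
apply: (rperp_sh HopC) => _ [A ->]; exists (iota (sh A)); first by exists (sh A).
by split; exact: op_iso (iso_trans (fmap_iso iota (iso_sym (unsh_sh A))) (tfun_unsh iota (sh A))).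
Qed.

(** This bounds the cogenerated subcategory from above, since the double orthogonal contains C0.
    Closure under shifts rests on the stability of C0 under [1] and [-1]. *)
Lemma rperp_lperp_colocalizing : is_colocalizing (rperp (lperp objC0)).
Proof.
split.
- by move=> X Y i; exact: rperp_iso.
- by move=> Z Z0 K _ f; exact: to_zero.
- move=> X; apply: (rperp_sh HC) => K KP; exists (unsh K); first exact: lperp_image_unsh.
  by split; exact: iso_sym (sh_unsh K).
- move=> X; apply: (rperp_unsh HC) => K KP; exists (sh K); first exact: lperp_image_sh.
  by split; exact: iso_refl.
- move=> X Y Z f g h d XP YP K KP u.
  have shX : rperp (lperp objC0) (sh X).
    apply: (rperp_sh HC) XP => B BP; exists (unsh B); first exact: lperp_image_unsh.
    by split; exact: iso_sym (sh_unsh B).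
  have [y ->] := dist_lift' HC d (shX K KP (h ∘ u)).
  by rewrite (YP K KP y) compm0.
- move=> I X T inj cT XP K KP f; apply: (coprod_ext cT) => i.
  rewrite (comp0m (C := op C)); exact: (XP i K KP).
Qed.

Lemma cogenerated_rperp Y : cogenerated objC0 Y -> rperp (lperp objC0) Y.
Proof.
apply; first exact: rperp_lperp_colocalizing.
by move=> _ [A ->] K KP f; apply: (KP (iota A)); exists A.
Qed.

(** This is [compact_approx] in the opposite category. For P a set of representatives of C0 it
    yields the reflection; for the given P it yields torsion triangles whose right term lies in the
    colocalizing subcategory. *)
Lemma cocompact_approx (I : choiceType) (P : I -> C0) M :
  exists (K E : C) (f : Mor K M) (g : Mor M E) (h : Mor E (sh K)),
  [/\ dist f g h, lperp (image_class (fun i => iota (P i))) K, cogenerated objC0 E &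
      @strong_ext_closure (op_tri C) (image_class (fun i => iota (P i))) E].
Proof.
have [E [K [f [g [h [d KP EQ]]]]]] := compact_approx HopC prodC
  (fun i => cocompact_fs (cocompactC0 (P i))) M.
exists K, E, g, f; move: d => /op_distP d; eexists; split; first exact: d.
- exact: KP.
- apply: EQ => [||i]; first exact: cogenerated_strongly_ext.
    exact: (coloc_products (cogenerated_colocalizing objC0)).
  by move=> Q _ QP; apply: QP; exists (P i).
- move=> Q Qs _ Qc QP; apply: EQ => // i; apply: QP; by exists i.
Qed.

(** M -> E is universal because neither K nor K[1] has nonzero maps to the subcategory: K gives
    existence, K[1] uniqueness. *)
Lemma colocalizing_left_adjoint :
  exists L : functor C (colocalizing_sub objC0), is_left_adjoint L (colocalizing_incl objC0).
Proof.
apply: left_adjoint_ex => M; have [J [s sP]] := smallC0.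
have [K [E [f [g [h [d KP cE _]]]]]] := cocompact_approx s M.
have {}KP : lperp objC0 K.
  move=> _ [A ->] u; have [j [i]] := sP A.
  apply: (can_inj (fun v => iso_toKl (fmap_iso iota i) v)).
  by rewrite compm0; apply: (KP (iota (s j))); exists j.
exists (exist _ E cE), g => -[Y cY] /= u.
have YP := cogenerated_rperp cY.
have [v vE] := dist_extend HC d (YP K KP (u ∘ f)).
exists v; split=> // v' v'E; apply: subr0_eq.
have [|w ->] := dist_extend' HC (z := v - v') d; first by rewrite compBl -vE v'E subrr.
by rewrite (YP _ (lperp_image_sh KP) w) comp0m.
Qed.

Variables (Phi : pairing C C') (t : forall X Y A, Mor X (iota A) -> Mor (iota' A) Y -> Phi X Y).
Hypothesis Ht : is_tensor t.

(** Every map X -> iota A factors uniquely through the unit, so precomposition with the unit is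
    bijective on tensors; gamma is its inverse. *)
Lemma pairing_reflection (L : functor C (colocalizing_sub objC0)) :
  is_left_adjoint L (colocalizing_incl objC0) ->
  exists gamma : forall (X : C) (Y : C'),
      Phi X Y -> pull (colocalizing_incl objC0) (idf C') Phi (L X) Y,
    @pairing_iso C C' Phi
      (pull L (idf C') (pull (colocalizing_incl objC0) (idf C') Phi)) gamma.
Proof.
move=> [eta [etaN univ]].
have inC0 A : cogenerated objC0 (iota A) by move=> Q _; apply; exists A.
pose k X Y : Phi (sval (L X)) Y -> Phi X Y := pl (eta X).
have kB X Y : GRing.zmod_morphism (k X Y) := plB (eta X).
have kI X Y : injective (k X Y).
  apply: (zmorph_inj (kB X Y)) => x; have [A [a [b ->]]] := tens_surj Ht x.
  rewrite /k (tens_pl Ht) => /(tens_null Ht)[B [u [d [-> ua]]]].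
  rewrite -(tens_bal Ht); suff -> : fmap iota u ∘ a = 0 by exact: (tens0l Ht).
  have [v [_ vU]] := univ X (exist _ (iota B) (inC0 B)) 0.
  have <- : v = fmap iota u ∘ a by apply: vU; rewrite /= -compA.
  by apply: vU; rewrite /= comp0m.
have /choice_dep2[g gE] X Y : exists g : Phi X Y -> Phi (sval (L X)) Y, cancel g (k X Y).
  have /choice[g gE] x : exists y, k X Y y = x.
    have [A [a [b ->]]] := tens_surj Ht x.
    have [a' [a'E _]] := univ X (exist _ (iota A) (inC0 A)) a.
    by exists (t a' b); rewrite /k (tens_pl Ht); congr (t _ b).
  by exists g.
exists g; split; last first.
  by move=> X Y; exists (k X Y) => // x; apply: kI; rewrite gE.
split=> [X Y x y|X X' Y f x|X Y Y' f x]; apply: kI.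
- by rewrite kB !gE.
- rewrite gE /k /= -plM; have := etaN _ _ f; rewrite /= => <-.
  by rewrite plM; congr (pl f _); exact: esym (gE X Y x).
- by rewrite gE /k /= plr; congr (pr f _); exact: esym (gE X Y x).
Qed.

End Reflection.

Lemma envelope_op (D : tridata) (P : D -> Prop) X : pretriangulated D ->
  @envelope (op_tri D) P X <-> envelope P X.
Proof.
move=> HD; split=> EX Q Q0 Qr Qe QP; apply: EX => //.
- by move=> A B i r ri; exact: (Qr A B r i ri).
- by move=> A B Z f g h /op_distP d QA QZ; exact: (Qe _ _ _ _ _ _ d QZ QA).
- by move=> A B i r ri; exact: (Qr A B r i ri).
- move=> A B Z f g h d QA QZ; exact: (Qe _ _ _ _ _ _ (op_dist HD d) QZ QA).
Qed.

Lemma torsion_pair_op (D : tridata) (LO RO : D -> Prop) :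
  @torsion_pair (op_tri D) RO LO -> torsion_pair LO RO.
Proof.
move=> [H1 H2 H3]; split=> // M; have [R [L [f [g [h [RR LL /op_distP d]]]]]] := H3 M.
by exists L, R, g, f; eexists; split; last exact: d.
Qed.

(** * Orthogonality under the pairing *)

Section Orthogonality.
Variables (C C' C0 : tridata).
Hypotheses (HC : pretriangulated C) (HC' : pretriangulated C') (HC0 : pretriangulated C0).
Variables (iota : tri_functor C0 C) (iota' : tri_functor C0 C').
Hypothesis ff_iota' : fully_faithful iota'.
Hypothesis compactC0 : forall Y : C0, fs_compact (iota' Y).
Variables (Phi : pairing C C') (t : forall X Y A, Mor X (iota A) -> Mor (iota' A) Y -> Phi X Y).
Hypothesis Ht : is_tensor t.
Variables (I : Type) (P : I -> C0).

Lemma lperp_envelope X K : lperp (image_class (fun i => iota (P i))) X ->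
  envelope (image_class P) K -> forall f : Mor X (iota K), f = 0.
Proof.
move=> XP EK; apply: (EK (fun K => forall f : Mor X (iota K), f = 0)).
- by move=> Z Z0 f; apply: to_zero; exact: is_zero_fmap.
- move=> A B i r ri B0 f; rewrite -[f]comp1m -(fmap1 iota) -ri fmapM -compA.
  by rewrite (B0 (_ ∘ f)) compm0.
- move=> A B D f g h d A0 D0 u.
  have [|v ->] := dist_lift HC (y := u) (tfun_dist iota d); first exact: D0.
  by rewrite (A0 v) compm0.
- by move=> _ [i ->]; apply: XP; exists i.
Qed.

(** The map b passes through some K of the envelope, and balancing turns a into a map from X to iota
    K, which is zero. *)
Lemma vanishes_lperp : vanishes Phi (lperp (image_class (fun i => iota (P i))))
  (strong_ext_closure (image_class (fun i => iota' (P i)))).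
Proof.
move=> X Y XP YP x; have [A [a [b ->]]] := tens_surj Ht x.
have [K [u [v [EK ->]]]] := strong_ext_closure_factor HC0 HC' ff_iota' compactC0 b YP.
by rewrite -(tens_bal Ht) (lperp_envelope XP EK (_ ∘ a)) (tens0l Ht).
Qed.

(** The converse tests the objects [iota' (P i)], at which the pairing detects the maps from X to
    [iota (P i)]. *)
Lemma lperp_pairingP X : lperp (image_class (fun i => iota (P i))) X <->
  lperp_pairing Phi (strong_ext_closure (image_class (fun i => iota' (P i)))) X.
Proof.
split=> [XP Y YP x|XP _ [i ->] f]; first exact: (vanishes_lperp XP YP).
apply: (tens_id_inj Ht ff_iota'); apply: XP => Q _ _ _ QP.
by apply: QP; exists i.
Qed.

End Orthogonality.

(** The model only provides existence; the other statements are proved for an arbitrary coextension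
    pairing, and many of those about its first argument come from [Htop], its tensors over the
    opposite categories. *)
Theorem proposition5p3p1
  (C C' C0 : triangulated)
  (prodC : has_products C) (coprodC' : has_coproducts C')
  (smallC0 : essentially_small C0)
  (iota : tri_functor C0 C) (iota' : tri_functor C0 C')
  (ff_iota : fully_faithful iota) (ff_iota' : fully_faithful iota')
  (cocompactC0 : forall Y : C0, cocompact (iota Y))
  (compactC0 : forall Y : C0, compact (iota' Y))
  (IP : choiceType) (P_ : IP -> C0) :
  (exists (Phi : pairing C C') (alpha : forall (X : C) (Y : C0), Mor X (iota Y) -> Phi X (iota' Y)),
     is_coext_pairing alpha) /\
  forall (Phi : pairing C C') (alpha : forall (X : C) (Y : C0), Mor X (iota Y) -> Phi X (iota' Y)),
  is_coext_pairing alpha ->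
  let objC0 : C -> Prop := image_class iota in
  let E := colocalizing_sub objC0 in
  let incl : functor E C := colocalizing_incl objC0 in
  let PhiE : pairing E C' := pull incl (idf C') Phi in
  let alpha0 (A B : C0) (f : Mor A B) : Phi (iota A) (iota' B) :=
    alpha (iota A) B (fmap iota f) in
  let P : C0 -> Prop := image_class P_ in
  let PC : C -> Prop := image_class (fun i => iota (P_ i)) in
  let PC' : C' -> Prop := image_class (fun i => iota' (P_ i)) in
  let LO' : C' -> Prop := strong_ext_closure PC' in
  let RO' : C' -> Prop := rperp PC' in
  let LO : C -> Prop := lperp PC in
  let RO : C -> Prop := @strong_ext_closure (op_tri C) PC in
  let LOE (X : E) : Prop := LO (incl X) in
  let ROE (X : E) : Prop := RO (incl X) in
  (* 1 and 5 *)
  (exists sigma : shift_iso Phi,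
    [/\ extends_shift alpha sigma,
        is_duality Phi,
        is_nice sigma,
        determining alpha0 &
        forall (Psi : pairing C C') (tau : shift_iso Psi)
               (beta : forall A B : C0, Mor A B -> Psi (iota A) (iota' B)),
          is_duality Psi -> determining beta ->
          exists gamma : forall (X : C) (Y : C'), Phi X Y -> Psi X Y,
            [/\ pairing_iso gamma,
                forall (A B : C0) (f : Mor A B), gamma _ _ (alpha0 A B f) = beta A B f,
                forall gamma' : forall (X : C) (Y : C'), Phi X Y -> Psi X Y,
                  pairing_morphism gamma' ->
                  (forall (A B : C0) (f : Mor A B), gamma' _ _ (alpha0 A B f) = beta A B f) ->
                  forall (X : C) (Y : C') x, gamma' X Y x = gamma X Y x &
                respects_shift tau beta ->
                  forall (X : C) (Y : C') x, gamma _ _ (sigma X Y x) = tau X Y (gamma X Y x)]]) /\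
  (* 2 *)
  (exists L : functor C E,
     is_left_adjoint L incl /\
     exists gamma : forall (X : C) (Y : C'), Phi X Y -> PhiE (L X) Y,
       @pairing_iso C C' Phi (pull L (idf C') PhiE) gamma) /\
  (* 3 *)
  (forall (M : C) (N : C') (Q : quiver) (M_ : diagram Q C)
          (proj : forall v, Mor M (M_ v)),
     is_C0_limit iota proj ->
     @is_ab_colimit (op_quiver Q) (fun v => Phi (M_ v) N)
       (fun u v e => pl (dmap M_ e)) (Phi M N) (fun v => pl (proj v))) /\
  (forall N : C', respects_coproducts (pairing_l Phi N)) /\
  (* 4 *)
  (forall (M : C) (N : C') (Q : quiver) (N_ : diagram Q C')
          (inj : forall v, Mor (N_ v) N),
     is_C0_colimit iota' inj ->
     @is_ab_colimit Q (fun v => Phi M (N_ v))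
       (fun u v e => pr (dmap N_ e)) (Phi M N) (fun v => pr (inj v))) /\
  (forall M : C, homological (pairing_r Phi M) /\
                 respects_coproducts (pairing_r Phi M)) /\
  (* 6 *)
  smashing LO' RO' /\
  (* 7 *)
  cosmashing LO RO /\
  torsion_pair LOE ROE /\
  (* 8 *)
  left_orthogonal Phi LO RO LO' RO' /\
  left_orthogonal PhiE LOE ROE LO' RO' /\
  (forall X : C, LO X <-> lperp_pairing Phi LO' X) /\
  (forall X : E, LOE X <-> lperp_pairing PhiE LO' X) /\
  (* 9 *)
  (forall X : C0, LO' (iota' X) <-> envelope P X) /\
  (forall X : C0, RO (iota X) <-> envelope P X).
Proof.
have HC := triangulated_pre (tdataP C); have HC' := triangulated_pre (tdataP C').
have HC0 := triangulated_pre (tdataP C0).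
have HopC := pretriangulated_op HC; have HopC' := pretriangulated_op HC'.
have HopC0 := pretriangulated_op HC0.
have [J [s sP]] := smallC0.
have Ht0 := tpairing_is_tensor HC HC' HC0 iota iota' sP.
split; first by do 2!eexists; exact: (tens_coext_pairing HC0 Ht0 smallC0).
move=> Phi alpha Halpha objC0 E incl PhiE alpha0 P PC PC' LO' RO' LO RO LOE ROE.
have Ht : is_tensor (@coext_tens _ _ _ iota iota' Phi alpha).
  exact: (coext_is_tensor HC0 Halpha Ht0).
pose iotaop := op_tri_functor HC0 HC iota; pose iotaop' := op_tri_functor HC0 HC' iota'.
have Htop : @is_tensor (op_tri C') (op_tri C) (op_tri C0) iotaop' iotaop (op_pairing Phi) _ :=
  is_tensor_op Ht.
have ff_iotaop : fully_faithful iotaop by move=> A B; exact: ff_iota.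
have fsC0 A : fs_compact (iota' A) := compact_fs (compactC0 A).
have fsC0op A : fs_compact (iotaop A) := cocompact_fs (cocompactC0 A).
have tors' : smashing LO' RO'.
  exact: (compactly_generated_torsion_pair HC' coprodC' (fun i => fsC0 (P_ i))).
have torsop : @smashing (op_tri C) RO LO.
  exact: (compactly_generated_torsion_pair HopC prodC (fun i => fsC0op (P_ i))).
have tors : torsion_pair LO RO by apply: torsion_pair_op; case: torsop.
have vanL : vanishes Phi LO LO' := vanishes_lperp HC HC' HC0 ff_iota' fsC0 Ht (P := P_).
(* Over the opposite categories, with the arguments exchanged, the right classes become the left
   ones. *)
have vanR : vanishes Phi RO RO'.
  move=> X Y XR YR x.
  exact: (vanishes_lperp HopC' HopC HopC0 ff_iotaop fsC0op Htop (P := P_) YR XR).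
have colim := tensor_colimit HC0 Ht.
have cl N : respects_coproducts (pairing_l Phi N).
  exact: (tensor_respects_coproducts HopC0 Htop N cocompactC0).
have cr M : respects_coproducts (pairing_r Phi M).
  exact: (tensor_respects_coproducts HC0 Ht M compactC0).
split.
  have [sigma sigmaE] := tensor_shift HC HC' HC0 Ht.
  have alphaE (X : C) (A : C0) (a : Mor X (iota A)) : coext_tens alpha a (idm (iota' A)) = alpha X A a.
    by rewrite /coext_tens pr1.
  have alpha0E : alpha0 = (fun (A B : C0) (f : Mor A B) => coext_tens alpha (fmap iota f) (idm (iota' B))).
    do 3!(apply: functional_extensionality_dep => ?); exact: esym (alphaE _ _ _).
  exists sigma; split.
  - move=> X Y f; rewrite -(alphaE X Y f) sigmaE /tens_sh fmap1 comp1m.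
    by rewrite -alphaE (tens_pr Ht) compm1.
  - split=> [X|Y A B D l m n d b]; first exact: (tensor_homological HC' Ht).
    exact: (tensor_homological HopC Htop (op_dist HC d) b).
  - exact: (tensor_nice HC HC' HC0 Ht sigmaE).
  - rewrite alpha0E; split=> //.
    + exact: (tensor_pairing_iso Ht ff_iota ff_iota').
    + exact: (tensor_vanishes_l Ht).
    + exact: (tensor_vanishes_r Ht).
  - move=> Psi tau beta dPsi detPsi; rewrite alpha0E.
    exact: (determining_unique HC HC' HC0 prodC coprodC' smallC0 ff_iota ff_iota'
      cocompactC0 compactC0 Ht dPsi detPsi tau sigmaE).
split.
  have [L LA] := colocalizing_left_adjoint HC prodC smallC0 cocompactC0.
  by exists L; split=> //; exact: (pairing_reflection Ht LA).
split.
  move=> M N Q M_ proj lim.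
  (* A C0-limit is a C0-colimit in the opposite category, over the reversed quiver. *)
  pose M' : diagram (op_quiver Q) (op C) :=
    @Diagram (op_quiver Q) (op C) (dob M_) (fun u v e => dmap M_ e).
  exact: (tensor_colimit HopC0 Htop N (N_ := M') (inj := proj)
    (conj (fun u v e => lim.1 v u e) lim.2)).
split; first exact: cl.
split; first exact: colim.
split; first by move=> M; split=> //; exact: (tensor_homological HC' Ht).
split; first exact: tors'.
split; first by split=> //; case: torsop.
split.
  case: (tors) => [T1 T2 _].
  have approx (M : E) : exists (L R : E) (f : @Mor E L M) (g : @Mor E M R) (h : @Mor E R (sh L)),
      [/\ LOE L, ROE R & @dist E _ _ _ f g h].
    case: M => M EM.
    have [K [R [f [g [h [d KP ER RR]]]]]] := cocompact_approx HC prodC cocompactC0 P_ M.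
    (* K is an extension of M by the desuspension of R, both of which lie in E. *)
    have EK : cogenerated objC0 K.
      exact: (cogenerated_ext HC (dist_back HC d) (cogenerated_unsh ER) EM).
    by exists (exist _ K EK), (exist _ R ER), f, g, h.
  split=> [Y|X|//].
    split=> [/T1 YR X XL f|YR]; first exact: (YR _ XL).
    (* Orthogonality inside E makes f vanish, so Y is a retract of R, which is right orthogonal to
       all of LO and not only to its part in E. *)
    have [L [R [f [g [h [LL RR d]]]]]] := approx Y.
    have [|r rE] := dist_extend HC (y := idm (sval Y)) d.
      by rewrite (YR L LL f : f = 0) comp1m.
    apply/T1 => X XL u; rewrite -[u]comp1m rE -compA.
    by rewrite ((T1 _).1 RR X XL (@Defs.comp C X (sval Y) (sval R) g u)) compm0.
  split=> [XL Y YR f|XR _ [i ->]].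
    by have := (T2 _).1 XL _ YR f.
  (* The images of P lie both in E and in RO, so orthogonality to ROE includes orthogonality to
     them. *)
  have inE : cogenerated objC0 (iota (P_ i)) by move=> Q _; apply; exists (P_ i).
  apply: (XR (exist _ _ inE)) => Q _ _ _ QP; apply: QP; by exists i.
split; first by split.
split; first by split=> X Y; [exact: (vanL (sval X) Y) | exact: (vanR (sval X) Y)].
split; first exact: (lperp_pairingP HC HC' HC0 ff_iota' fsC0 Ht P_).
split; first by move=> X; exact: (lperp_pairingP HC HC' HC0 ff_iota' fsC0 Ht P_).
split=> X; first by apply: (strong_ext_closure_envelope HC0 HC' ff_iota' fsC0); case: tors'.
rewrite -(envelope_op _ _ HC0).
by apply: (strong_ext_closure_envelope HopC0 HopC ff_iotaop fsC0op); case: torsop.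
Qed.
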